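(* Let the Assumption stated in the context hold, let $\ell>0$, $\delta=\ell/\sqrt N$, let $x^0\in\mathcal H^s_\cap$ and $T>0$. Let $\{x^{k,N}\}_{k\ge0}$ be the MALA chain on $X^N$ started at $x^{0,N}=\mathcal P^N(x^0)$, and let $S^{(N)}$ be the continuous interpolant of the sequence $S^{k,N}=\frac1N\sum_{i=1}^N |x^{k,N}_i|^2/\lambda_i^2$, which is started at $S^{0,N}=\frac1N\sum_{i=1}^N|x^0_i|^2/\lambda_i^2$. Then, as $N\to\infty$, $S^{(N)}$ converges in probability in $C([0,T];\mathbb R)$ (uniform topology) to the solution $S(t)$ of the ODE $$dS(t)=b_\ell(S(t))\,dt,\qquad S(0)=\lim_{N\to\infty}S^{0,N},$$ where $b_\ell(s)=2\ell(1-s)\left(1\wedge e^{\ell^2(s-1)/2}\right)$.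
   Context: Spaces. $(\mathcal H,\langle\cdot,\cdot\rangle,\|\cdot\|)$ is a real separable infinite-dimensional Hilbert space, $\mathcal C$ a positive self-adjoint trace class operator on $\mathcal H$ with $\mathcal C\phi_j=\lambda_j^2\phi_j$, $\lambda_j>0$, where $\{\phi_j\}_{j\ge1}$ is an orthonormal basis of $\mathcal H$; $x_j:=\langle x,\phi_j\rangle$. For $r\in\mathbb R$, $\mathcal H^r$ is the Hilbert space with $\langle x,y\rangle_r=\sum_j j^{2r}x_jy_j$, $\|x\|_r^2=\sum_j j^{2r}x_j^2$; for $s\ge0$ the dual of $\mathcal H^s$ is identified with $\mathcal H^{-s}$ through $\langle\cdot,\cdot\rangle$. $X^N=\mathrm{span}\{\phi_1,\dots,\phi_N\}$, $\mathcal P^N(x)=\sum_{j=1}^N x_j\phi_j$, $\mathcal C_N=\mathcal P^N\mathcal C\mathcal P^N$, $\Psi^N=\Psi\circ\mathcal P^N$ (so $\nabla\Psi^N=\mathcal P^N\circ\nabla\Psi\circ\mathcal P^N$), and $\|x\|_{\mathcal C_N}^2=\sum_{j=1}^N x_j^2/\lambda_j^2$ on $X^N$. Assumption. (1) There is $\kappa>1/2$ with $\lambda_j\asymp j^{-\kappa}$. (2) There is $s\in[0,\kappa-1/2)$ such that $\Psi:\mathcal H^s\to\mathbb R$ is defined everywhere on $\mathcal H^s$. (3) $\Psi$ is differentiable with derivative $\nabla\Psi(x)\in\mathcal H^{-s}$, and there is a constant $K$ with $\|\nabla\Psi(x)\|_{-s}\le K$ and $\|\nabla\Psi(x)-\nabla\Psi(y)\|_{-s}\le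 K\|x-y\|_s$ for all $x,y\in\mathcal H^s$. This $s$ is fixed. MALA chain. The target $\pi^N$ on $X^N\cong\mathbb R^N$ has Lebesgue density proportional to $\exp(-\Psi^N(x)-\frac12\|x\|^2_{\mathcal C_N})$. Given $x^{k,N}\in X^N$, the proposal is $y^{k,N}=x^{k,N}-\delta(x^{k,N}+\mathcal C_N\nabla\Psi^N(x^{k,N}))+\sqrt{2\delta}\,\mathcal C_N^{1/2}\xi^{k,N}$ with $\xi^{k,N}=\sum_{j=1}^N\xi^{k,N}_j\phi_j$, $\xi_j^{k,N}$ i.i.d. $\mathcal N(0,1)$. The acceptance probability is $\alpha^N(x,y)=1\wedge\frac{\pi^N(y)q^N(y,x)}{\pi^N(x)q^N(x,y)}$ with $q^N(x,y)\propto\exp\left(-\frac1{4\delta}\|(y-x)+\delta(x+\mathcal C_N\nabla\Psi^N(x))\|^2_{\mathcal C_N}\right)$. Set $\gamma^{k,N}=\mathbf 1\{U^{k,N}\le\alpha^N(x^{k,N},y^{k,N})\}$ with $U^{k,N}$ uniform on $[0,1]$, all $U^{k,N},\xi^{k,N}$ independent, and $x^{k+1,N}=\gamma^{k,N}y^{k,N}+(1-\gamma^{k,N})x^{k,N}$, $x^{0,N}=\mathcal P^N(x^0)$ deterministic. Interpolant. With $t_k=k/\sqrt N$, $S^{(N)}(t)=(\sqrt N t-k)S^{k+1,N}+(k+1-\sqrt N t)S^{k,N}$ for $t_k\le t<t_{k+1}$. $\mathcal H^s_\cap=\{x\in\mathcal H^s:\lim_{N\to\infty}\frac1N\sum_{i=1}^N|x_i|^2/\lambda_i^2\text{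 exists and is finite}\}$. *)

(* Defs.v *)
From HB Require Import structures.
From mathcomp Require Import all_boot all_order all_algebra.
From mathcomp Require Import all_classical all_reals all_analysis.
From mathcomp Require Import sesquilinear.
Set Implicit Arguments.
Unset Strict Implicit.
Unset Printing Implicit Defensive.
Import Order.TTheory GRing.Theory Num.Theory.
Import numFieldNormedType.Exports.
Local Open Scope classical_set_scope.
Local Open Scope ring_scope.

(* Throughout, sequences are indexed from 0: the entry of index j is the one
   of rank j.+1 in the mathematical text, hence the weights j.+1. *)

(* H^r for an arbitrary real r.  An element of H^r is given by its sequence of
   coordinates in the basis phi; for r < 0 the coordinates of an element of
   H^r need not be those of a vector of H. *)
Section weighted_spaces.
Context {R : realType}.
Implicit Types (r : R) (a g h : nat -> R).

Definition Hr_sqnorm r a : \bar R :=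
  (\sum_(0 <= j <oo) (j.+1%:R `^ (2 * r) * a j ^+ 2)%:E)%E.

Definition in_Hr r a : Prop := (Hr_sqnorm r a < +oo)%E.

Definition Hr_norm r a : R := Num.sqrt (fine (Hr_sqnorm r a)).

(* The pairing of H^{-s} with H^s that extends the inner product of H; the
   series is absolutely convergent when g is in H^{-s} and h in H^s. *)
Definition dual_pairing g h : R := limn (series (fun j => g j * h j)).

Definition asymp_power (lambda : nat -> R) (kappa : R) : Prop :=
  exists c1 c2 : R, [/\ 0 < c1, 0 < c2 &
    forall j, c1 * j.+1%:R `^ (- kappa) <= lambda j
              /\ lambda j <= c2 * j.+1%:R `^ (- kappa)].

End weighted_spaces.

Section hilbert.
Context {R : realType} {H : completeNormedModType R}.
Variable ip : {dot H for @idfun R}.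

Definition norm_of_dot : Prop := forall x : H, `|x| ^+ 2 = ip x x.

(* A Hilbert space with such a basis, indexed by nat, is separable and
   infinite-dimensional. *)
Definition orthonormal_basis (phi : nat -> H) : Prop :=
  (forall i j, ip (phi i) (phi j) = (i == j)%:R) /\
  (forall x : H, series (fun j => ip x (phi j) *: phi j) @ \oo --> x).

Variable phi : nat -> H.

(* For a positive operator, trace class means that the trace, which does not
   depend on the orthonormal basis, is finite. *)
Definition positive_trace_class (C : {linear H -> H}) : Prop :=
  [/\ continuous C,
      forall x y, ip (C x) y = ip x (C y),
      forall x, 0 <= ip (C x) x &
      (\sum_(0 <= j <oo) (ip (C (phi j)) (phi j))%:E < +oo)%E].

Definition hcoord (x : H) : nat -> R := fun j => ip x (phi j).

(* Membership in H^s, for s >= 0. *)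
Definition in_Hs (s : R) (x : H) : Prop := in_Hr s (hcoord x).

Definition Hs_norm (s : R) (x : H) : R := Hr_norm s (hcoord x).

(* Frechet differentiability at x of a function on H^s, with derivative
   h |-> dual_pairing g h; only the values of Psi on H^s matter. *)
Definition Hs_derivative_at (s : R) (Psi : H -> R) (x : H) (g : nat -> R)
    : Prop :=
  forall e : R, 0 < e -> exists2 d : R, 0 < d &
    forall h : H, in_Hs s h -> Hs_norm s h < d ->
      `|Psi (x + h) - Psi x - dual_pairing g (hcoord h)| <= e * Hs_norm s h.

Definition potential_assumption (s K : R) (Psi : H -> R)
    (gradPsi : H -> nat -> R) : Prop :=
  [/\ forall x, in_Hs s x -> in_Hr (- s) (gradPsi x),
      forall x, in_Hs s x -> Hs_derivative_at s Psi x (gradPsi x),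
      forall x, in_Hs s x -> Hr_norm (- s) (gradPsi x) <= K &
      forall x y, in_Hs s x -> in_Hs s y ->
        Hr_norm (- s) (fun j => gradPsi x j - gradPsi y j)
          <= K * Hs_norm s (x - y)].

Definition synthXN (N : nat) (a : nat -> R) : H := \sum_(j < N) a j *: phi j.

Definition projXN (N : nat) (x : H) : H := synthXN N (hcoord x).

Variable lambda : nat -> R.

(* (1/N) sum_{i <= N} |x_i|^2 / lambda_i^2 *)
Definition rescaled_norm (N : nat) (x : H) : R :=
  N%:R^-1 * \sum_(i < N) `|hcoord x i| ^+ 2 / lambda i ^+ 2.

Definition Hs_cap (s : R) (x : H) : Prop :=
  in_Hs s x /\ cvgn (fun N => rescaled_norm N x).

Variables (C : {linear H -> H}) (Psi : H -> R) (gradPsi : H -> nat -> R).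

Definition CN (N : nat) (x : H) : H := projXN N (C (projXN N x)).

(* The square root of CN given by its spectral decomposition. *)
Definition sqrtCN (N : nat) (x : H) : H :=
  \sum_(j < N) (lambda j * hcoord x j) *: phi j.

Definition sqnormCN (N : nat) (x : H) : R :=
  \sum_(j < N) hcoord x j ^+ 2 / lambda j ^+ 2.

Definition PsiN (N : nat) (x : H) : R := Psi (projXN N x).

(* The projection P^N, extended to H^{-s}, maps it to X^N. *)
Definition gradPsiN (N : nat) (x : H) : H := synthXN N (gradPsi (projXN N x)).

(* The normalising constants of pi^N and of q^N do not depend on the points
   and cancel in the acceptance ratio, so both densities are unnormalised. *)
Definition target_density (N : nat) (x : H) : R :=
  expR (- PsiN N x - 2^-1 * sqnormCN N x).

Definition proposal_density (N : nat) (delta : R) (x y : H) : R :=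
  expR (- (4 * delta)^-1 *
    sqnormCN N ((y - x) + delta *: (x + CN N (gradPsiN N x)))).

Definition acceptance (N : nat) (delta : R) (x y : H) : R :=
  Num.min 1 (target_density N y * proposal_density N delta y x /
             (target_density N x * proposal_density N delta x y)).

Definition proposal (N : nat) (delta : R) (x : H) (xi : 'I_N -> R) : H :=
  x - delta *: (x + CN N (gradPsiN N x))
  + Num.sqrt (2 * delta) *: sqrtCN N (\sum_(j < N) xi j *: phi j).

Definition mala_step (N : nat) (delta : R) (x : H) (xi : 'I_N -> R) (u : R)
    : H :=
  let y := proposal delta x xi in
  let gamma : R := (u <= acceptance N delta x y)%R%:R in
  gamma *: y + (1 - gamma) *: x.

Fixpoint mala_chain (N : nat) (delta : R) (x0 : H) (xi : nat -> 'I_N -> R)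
    (u : nat -> R) (k : nat) : H :=
  if k is k'.+1 then
    mala_step delta (mala_chain delta x0 xi u k') (xi k') (u k')
  else projXN N x0.

End hilbert.

Section noise.
Context {d : measure_display} {Omega : measurableType d} {R : realType}.
Variable P : probability Omega R.

Definition mutually_independent (I : eqType) (X : I -> {RV P >-> R}) : Prop :=
  forall (J : seq I) (A : I -> set R), uniq J ->
    (forall i, measurable (A i)) ->
    P (\bigcap_(i in [set` J]) (X i @^-1` A i)) =
    (\prod_(i <- J) P (X i @^-1` A i))%E.

Definition noise_family (N : nat) (xi : nat -> 'I_N -> {RV P >-> R})
    (U : nat -> {RV P >-> R}) (i : (nat * 'I_N + nat)%type) : {RV P >-> R} :=
  match i with inl kj => xi kj.1 kj.2 | inr k => U k end.

Definition mala_noise (N : nat) (xi : nat -> 'I_N -> {RV P >-> R})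
    (U : nat -> {RV P >-> R}) : Prop :=
  [/\ forall k j (A : set R), measurable A ->
        distribution P (xi k j) A = normal_prob 0 1 A,
      forall k (A : set R), measurable A ->
        distribution P (U k) A = uniform_prob (@ltr01 R) A &
      mutually_independent (noise_family xi U)].

Definition unif_dist (T : R) (f g : R -> R) : \bar R :=
  ereal_sup [set (`|f t - g t|)%:E | t in `[0, T]].

Definition cvg_in_probability_unif (T : R) (X : nat -> Omega -> R -> R)
    (f : R -> R) : Prop :=
  forall e : R, 0 < e ->
    P [set w | (e%:E < unif_dist T (X N w) f)%E] @[N --> \oo] --> 0%E.

End noise.

Section limit.
Context {R : realType}.

(* For t >= 0, the integer k such that k / sqrt N <= t < (k + 1) / sqrt N is
   the integral part of sqrt N * t. *)
Definition interpolant (N : nat) (S : nat -> R) (t : R) : R :=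
  let u := Num.sqrt N%:R * t in
  let k := Num.truncn u in
  (u - k%:R) * S k.+1 + (k.+1%:R - u) * S k.

Definition drift (ell x : R) : R :=
  2 * ell * (1 - x) * Num.min 1 (expR (ell ^+ 2 * (x - 1) / 2)).

Definition ode_solution (b : R -> R) (T S0 : R) (S : R -> R) : Prop :=
  [/\ S 0 = S0,
      {within `[0, T], continuous S} &
      forall t, 0 < t < T -> is_derive t (1 : R) S (b (S t))].

End limit.

(* Main.v *)
Require Import Defs.
From HB Require Import structures.
From mathcomp Require Import all_boot all_order all_algebra.
From mathcomp Require Import all_classical all_reals all_analysis measurable_realfun.
From mathcomp Require Import sesquilinear ring lra.
Set Implicit Arguments.
Unset Strict Implicit.
Unset Printing Implicit Defensive.
Import Order.TTheory GRing.Theory Num.Theory.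
Import numFieldNormedType.Exports.
Local Open Scope classical_set_scope.
Local Open Scope ring_scope.

(** Why the theorem holds.  In the whitened coordinates z_i = x_i / lambda_i
    the chain lives in R^N, the rescaled norm is S = |z|^2 / N, and a proposal
    is z' = z - delta (z + g(z)) + sqrt (2 delta) xi, where g = C^(1/2) grad Psi
    is bounded and Lipschitz for the norm of H^s.  Write p = N^(-1/4), so that
    delta = ell p^2.

    One step.  The mean change of |z|^2 under the proposal is 2 delta (N - |z|^2),
    of order N^(1/2), and its fluctuations are of order N^(1/4)
    ([wproposal_sqnorm]).  In the logarithm of the acceptance ratio the
    quadratic parts of the target and of the proposal densities nearly cancel:
    what remains is - delta / 4 times the change of |z|^2, that is
    ell^2 (S - 1) / 2, plus terms of order p that come from Psi and from the
    fluctuations ([log_ratio_le]).  Hence the acceptance probability alpha is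
    close to 1 /\ exp (ell^2 (S - 1) / 2), and with gamma the acceptance
    indicator the change of S is
      p^2 drift (S) + 2 delta (1 - S) (gamma - alpha) + O(p^3)
    ([one_step_error]).  The error p^3 is a random quantity whose expectation
    is under control as long as S stays bounded ([integral_step_cost]).

    Many steps.  A time interval of length T has about T / p^2 steps.  The
    errors add up to O(p) in mean.  The middle term is a sum of centred coin
    tosses, orthogonal to each other, so its second moment is of order
    p^-2 delta^2, that is O(p^2) ([integral_stopped_sqr]).  Hence S is a small
    perturbation of the Euler scheme with step p^2 for the equation.  A
    discrete Gronwall argument on each path ([pathwise_compare]) turns the two
    bounds into uniform closeness to the solution, except on an event whose
    probability is estimated by Markov's inequality ([failure_probability])
    and tends to 0 ([white_limit]).

    The estimates hold only while S is bounded, and S is not bounded a priori.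
    This is why the coin tosses are summed up to a stopping rule ([stopped]),
    which bounds the second moment and yet does not alter the paths that
    stay close to the solution.

    Since the drift is Lipschitz, the equation has at most one solution
    ([ode_unique]); a solution is written down explicitly when S(0) >= 1 and
    by separation of variables when S(0) < 1 ([ode_exists]).

    The independence of the noise enters in one form: a bound on the integral
    over one noise variable, the others being fixed, can be integrated
    ([noise_integral_le]).  It rests on Tonelli's theorem and on the
    sigma-algebras generated by the subfamilies of the noise. *)

(** * Second moments of Gaussian variables *)

Section gaussian_moments.
Context {R : realType}.
Local Notation mu := (@lebesgue_measure R).
Local Notation gauss := (@normal_pdf R 0 1).

Lemma ge0_integral_normal_prob (m s : R) (f : measurableTypeR R -> \bar R) :
  measurable_fun setT f -> (forall x, 0 <= f x)%E ->
  (\int[normal_prob m s]_x f x = \int[mu]_x (f x * (normal_pdf m s x)%:E))%E.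
Proof.
move=> mf f0.
have dom := @normal_prob_dominates R m s.
rewrite -(Radon_Nikodym_SigmaFinite.change_of_variables dom)//.
have mpdf : measurable_fun [set: measurableTypeR R] (EFin \o normal_pdf m s).
  by apply/measurable_EFinP; exact: measurable_normal_pdf.
have mRN : measurable_fun setT
    (Radon_Nikodym_SigmaFinite.f (normal_prob m s) mu).
  exact/measurable_int/Radon_Nikodym_SigmaFinite.f_integrable.
apply: ae_eq_integral => //; [exact: emeasurable_funM|exact: emeasurable_funM|].
apply: ae_eqe_mul2l; apply: integral_ae_eq => //.
- exact: Radon_Nikodym_SigmaFinite.f_integrable.
- by move=> A _ mA; rewrite -Radon_Nikodym_SigmaFinite.f_integral.
Qed.

Lemma is_derive_gauss (x : R) : is_derive x 1 gauss (- x * gauss x).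
Proof.
have := @normal_pdfE R 0 1 (oner_neq0 _) => ->; rewrite /normal_fun.
have -> : (fun x : R => normal_peak 1 * expR (- (x - 0) ^+ 2 / (1 ^+ 2 *+ 2)))
  = cst (normal_peak 1) * (expR \o (- (cst 2^-1 * id ^+ 2))).
  by apply/funext => y /=; congr (_ * expR _); rewrite !fctE subr0 expr1n /=; field.
apply: is_derive_eq.
rewrite /= subr0 expr1n /GRing.scale/= expr1 /cst.
rewrite (_ : (- (cst 2^-1 * id ^+ 2)) x = - x ^+ 2 / 2); last first.
  by rewrite !fctE /=; field.
by rewrite mulr0 addr0; field.
Qed.

(** Integration by parts in disguise: as G is a primitive of (p - v) gauss, the
    integral of p gauss over [-n, n] is at most v plus G n - G (- n), and
    monotone convergence lets n tend to infinity. *)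
Lemma gauss_integral_le (p G : R -> R) (v : R) :
  continuous p -> (forall x, 0 <= p x) -> 0 <= v ->
  (forall x : R, is_derive x (1 : R) G (p x * gauss x - v * gauss x)) ->
  (\forall n \near \oo, G n%:R <= G (- n%:R)) ->
  (\int[normal_prob 0 1]_x (p x)%:E <= v%:E)%E.
Proof.
move=> cp p0 v0 dG Gle.
have mp : measurable_fun setT p by exact: continuous_measurable_fun.
have cg : continuous gauss by apply: continuous_normal_pdf; exact: oner_neq0.
have cpg : continuous (fun x => p x * gauss x).
  by move=> x; apply: cvgM; [exact: cp|exact: cg].
have cvg' : continuous (fun x => v * gauss x).
  by move=> x; apply: cvgM; [exact: cvg_cst|exact: cg].
rewrite ge0_integral_normal_prob; last 2 first.
- exact/measurable_EFinP.
- by move=> x; rewrite lee_fin.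
under eq_integral do rewrite -EFinM.
pose F (n : nat) : set (measurableTypeR R) := `[- n%:R, n%:R]%classic.
have FT : \bigcup_n F n = setT.
  apply/seteqP; split => // x _; exists (Num.truncn `|x|).+1 => //.
  rewrite /F/= in_itv/= -ler_norml ltW//.
  by have /andP[] := truncn_itv (normr_ge0 x).
have cvgF := @ge0_nondecreasing_set_cvg_integral _ _ R F
  (fun x : measurableTypeR R => (p x * gauss x)%:E) mu.
have {}cvgF : (\int[mu]_(x in F i) (p x * gauss x)%:E @[i --> \oo]
    --> \int[mu]_x (p x * gauss x)%:E)%E.
  rewrite -FT; apply: cvgF.
  - move=> m n mn; apply/subsetPset => x; rewrite /F/= !in_itv/= => /andP[a b].
    rewrite (le_trans _ a) ?(le_trans b)// ?lerN2 ?ler_nat//.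
  - by move=> i; exact: measurable_itv.
  - by move=> i; apply/measurable_EFinP/measurable_funTS;
      exact: continuous_measurable_fun.
  - by move=> i x _; rewrite lee_fin mulr_ge0// normal_pdf_ge0.
rewrite -(cvg_lim _ cvgF)//; apply: lime_le; first by apply/cvg_ex; eexists; exact: cvgF.
near=> n.
have n0 : 0 < n%:R :> R by rewrite ltr0n; near: n; exists 1%N.
have nn : - n%:R < n%:R :> R by rewrite gtrN.
have cw (h : R -> R) : continuous h -> {within F n, continuous h}.
  exact: continuous_subspaceT.
have ig (h : R -> R) : continuous h -> mu.-integrable (F n) (EFin \o h).
  move=> ch; apply: continuous_compact_integrable; first exact: segment_compact.
  exact: cw.
have -> : (\int[mu]_(x in F n) (p x * gauss x)%:E =
  \int[mu]_(x in F n) (p x * gauss x - v * gauss x)%:E +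
  \int[mu]_(x in F n) (v * gauss x)%:E)%E.
  rewrite -integralD//=; first by apply: eq_integral => x _; rewrite -EFinD subrK.
  + exact: measurable_itv.
  + by apply: (ig (fun x => p x * gauss x - v * gauss x)) => x;
      apply: cvgB; [exact: cpg|exact: cvg'].
  + exact: (ig (fun x => v * gauss x)).
have dd x : derivable G x 1 by have [] := dG x.
have Gc : continuous G.
  by move=> x; apply: differentiable_continuous; apply/derivable1_diffP.
rewrite (@continuous_FTC2 _ _ G)//; last 3 first.
- by apply: cw => x; apply: cvgB; [exact: cpg|exact: cvg'].
- by split => //; [apply: cvg_at_right_filter; exact: Gc|
    apply: cvg_at_left_filter; exact: Gc].
- by move=> x _; rewrite derive1E; apply: derive_val.
have -> : (v%:E = 0 + v%:E * \int[mu]_x (gauss x)%:E)%E.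
  by rewrite integral_normal_pdf mule1 add0e.
apply: leeD.
  rewrite -EFinB lee_fin subr_le0; near: n; exact: Gle.
under eq_integral do rewrite EFinM.
rewrite ge0_integralZl//; last 3 first.
- exact: measurable_itv.
- apply/measurable_EFinP/measurable_funTS; exact: measurable_normal_pdf.
- by move=> x _; rewrite lee_fin normal_pdf_ge0.
apply: lee_wpmul2l; first by rewrite lee_fin.
apply: ge0_subset_integral => //.
- exact: measurable_itv.
- apply/measurable_EFinP; exact: measurable_normal_pdf.
- by move=> x _; rewrite lee_fin normal_pdf_ge0.
Unshelve. all: by end_near. Qed.

(** From gauss' = - x gauss one gets
    ((a + c x)^2 - a^2 - c^2) gauss = (- (2 a c + c^2 x) gauss)'. *)
Lemma gauss_affine_sqr (a c : R) :
  (\int[normal_prob 0 1]_x ((a + c * x) ^+ 2)%:E <= (a ^+ 2 + c ^+ 2)%:E)%E.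
Proof.
apply: (@gauss_integral_le _ (fun x => - ((2 * a * c + c ^+ 2 * x) * gauss x))).
- have ca x : {for x, continuous (fun x : R => a + c * x)}.
    by apply: cvgD; [exact: cvg_cst|apply: cvgM; [exact: cvg_cst|exact: cvg_id]].
  by move=> x; apply: cvgM; exact: ca.
- by move=> x; exact: sqr_ge0.
- by rewrite addr_ge0 ?sqr_ge0.
- move=> x; have dg := is_derive_gauss x.
  change (is_derive x 1 (- ((cst (2 * a * c) + cst (c ^+ 2) * id) * gauss))
    ((a + c * x) ^+ 2 * gauss x - (a ^+ 2 + c ^+ 2) * gauss x)).
  apply: (is_derive_eq (is_deriveN (is_deriveM (is_deriveD
    (is_derive_cst _ _ _) (is_deriveM (is_derive_cst _ _ _)
    (is_derive_id _ _))) dg))); rewrite /GRing.scale/= !fctE /=.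
  by move: (gauss x) => g; ring.
near=> n.
have gE : gauss (- n%:R) = gauss n%:R.
  by rewrite normal_pdfE ?oner_neq0// /normal_fun !subr0 sqrrN.
rewrite gE -!mulNr ler_wpM2r ?normal_pdf_ge0//.
have : 0 <= c ^+ 2 * n%:R by rewrite mulr_ge0 ?sqr_ge0.
lra.
Unshelve. all: by end_near. Qed.

(** The primitive - (2 a c x + c^2 x^3 + c^2 x) gauss encodes E X^2 = 1 and
    E X^4 = 3, so that X^2 - 1 is centred with variance 2. *)
Lemma gauss_square_sqr (a c : R) :
  (\int[normal_prob 0 1]_x ((a + c * (x ^+ 2 - 1)) ^+ 2)%:E
     <= (a ^+ 2 + 2 * c ^+ 2)%:E)%E.
Proof.
apply: (@gauss_integral_le _
  (fun x => - ((2 * a * c * x + c ^+ 2 * x ^+ 3 + c ^+ 2 * x) * gauss x))).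
- move=> x; have c0 : {for x, continuous (fun x : R => a + c * (x ^+ 2 - 1))}.
    apply: cvgD; [exact: cvg_cst|apply: cvgM; first exact: cvg_cst].
    by apply: cvgB; [exact: exprn_continuous|exact: cvg_cst].
  by apply: cvgM; exact: c0.
- by move=> x; exact: sqr_ge0.
- by apply: addr_ge0; [exact: sqr_ge0|apply: mulr_ge0 => //; exact: sqr_ge0].
- move=> x; have dg := is_derive_gauss x.
  change (is_derive x 1 (- ((cst (2 * a * c) * id + cst (c ^+ 2) * id ^+ 3 +
      cst (c ^+ 2) * id) * gauss))
    ((a + c * (x ^+ 2 - 1)) ^+ 2 * gauss x
      - (a ^+ 2 + 2 * c ^+ 2) * gauss x)).
  apply: (is_derive_eq (is_deriveN (is_deriveM (is_deriveD (is_deriveD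
    (is_deriveM (is_derive_cst _ _ _) (is_derive_id _ _))
    (is_deriveM (is_derive_cst _ _ _) (is_deriveX 3 (is_derive_id _ _))))
    (is_deriveM (is_derive_cst _ _ _) (is_derive_id _ _))) dg)));
    rewrite /GRing.scale/= !fctE /=.
  by move: (gauss x) => g; ring.
have [->|c0] := eqVneq c 0.
  by near=> n; rewrite !(mulr0,mul0r,expr0n)/= !(mul0r,addr0,add0r,oppr0).
near=> n.
have gE : gauss (- n%:R) = gauss n%:R.
  by rewrite normal_pdfE ?oner_neq0// /normal_fun !subr0 sqrrN.
rewrite gE -!mulNr ler_wpM2r ?normal_pdf_ge0//.
have cn : 2 * `|a| / `|c| <= n%:R by near: n; exact: nbhs_infty_ger.
have n1 : 1 <= n%:R :> R by near: n; exact: nbhs_infty_ger.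
have c0' : 0 < `|c| by rewrite normr_gt0.
move: cn; rewrite ler_pdivrMr// => cn.
have h1 : - (2 * a * c) <= c ^+ 2 * n%:R ^+ 2.
  have e : c ^+ 2 = `|c| ^+ 2 by rewrite real_normK// num_real.
  have h : - (2 * a * c) <= 2 * `|a| * `|c|.
    rewrite -mulrA -mulrN -mulrA ler_wpM2l// -normrM.
    by apply: (le_trans (ler_norm _)); rewrite normrN.
  have h' : 2 * `|a| * `|c| <= n%:R * `|c| * `|c| by rewrite ler_wpM2r.
  have h'' : 0 <= `|c| ^+ 2 * (n%:R * (n%:R - 1)).
    by apply: mulr_ge0; [exact: sqr_ge0|apply: mulr_ge0 => //; rewrite subr_ge0].
  rewrite e; lra.
have h2 : 0 <= (2 * a * c + c ^+ 2 * n%:R ^+ 2) * n%:R.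
  by rewrite mulr_ge0//; lra.
have h3 : 0 <= c ^+ 2 * n%:R by rewrite mulr_ge0 ?sqr_ge0.
move: h2 h3; nra.
Unshelve. all: by end_near. Qed.

End gaussian_moments.

(** * Independence and Tonelli's theorem *)

Section independence_tonelli.
Context d d1 d2 (Omega : measurableType d) (T1 : measurableType d1)
  (T2 : measurableType d2) (R : realType).
Variables (P : probability Omega R) (m2 : probability T2 R).

(** The product rule on rectangles identifies the law of (Z, Y) with the product
    of the law of Z and m2, so Y can be integrated out first. *)
Lemma indep_tonelli (Z : Omega -> T1) (Y : Omega -> T2) (F : T1 * T2 -> \bar R) :
  measurable_fun setT Z -> measurable_fun setT Y ->
  (forall A B, measurable A -> measurable B ->
    P (Z @^-1` A `&` Y @^-1` B) = (P (Z @^-1` A) * m2 B)%E) ->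
  measurable_fun setT F -> (forall x, 0 <= F x)%E ->
  (\int[P]_w F (Z w, Y w) = \int[P]_w \int[m2]_y F (Z w, y))%E.
Proof.
move=> mZ mY ZY mF F0.
pose hZ := isMeasurableFun.Build _ _ _ _ _ mZ.
pose Z' : {mfun Omega >-> T1} := HB.pack Z hZ.
have mZY : measurable_fun setT (fun w => (Z w, Y w)).
  exact: measurable_fun_pair.
pose hZY := isMeasurableFun.Build _ _ _ _ _ mZY.
pose ZY' : {mfun Omega >-> (T1 * T2)%type} :=
  HB.pack (fun w => (Z w, Y w)) hZY.
have E A : measurable A ->
    ((distribution P Z' \x m2) A = distribution P ZY' A)%E.
  by move=> mA; apply: product_measure_unique => // B C mB mC; exact: ZY.
transitivity (\int[distribution P ZY']_z F z)%E.
  by rewrite ge0_integral_distribution.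
transitivity (\int[distribution P Z' \x m2]_z F z)%E.
  by apply: eq_measure_integral => A mA _; apply/esym; exact: E.
rewrite fubini_tonelli1//.
rewrite (@ge0_integral_distribution _ _ _ _ _ _ _ (fubini_F m2 F))//.
- exact: measurable_fun_fubini_tonelli_F.
- by move=> y; exact: integral_ge0.
Qed.

End independence_tonelli.

Section cylinders.
Context d (Omega : measurableType d) (R : realType) (P : probability Omega R).
Variables (I : eqType) (X : I -> {RV P >-> R}).
Implicit Types D : pred I.

Definition cylinders D : set (set Omega) :=
  [set C | exists (J : seq I) (A : I -> set R),
    [/\ uniq J, {subset J <= D}, forall i, measurable (A i) &
        C = \bigcap_(i in [set` J]) X i @^-1` A i]].

(** The events determined by the variables with index in D.  The set D stays
    explicit: a function measurable for noise_algebra D is independent of X i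
    as soon as i is outside D. *)
Definition noise_algebra D := g_sigma_algebraType (cylinders D).

Lemma cylinders_setT D : cylinders D setT.
Proof.
exists [::], (fun=> setT); split => //.
by apply/esym/seteqP; split.
Qed.

Lemma measurable_RV i (A : set R) : measurable A -> measurable (X i @^-1` A).
Proof. by move=> mA; rewrite -[X in measurable X]setTI; exact: measurable_funP. Qed.

Lemma cylinders_measurable D : cylinders D `<=` measurable.
Proof.
move=> _ [J [A [_ _ mA ->]]]; elim: J => [|i J IH].
  by rewrite (_ : bigcap _ _ = setT)//; apply/seteqP; split.
rewrite (_ : bigcap _ _ =
  X i @^-1` A i `&` \bigcap_(j in [set` J]) X j @^-1` A j).
  by apply: measurableI => //; exact: measurable_RV.
apply/seteqP; split => [w wJ|w [wi wJ] j /=].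
  split; first by apply: wJ; rewrite /= inE eqxx.
  by move=> j jJ; apply: wJ; rewrite /= inE (jJ : j \in J) orbT.
by rewrite inE => /orP[/eqP ->//|jJ]; exact: wJ.
Qed.

Lemma cylinders_setI D : setI_closed (cylinders D).
Proof.
move=> _ _ [J [A [uJ JD mA ->]]] [J' [A' [uJ' J'D mA' ->]]].
pose B i := (if i \in J then A i else setT) `&` (if i \in J' then A' i else setT).
exists (undup (J ++ J')), B; split.
- exact: undup_uniq.
- move=> i; rewrite mem_undup mem_cat => /orP[/JD//|/J'D//].
- by move=> i; apply: measurableI; case: ifP.
apply/seteqP; split => [w [w1 w2] i /=|w w12].
  rewrite mem_undup mem_cat => iJ; split.
    by case: ifP => // iJ1; exact: w1.
  by case: ifP => // iJ1; exact: w2.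
split => i iJ.
- have [|] := w12 i; first by rewrite /= mem_undup mem_cat (iJ : i \in J).
  by rewrite (iJ : i \in J).
- have [|] := w12 i; first by rewrite /= mem_undup mem_cat (iJ : i \in J') orbT.
  by rewrite (iJ : i \in J').
Qed.

Lemma noise_algebra_measurable D (A : set (noise_algebra D)) :
  measurable A -> measurable (A : set Omega).
Proof.
move=> mA.
exact: (smallest_sub (@sigma_algebra_measurable _ Omega)
  (@cylinders_measurable D)).
Qed.

Lemma noise_algebraS D D' (A : set Omega) : {subset D <= D'} ->
  measurable (A : set (noise_algebra D)) ->
  measurable (A : set (noise_algebra D')).
Proof.
move=> DD'; apply: sub_smallest2r.
  exact: smallest_sigma_algebra.
move=> _ [J [B [uJ JD mB ->]]].
by exists J, B; split => // i /JD /DD'.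
Qed.

Lemma measurable_noise D i : i \in D ->
  measurable_fun setT (X i : noise_algebra D -> R).
Proof.
move=> iD _ B mB; rewrite setTI; apply: sub_sigma_algebra.
exists [:: i], (fun=> B); split => //.
- by move=> j; rewrite inE => /eqP ->.
- by apply/seteqP; split => [w wB j /=|w]; [rewrite inE => /eqP ->|apply; rewrite /= inE].
Qed.

Lemma noise_algebra_measurable_fun D d' (T : measurableType d')
    (f : Omega -> T) :
  measurable_fun setT (f : noise_algebra D -> T) -> measurable_fun setT f.
Proof.
move=> mf _ B mB; have := mf measurableT B mB; rewrite !setTI.
exact: noise_algebra_measurable.
Qed.

Lemma noise_algebra_measurable_funS D D' d' (T : measurableType d')
    (f : Omega -> T) : {subset D <= D'} ->
  measurable_fun setT (f : noise_algebra D -> T) ->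
  measurable_fun setT (f : noise_algebra D' -> T).
Proof.
move=> DD' mf _ B mB; have := mf measurableT B mB; rewrite !setTI.
exact: noise_algebraS.
Qed.

Hypothesis indepX : mutually_independent X.

(** Both sides are finite measures in A that agree on the cylinders, which are
    stable under intersection and generate noise_algebra D. *)
Lemma noise_algebra_indep D i (A : set Omega) (B : set R) : i \notin D ->
  measurable (A : set (noise_algebra D)) -> measurable B ->
  P (A `&` X i @^-1` B) = (P A * P (X i @^-1` B))%E.
Proof.
move=> iD mA mB.
have mE := measurable_RV i mB.
have PE0 : 0 <= fine (P (X i @^-1` B)) by exact: fine_ge0.
rewrite muleC -[P (X i @^-1` B)]fineK ?fin_num_measure//.
change (mrestr P mE A = mscale (NngNum PE0) P A).
apply: (@g_sigma_algebra_measure_unique _ _ _ (cylinders D)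
  (@cylinders_measurable D) (fun=> setT)) => //.
- by move=> _; exact: cylinders_setT.
- by rewrite bigcup_const//; exists 0%N.
- exact: cylinders_setI.
- move=> _ [J [A' [uJ JD mA' ->]]]; rewrite /mrestr /mscale/=.
  change (P (\bigcap_(j in [set` J]) X j @^-1` A' j `&` X i @^-1` B) =
    (fine (P (X i @^-1` B)))%:E * P (\bigcap_(j in [set` J]) X j @^-1` A' j))%E.
  rewrite fineK ?fin_num_measure//.
  have iJ : i \notin J by apply: contra iD; exact: JD.
  pose A'' j := if j == i then B else A' j.
  have mA'' j : measurable (A'' j) by rewrite /A''; case: ifP.
  have /(_ _ mA'') := @indepX (i :: J) A'' _.
  rewrite big_cons /= iJ => /(_ uJ).
  rewrite (eq_big_seq (fun j => P (X j @^-1` A' j))); last first.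
    move=> j jJ; rewrite /A''; case: eqP => // ji; by rewrite -ji jJ in iJ.
  have A''i : A'' i = B by rewrite /A'' eqxx.
  rewrite -(indepX uJ mA') A''i => <-; congr (P _).
  apply/seteqP; split => [w [wJ wi] j /=|w wJ].
    rewrite inE => /orP[/eqP ->|jJ]; first by rewrite /A'' eqxx.
    by rewrite /A''; case: eqP => [->//|_]; exact: wJ.
  split=> [j jJ|].
  + have := wJ j; rewrite /A''; case: eqP => [ji|_].
      by rewrite -ji (jJ : j \in J) in iJ.
    by apply; rewrite /= inE (jJ : j \in J) orbT.
  + by have := wJ i; rewrite /A'' eqxx; apply; rewrite /= inE eqxx.
- move=> _; change (P (setT `&` X i @^-1` B) < +oo)%E; rewrite setTI.
  apply: (le_lt_trans (probability_le1 P mE)).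
  exact: ltry.
Qed.

(** The identity of Omega, seen as a map into Omega with the coarser
    sigma-algebra noise_algebra D, is independent of X i.  Through it F may
    depend on all the variables with index in D at once. *)
Lemma noise_tonelli D i (nu : probability (measurableTypeR R) R)
    (F : noise_algebra D * measurableTypeR R -> \bar R) : i \notin D ->
  (forall B : set R, measurable B -> P (X i @^-1` B) = nu B) ->
  measurable_fun setT F -> (forall x, 0 <= F x)%E ->
  (\int[P]_w F (w, X i w) = \int[P]_w \int[nu]_y F (w, y))%E.
Proof.
move=> iD Xnu mF F0.
apply: (@indep_tonelli _ _ _ _ _ _ _ P nu (fun w => w : noise_algebra D)
  (fun w => X i w : measurableTypeR R)) => //.
- by move=> _ A mA; rewrite setTI; exact: (@noise_algebra_measurable D).
- by move=> _ A mA; rewrite setTI; exact: measurable_RV.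
- move=> A B mA mB; rewrite preimage_id noise_algebra_indep//.
  by rewrite Xnu.
Qed.

End cylinders.

(** * Second moments of sums of independent terms *)

Lemma measurable_sum_in d (T : measurableType d) (R : realType) (I : eqType)
    (r : seq I) (h : I -> T -> R) :
  (forall i, i \in r -> measurable_fun setT (h i)) ->
  measurable_fun setT (fun x => \sum_(i <- r) h i x).
Proof.
elim: r => [|i r IH] mh.
  by under eq_fun do rewrite big_nil; exact: measurable_cst.
under eq_fun do rewrite big_cons.
apply: measurable_funD; first by apply: mh; rewrite inE eqxx.
by apply: IH => j jr; apply: mh; rewrite inE jr orbT.
Qed.

Section uniform_moment.
Context {R : realType}.

Lemma uniform_prob_le (a : R) : 0 <= a <= 1 ->
  uniform_prob (@ltr01 R) [set u | u <= a] = a%:E.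
Proof.
move=> /andP[a0 a1].
rewrite -[LHS]mul1e.
have mA : measurable ([set u | u <= a] : set (measurableTypeR R)).
  by rewrite -set_itvNyc; exact: measurable_itv.
have := @integral_uniform R 0 1 ltr01 (fun u => (\1_[set u | u <= a] u)%:E).
rewrite integral_indic// setIT mul1e => ->; last 2 first.
- exact/measurable_EFinP/measurable_indic.
- by move=> x; rewrite lee_fin.
rewrite subr0 invr1 mul1e integral_indic//= ?measurable_itv//.
rewrite (_ : _ `&` _ = `[0, a]%classic); last first.
  apply/seteqP; split => x /=; rewrite !in_itv/=.
    by move=> [-> /andP[-> _]].
  by move=> /andP[-> xa]; rewrite xa (le_trans xa a1).
rewrite lebesgue_measure_itv/= lte_fin; case: ltP => a0'.
  by rewrite oppr0 adde0.
by congr EFin; apply/le_anti; rewrite a0 a0'.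
Qed.

(** Conditionally on its success probability a, the coin 1{u <= a} - a is
    centred with variance a (1 - a) <= 1. *)
Lemma uniform_centered_sqr (m h a : R) : 0 <= a <= 1 ->
  (\int[uniform_prob (@ltr01 R)]_u ((m + h * ((u <= a)%R%:R - a)) ^+ 2)%:E
    <= (m ^+ 2 + h ^+ 2)%:E)%E.
Proof.
move=> a01; have /andP[a0 a1] := a01.
pose A := [set u : measurableTypeR R | u <= a].
have mA : measurable A by rewrite /A -set_itvNyc; exact: measurable_itv.
have mB : measurable (~` A) by exact: measurableC.
pose s := (m + h * (1 - a)) ^+ 2; pose t := (m - h * a) ^+ 2.
rewrite [leLHS](_ : _ = \int[uniform_prob (@ltr01 R)]_u
    (s%:E * (\1_A u)%:E + t%:E * (\1_(~` A) u)%:E))%E; last first.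
  apply: eq_integral => u _; rewrite !indicE.
  have -> : (u \in ~` A) = ~~ (u \in A) by rewrite in_setC.
  have -> : (u \in A) = (u <= a) by apply/idP/idP; rewrite inE.
  rewrite -!EFinM -EFinD; case: (u <= a); rewrite /= ?mulr1 ?mulr0 ?addr0 ?add0r//.
  by congr EFin; rewrite /t; ring.
rewrite ge0_integralD//; last 4 first.
- by move=> u _; rewrite -EFinM lee_fin mulr_ge0// sqr_ge0.
- by apply: emeasurable_funM => //; apply/measurable_EFinP/measurable_indic.
- by move=> u _; rewrite -EFinM lee_fin mulr_ge0// sqr_ge0.
- by apply: emeasurable_funM => //; apply/measurable_EFinP/measurable_indic.
rewrite !ge0_integralZl//; last 4 first.
- exact/measurable_EFinP/measurable_indic.
- by rewrite lee_fin sqr_ge0.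
- exact/measurable_EFinP/measurable_indic.
- by rewrite lee_fin sqr_ge0.
have UA : uniform_prob (@ltr01 R) A = a%:E by exact: uniform_prob_le.
have UB : uniform_prob (@ltr01 R) (~` A) = (1 - a)%:E.
  transitivity (1 - uniform_prob (@ltr01 R) A)%E; last by rewrite UA.
  exact: (probability_setC (uniform_prob (@ltr01 R)) mA).
rewrite !integral_indic// !setIT.
rewrite [X in (s%:E * X)%E](UA : _ = a%:E) [X in (t%:E * X)%E](UB : _ = (1 - a)%:E).
rewrite -!EFinM -EFinD lee_fin -subr_ge0.
rewrite (_ : _ - _ = h ^+ 2 * (1 - a * (1 - a))); last by rewrite /s /t; ring.
apply: mulr_ge0; first exact: sqr_ge0.
by nra.
Qed.

End uniform_moment.

Section noise_moments.
Context d (Omega : measurableType d) (R : realType) (P : probability Omega R).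
Variables (I : eqType) (X : I -> {RV P >-> R}).
Hypothesis indepX : mutually_independent X.

(** Integration of a bound on the conditional expectation given noise_algebra D;
    by independence that conditional expectation is an integral against nu. *)
Lemma noise_integral_le (D : pred I) i (nu : probability (measurableTypeR R) R)
    (F : noise_algebra X D * measurableTypeR R -> R) (G : Omega -> R) :
  i \notin D ->
  (forall B : set R, measurable B -> P (X i @^-1` B) = nu B) ->
  measurable_fun setT F -> (forall x, 0 <= F x) ->
  measurable_fun setT (G : noise_algebra X D -> R) ->
  (forall w, \int[nu]_y (F (w, y))%:E <= (G w)%:E)%E ->
  (\int[P]_w (F (w, X i w))%:E <= \int[P]_w (G w)%:E)%E.
Proof.
move=> iD Xnu mF F0 mG FG.
have mF' : measurable_fun setT (EFin \o F) by exact/measurable_EFinP.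
rewrite (noise_tonelli indepX iD Xnu mF') => [|x]; last by rewrite lee_fin.
apply: ge0_le_integral => //.
- by move=> w _; apply: integral_ge0 => y _; rewrite lee_fin.
- have := measurable_fun_fubini_tonelli_F (m2 := nu) _ mF'.
  by move=> /(_ (fun x => F0 x)) /noise_algebra_measurable_fun.
- exact/measurable_EFinP/(noise_algebra_measurable_fun mG).
- by move=> w _; exact: FG.
Qed.

(** The quadratic bound in a and b says that g is centred, with variance at most
    v, under the law of the fresh variables.  When the sum is built one term at
    a time, the terms already present are the constant a of this bound. *)
Lemma noise_sum_sqr (D : pred I) (r : seq I)
    (nu : probability (measurableTypeR R) R) (g : R -> R) (v : R)
    (c : I -> Omega -> R) :
  (forall i, i \in r ->
    forall B : set R, measurable B -> P (X i @^-1` B) = nu B) ->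
  measurable_fun setT g ->
  (forall a b, \int[nu]_y ((a + b * g y) ^+ 2)%:E
     <= (a ^+ 2 + v * b ^+ 2)%:E)%E ->
  0 <= v ->
  uniq r -> (forall i, i \in r -> i \notin D) ->
  (forall i, i \in r -> measurable_fun setT (c i : noise_algebra X D -> R)) ->
  (\int[P]_w ((\sum_(i <- r) c i w * g (X i w)) ^+ 2)%:E
    <= v%:E * \sum_(i <- r) \int[P]_w (c i w ^+ 2)%:E)%E.
Proof.
move=> Xnu mg gv v0.
elim: r Xnu => [|i r IH] Xnu /=.
  move=> _ _ _; rewrite big_nil mule0 integral0_eq// => w _.
  by rewrite big_nil expr0n.
move=> /andP[ir ur] irD mc.
pose D' : pred I := [pred j | (j \in D) || (j \in r)].
have DD' : {subset D <= D'} by move=> j jD; rewrite inE jD.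
have iD' : i \notin D'.
  by rewrite inE negb_or ir andbT irD// inE eqxx.
pose S w := \sum_(j <- r) c j w * g (X j w).
have mS : measurable_fun setT (S : noise_algebra X D' -> R).
  apply: measurable_sum_in => j jr; apply: measurable_funM.
    by apply: (noise_algebra_measurable_funS DD'); apply: mc; rewrite inE jr orbT.
  by apply: measurableT_comp => //; apply: measurable_noise; rewrite !inE jr orbT.
have mci : measurable_fun setT (c i : noise_algebra X D' -> R).
  by apply: (noise_algebra_measurable_funS DD'); apply: mc; rewrite inE eqxx.
have mS' := noise_algebra_measurable_fun mS.
have mci' := noise_algebra_measurable_fun mci.
have {}IH : (\int[P]_w (S w ^+ 2)%:E
    <= v%:E * \sum_(i <- r) \int[P]_w (c i w ^+ 2)%:E)%E.
  apply: IH => //.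
  - by move=> j jr; apply: Xnu; rewrite inE jr orbT.
  - by move=> j jr; apply: irD; rewrite inE jr orbT.
  - by move=> j jr; apply: mc; rewrite inE jr orbT.
have := @noise_integral_le D' i nu
  (fun wy => (S wy.1 + c i wy.1 * g wy.2) ^+ 2)
  (fun w => S w ^+ 2 + v * c i w ^+ 2) iD' (Xnu i (mem_head _ _)).
move=> H; under eq_integral do rewrite big_cons addrC.
apply: (le_trans (H _ _ _ _)).
- apply: measurable_funX; apply: measurable_funD.
    exact: measurableT_comp.
  apply: measurable_funM; first exact: measurableT_comp.
  exact: measurableT_comp.
- by move=> x; exact: sqr_ge0.
- apply: measurable_funD; first exact: measurable_funX.
  by apply: measurable_funM => //; exact: measurable_funX.
- by move=> w /=; exact: (gv (S w) (c i w)).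
under eq_integral do rewrite EFinD.
rewrite ge0_integralD//; last 4 first.
- by move=> w _; rewrite lee_fin sqr_ge0.
- by apply/measurable_EFinP; exact: measurable_funX.
- by move=> w _; rewrite lee_fin mulr_ge0// sqr_ge0.
- by apply/measurable_EFinP; apply: measurable_funM => //; exact: measurable_funX.
under [X in (_ + X)%E]eq_integral do rewrite EFinM.
rewrite ge0_integralZl//; last 2 first.
- by apply/measurable_EFinP; exact: measurable_funX.
- by move=> w _; rewrite lee_fin sqr_ge0.
rewrite big_cons [leRHS]ge0_muleDr; last 2 first.
- by apply: integral_ge0 => w _; rewrite lee_fin sqr_ge0.
- by apply: sume_ge0 => j _; apply: integral_ge0 => w _; rewrite lee_fin sqr_ge0.
by rewrite addeC leeD2l.
Qed.

End noise_moments.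

(** * Measurability of continuous functions of finitely many coordinates *)

(** Rounding the coordinates down to multiples of 1 / (n + 1) gives functions
    with countably many values, which are measurable and converge pointwise by
    continuity of f. *)
Lemma measurable_seq_continuous d (T : measurableType d) (R : realType)
    (N : nat) (f : ('I_N -> R) -> R) (Z : 'I_N -> T -> R) :
  (forall (u : nat -> 'I_N -> R) (a : 'I_N -> R),
    (forall i, u n i @[n --> \oo] --> a i) -> f (u n) @[n --> \oo] --> f a) ->
  (forall i, measurable_fun setT (Z i)) ->
  measurable_fun setT (fun t => f (fun i => Z i t)).
Proof.
move=> cf mZ.
pose F (n : nat) (t : T) : {ffun 'I_N -> int} :=
  [ffun i => Num.floor (n.+1%:R * Z i t)].
pose val (n : nat) (m : {ffun 'I_N -> int}) (i : 'I_N) : R :=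
  (m i)%:~R / n.+1%:R.
have mF n m : measurable [set t | F n t = m].
  rewrite (_ : mkset _ = \bigcap_(i in [set: 'I_N])
    (Z i @^-1` `[(m i)%:~R / n.+1%:R, (m i + 1)%:~R / n.+1%:R[)); last first.
    apply/seteqP; split => t /=.
      move=> Ftm i _; rewrite /= in_itv/= ler_pdivrMr// ltr_pdivlMr//.
      rewrite mulrC -Ftm ffunE; exact/floor_itv.
    move=> H; apply/ffunP => i; rewrite ffunE; apply/eqP.
    have /= := H i Logic.I; rewrite in_itv/= ler_pdivrMr// ltr_pdivlMr// mulrC.
    by rewrite -floor_eq ?num_real// => /eqP.
  apply: fin_bigcap_measurable; first exact: finite_finset.
  move=> i _; rewrite -[X in measurable X]setTI; apply: mZ => //.
apply: (measurable_fun_cvg (h := fun n t => f (val n (F n t)))).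
- move=> n _ B mB; rewrite setTI.
  rewrite (_ : _ @^-1` _ = \bigcup_k (if unpickle k is Some m then
     if `[< B (f (val n m)) >] then [set t | F n t = m] else set0 else set0)).
    apply: bigcupT_measurable => k; case: unpickle => // m.
    by case: ifP.
  apply/seteqP; split => t /=.
    move=> Bt; exists (pickle (F n t)) => //; rewrite pickleK.
    by case: asboolP.
  move=> [k _]; case: unpickle => // m; case: asboolP => //= Bm.
  by move=> ->.
- move=> t _; apply: cf => i; rewrite /val.
  apply/cvgrPdist_le => e e0; near=> n.
  rewrite ffunE.
  have n0 : 0 < n.+1%:R :> R by [].
  have /andP[h1 h2] := floor_itv (n.+1%:R * Z i t).
  have -> : Z i t - (Num.floor (n.+1%:R * Z i t))%:~R / n.+1%:R =
    (n.+1%:R * Z i t - (Num.floor (n.+1%:R * Z i t))%:~R) / n.+1%:R.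
    by rewrite mulrBl mulrAC mulfV ?mul1r // gt_eqF.
  rewrite ger0_norm; last by rewrite divr_ge0// subr_ge0.
  apply: (@le_trans _ _ (1 / n.+1%:R)).
    rewrite ler_pM2r ?invr_gt0//; rewrite intrD in h2.
    by rewrite lerBlDl ltW// addrC.
  rewrite div1r; apply: ltW; near: n.
  exact: (near_infty_natSinv_lt (PosNum e0)).
Unshelve. all: by end_near. Qed.

(** * Euclidean vectors, and the function 1 /\ exp *)

Section euclid.
Context {R : realType} {N : nat}.
Implicit Types u v w : 'I_N -> R.

Definition dot u v : R := \sum_i u i * v i.
Definition nrm u : R := Num.sqrt (dot u u).

Lemma dotC u v : dot u v = dot v u.
Proof. by apply: eq_bigr => i _; rewrite mulrC. Qed.

Lemma dotDl u v w : dot (fun i => u i + v i) w = dot u w + dot v w.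
Proof. by rewrite /dot -big_split; apply: eq_bigr => i _ /=; rewrite mulrDl. Qed.

Lemma dotZl a u v : dot (fun i => a * u i) v = a * dot u v.
Proof. by rewrite /dot mulr_sumr; apply: eq_bigr => i _; rewrite mulrA. Qed.

Lemma dotNl u v : dot (fun i => - u i) v = - dot u v.
Proof. by rewrite /dot -sumrN; apply: eq_bigr => i _; rewrite mulNr. Qed.

Lemma dotDr u v w : dot w (fun i => u i + v i) = dot w u + dot w v.
Proof. by rewrite dotC dotDl !(dotC w). Qed.

Lemma dotZr a u v : dot v (fun i => a * u i) = a * dot v u.
Proof. by rewrite dotC dotZl (dotC v). Qed.

Lemma dotNr u v : dot v (fun i => - u i) = - dot v u.
Proof. by rewrite dotC dotNl (dotC v). Qed.

Definition dotE := (dotDl, dotZl, dotNl, dotDr, dotZr, dotNr).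

Lemma dot_ge0 u : 0 <= dot u u.
Proof. by apply: sumr_ge0 => i _; rewrite -expr2 sqr_ge0. Qed.

Lemma nrm_ge0 u : 0 <= nrm u. Proof. exact: sqrtr_ge0. Qed.

Lemma sqr_nrm u : nrm u ^+ 2 = dot u u.
Proof. by rewrite sqr_sqrtr// dot_ge0. Qed.

Lemma dot_sqr_le u v : dot u v ^+ 2 <= dot u u * dot v v.
Proof.
have [v0|v0] := eqVneq (dot v v) 0.
  suff -> : dot u v = 0 by rewrite expr0n/= mulr_ge0// dot_ge0.
  apply: big1 => i _.
  have /eqP := v0; rewrite psumr_eq0 => [|j _]; last by rewrite -expr2 sqr_ge0.
  move=> /allP /(_ i (mem_index_enum _)) /=; rewrite mulf_eq0 orbb => /eqP ->.
  by rewrite mulr0.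
have vp : 0 < dot v v by rewrite lt_def v0 dot_ge0.
have := dot_ge0 (fun i => dot v v * u i + - (dot u v * v i)).
rewrite !dotE (dotC v u) (_ : _ + _ = dot v v * (dot u u * dot v v - dot u v ^+ 2)).
  by rewrite pmulr_rge0// subr_ge0.
by ring.
Qed.

Lemma cauchy_schwarz u v : `|dot u v| <= nrm u * nrm v.
Proof.
rewrite -(@ler_pXn2r _ 2)// ?nnegrE ?mulr_ge0 ?nrm_ge0//.
by rewrite real_normK ?num_real// exprMn !sqr_nrm dot_sqr_le.
Qed.

Lemma nrmD u v : nrm (fun i => u i + v i) <= nrm u + nrm v.
Proof.
rewrite -(@ler_pXn2r _ 2)// ?nnegrE ?addr_ge0 ?nrm_ge0//.
rewrite sqrrD !sqr_nrm !dotE (dotC v u).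
have := le_trans (ler_norm _) (cauchy_schwarz u v); lra.
Qed.

Lemma nrmZ a u : nrm (fun i => a * u i) = `|a| * nrm u.
Proof.
by rewrite /nrm !dotE mulrA -expr2 sqrtrM ?sqr_ge0// sqrtr_sqr.
Qed.

Lemma nrm_le (u : 'I_N -> R) (c : R) : 0 <= c -> dot u u <= c ^+ 2 -> nrm u <= c.
Proof.
by move=> c0 uc; rewrite -(@ler_pXn2r _ 2)// ?nnegrE ?nrm_ge0// sqr_nrm.
Qed.

Lemma ler_norm_nrm u i : `|u i| <= nrm u.
Proof.
rewrite -(@ler_pXn2r _ 2)// ?nnegrE ?nrm_ge0// sqr_nrm real_normK ?num_real//.
rewrite /dot (bigD1 i)//= -expr2 lerDl.
by apply: sumr_ge0 => j _; rewrite -expr2 sqr_ge0.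
Qed.

End euclid.

Section min_exp.
Context {R : realType}.

Lemma expR_sub_le (a b : R) : a <= b -> b <= 0 -> expR b - expR a <= b - a.
Proof.
move=> ab b0.
have : expR b * (1 - expR (a - b)) <= 1 * (b - a).
  apply: ler_pM; first exact: expR_ge0.
  - by rewrite subr_ge0 -expR0 ler_expR subr_le0.
  - by rewrite -expR0 ler_expR.
  - by have := expR_ge1Dx (a - b); lra.
by rewrite mulrBr mulr1 -expRD mul1r (_ : b + (a - b) = a)//; ring.
Qed.

(** 1 /\ exp x = exp (x /\ 0), and exp is 1-Lipschitz on the negative reals. *)
Lemma min1_expR_lip (a b : R) :
  `|Num.min 1 (expR a) - Num.min 1 (expR b)| <= `|a - b|.
Proof.
wlog ab : a b / a <= b.
  move=> H; have [|/ltW] := leP a b; first exact: H.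
  by move=> /H; rewrite distrC [leRHS]distrC.
have m (x : R) : Num.min 1 (expR x) = expR (Num.min x 0).
  have [x0|x0] := leP x 0.
    by rewrite min_r// -expR0 ler_expR.
  by rewrite expR0 min_l// -[leLHS]expR0 ler_expR ltW.
rewrite !m distrC [leRHS]distrC.
have mab : Num.min a 0 <= Num.min b 0 by rewrite (le_min2 ab).
rewrite ger0_norm ?subr_ge0 ?ler_expR// ger0_norm ?subr_ge0//.
apply: (le_trans (expR_sub_le mab _)); first by rewrite ge_min lexx orbT.
by rewrite /Num.min; case: ltP => ?; case: ltP => ?; lra.
Qed.

End min_exp.

(** * The chain in whitened coordinates *)

Section norm_bounds.
Context {R : realType}.
Implicit Types c p x t : R.

Lemma ler_normZ c x t : 0 <= c -> `|x| <= t -> `|c * x| <= c * t.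
Proof. by move=> c0 xt; rewrite normrM ger0_norm// ler_wpM2l. Qed.

Lemma ler_norm_shrink p x t : 0 <= p <= 1 -> `|x| <= t -> `|p * x| <= t.
Proof.
move=> /andP[p0 p1] xt; rewrite normrM ger0_norm//.
by apply: le_trans xt; rewrite ler_piMl.
Qed.

Lemma ler_norm_add x y s t : `|x| <= s -> `|y| <= t -> `|x + y| <= s + t.
Proof. by move=> xs yt; apply: le_trans (ler_normD _ _) (lerD xs yt). Qed.

Lemma ler_norm_sub x y s t : `|x| <= s -> `|y| <= t -> `|x - y| <= s + t.
Proof. by move=> xs yt; apply: le_trans (ler_normB _ _) (lerD xs yt). Qed.

End norm_bounds.

Section white_chain.
Context {R : realType} {N : nat}.
Implicit Types z xi : 'I_N -> R.
Variables (sw : 'I_N -> R) (V : ('I_N -> R) -> R)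
  (g : ('I_N -> R) -> 'I_N -> R).

(** With sw j = j^s lambda_j, the norm of H^s read in whitened coordinates. *)
Definition wnrm z := nrm (fun i => sw i * z i).

(** What the limit theorem uses of the potential V = Psi and of the
    preconditioned gradient g = C^(1/2) grad Psi, with constants that do not
    depend on the dimension.  The pairing of z' - z with g is controlled by the
    norm of H^s and not only by the Euclidean one: the first is of order
    N^(-1/4) for a proposal, the second of order N^(1/4). *)
Record tame_potential (M L W : R) : Prop := {
  tame_M0 : 0 <= M;
  tame_L0 : 0 <= L;
  tame_W0 : 0 <= W;
  tame_weights : dot sw sw <= W ^+ 2;
  tame_grad : forall z, nrm (g z) <= M;
  tame_lip : forall z z', `|V z - V z'| <= L * wnrm (fun i => z' i - z i);
  tame_grad_lip : forall z z',
    nrm (fun i => g z' i - g z i) <= L * wnrm (fun i => z' i - z i);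
  tame_pairing : forall z z',
    `|dot (fun i => z' i - z i) (fun i => g z i + g z' i)|
      <= 2 * L * wnrm (fun i => z' i - z i) }.

Definition wproposal (delta : R) z xi : 'I_N -> R :=
  fun i => z i - delta * (z i + g z i) + Num.sqrt (2 * delta) * xi i.

(** In the logarithm of the acceptance ratio the term (|z|^2 - |z'|^2) / 2 of the
    target cancels against a cross term of the proposal densities; this is what
    is left. *)
Definition log_ratio (delta : R) z z' : R :=
  V z - V z' + 2^-1 * dot (fun i => z' i - z i) (fun i => g z i + g z' i)
  - delta / 4 * (dot (fun i => z' i + g z' i) (fun i => z' i + g z' i)
               - dot (fun i => z i + g z i) (fun i => z i + g z i)).

Definition waccept (delta : R) z z' : R :=
  Num.min 1 (expR (log_ratio delta z z')).

Definition wstep (delta : R) z xi (u : R) : 'I_N -> R :=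
  if u <= waccept delta z (wproposal delta z xi)
  then wproposal delta z xi else z.

Fixpoint wchain (delta : R) z (xi : nat -> 'I_N -> R) (u : nat -> R) (k : nat)
    : 'I_N -> R :=
  if k is k'.+1 then wstep delta (wchain delta z xi u k') (xi k') (u k')
  else z.

Lemma waccept01 delta z z' : 0 <= waccept delta z z' <= 1.
Proof. by rewrite /waccept le_min ler01 expR_ge0/= ge_min lexx. Qed.

Lemma wnrm_ge0 z : 0 <= wnrm z. Proof. exact: nrm_ge0. Qed.

Lemma wnrmD z z' : wnrm (fun i => z i + z' i) <= wnrm z + wnrm z'.
Proof.
apply: le_trans (nrmD _ _); rewrite le_eqVlt; apply/orP; left; apply/eqP; congr nrm.
by apply/funext => i; rewrite mulrDr.
Qed.

Lemma wnrmZ a z : wnrm (fun i => a * z i) = `|a| * wnrm z.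
Proof.
by rewrite -nrmZ /wnrm; congr nrm; apply/funext => i; rewrite mulrCA.
Qed.

Lemma wnrm_le_nrm (W : R) z : 0 <= W -> dot sw sw <= W ^+ 2 ->
  wnrm z <= W * nrm z.
Proof.
move=> W0 hW; apply: nrm_le; first by rewrite mulr_ge0 ?nrm_ge0.
rewrite exprMn sqr_nrm /dot mulr_sumr; apply: ler_sum => i _.
rewrite mulrACA; apply: ler_wpM2r; first by rewrite -expr2 sqr_ge0.
apply: le_trans hW; rewrite /dot (bigD1 i)//= lerDl.
by apply: sumr_ge0 => j _; rewrite -expr2 sqr_ge0.
Qed.

End white_chain.

Section remainder.
Context {R : realType}.

Definition remainder_const (l s2 b M : R) : R :=
  2 * l + 2 * s2 + 2 * l * (b * M) + l ^+ 2 * (2 * (b ^+ 2 + M ^+ 2))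
  + 2 * l * s2 * (1 + M).

(** The remainder of the change of |z|^2, multiplied by p = N^(-1/4): a and y
    are the rescaled noise terms |xi|^2 - N and z.xi, and t is 1 plus their
    size. *)
Lemma remainder_bound (p l s2 b M a y c e f t : R) :
  0 <= p <= 1 -> 0 <= l -> 0 <= s2 -> 0 <= b -> 0 <= M -> 
  `|a| + `|y| <= t - 1 -> `|c| <= b * M ->
  `|e| <= 2 * (b ^+ 2 + M ^+ 2) -> `|f| <= M * t ->
  `|2 * l * (p * a) + 2 * s2 * y - 2 * l * (p * c) + l ^+ 2 * (p * e)
    - 2 * l * s2 * (p * (p * (y + f)))| <= remainder_const l s2 b M * t.
Proof.
move=> p01 l0 s20 b0 M0 ayt cb eb fb.
have a0 := normr_ge0 a; have y0 := normr_ge0 y.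
have t1 : 1 <= t by lra.
have ht (x : R) : 0 <= x -> x <= x * t by move=> x0; rewrite ler_peMr.
rewrite (_ : remainder_const _ _ _ _ * t = 2 * l * t + 2 * s2 * t
  + 2 * l * (b * M) * t + l ^+ 2 * (2 * (b ^+ 2 + M ^+ 2)) * t
  + 2 * l * s2 * ((1 + M) * t)); last by rewrite /remainder_const; ring.
apply: ler_norm_sub; first apply: ler_norm_add; first apply: ler_norm_sub;
  first apply: ler_norm_add.
- by apply: ler_normZ; [rewrite mulr_ge0|apply: ler_norm_shrink => //; lra].
- by apply: ler_normZ; [rewrite mulr_ge0|lra].
- apply: le_trans (ht _ _); last by rewrite !mulr_ge0.
  by apply: ler_normZ; [rewrite mulr_ge0|apply: ler_norm_shrink].
- apply: le_trans (ht _ _).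
    by apply: ler_normZ; [exact: sqr_ge0|apply: ler_norm_shrink].
  by rewrite !mulr_ge0// ?sqr_ge0// addr_ge0 ?sqr_ge0.
- apply: ler_normZ; first by rewrite !mulr_ge0.
  do 2 apply: ler_norm_shrink => //.
  rewrite mulrDl mul1r; apply: ler_norm_add; first lra.
  exact: fb.
Qed.

End remainder.

Section one_step.
Context {R : realType} {N : nat}.
Implicit Types z xi : 'I_N -> R.
Variables (sw : 'I_N -> R) (V : ('I_N -> R) -> R)
  (g : ('I_N -> R) -> 'I_N -> R).

(** The first term is the drift of |z|^2 towards N, of order N^(1/2) when
    delta is of order N^(-1/2); the terms in parentheses are of order
    N^(1/4). *)
Lemma wproposal_sqnorm delta z xi : 0 <= delta ->
  dot (wproposal g delta z xi) (wproposal g delta z xi) - dot z z =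
  2 * delta * (N%:R - dot z z) +
  (2 * delta * (dot xi xi - N%:R)
   + 2 * Num.sqrt (2 * delta) * dot z xi
   - 2 * delta * dot z (g z)
   + delta ^+ 2 * dot (fun i => z i + g z i) (fun i => z i + g z i)
   - 2 * delta * Num.sqrt (2 * delta) * (dot z xi + dot (g z) xi)).
Proof.
move=> d0; set s := Num.sqrt _.
have s2 : s ^+ 2 = 2 * delta by rewrite sqr_sqrtr// mulr_ge0.
rewrite /wproposal -/s !dotE (dotC xi z) (dotC xi (g z)) (dotC (g z) z).
have e : s * (s * dot xi xi) = 2 * delta * dot xi xi.
  by rewrite mulrA -expr2 s2.
by rewrite e; ring.
Qed.

(** Makes visible the change of |z|^2, whose drift is the only part of the
    logarithm of the acceptance ratio that does not vanish in the limit. *)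
Lemma log_ratioE delta z z' :
  log_ratio V g delta z z' = V z - V z'
  + 2^-1 * dot (fun i => z' i - z i) (fun i => g z i + g z' i)
  - delta / 4 * ((dot z' z' - dot z z)
    + 2 * (dot (fun i => z' i - z i) (g z')
           + dot z (fun i => g z' i - g z i))
    + dot (g z') (g z') - dot (g z) (g z)).
Proof.
rewrite /log_ratio; congr (_ - _ * _).
rewrite !dotE (dotC (g z') z') (dotC (g z) z).
by ring.
Qed.

End one_step.

(** * One step of the chain *)

Ltac nonneg := repeat first [done | exact: sqr_ge0 | exact: nrm_ge0
  | exact: normr_ge0 | exact: dot_ge0 | exact: ltW | apply: exprn_ge0
  | apply: addr_ge0 | apply: mulr_ge0
  | (rewrite invr_ge0; exact: ler0n)].

Section one_step_error.
Context {R : realType} {N : nat}.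
Implicit Types z xi : 'I_N -> R.
Variables (sw : 'I_N -> R) (V : ('I_N -> R) -> R)
  (g : ('I_N -> R) -> 'I_N -> R) (M L W : R).
Hypothesis tame : tame_potential sw V g M L W.
(* p is N^(-1/4), and b^2 is a level below which |z|^2 / N is assumed to be. *)
Variables (p l b : R).
Hypotheses (p0 : 0 < p) (p1 : p <= 1) (Np : N%:R * p ^+ 4 = 1)
  (l0 : 0 < l) (b0 : 0 <= b).

Let delta := l * p ^+ 2.
Let s2 := Num.sqrt (2 * l).
Let CR := remainder_const l s2 b M.
Let CQ := l / 4 * CR + l / 2 * M * (l * (b + M) + s2) + l / 2 * M ^+ 2.
Let Cr := 2 * L + l / 2 * (b * L).
Definition step_const := 2 * l * (1 + b ^+ 2) * (CQ + Cr * (l * (W * M) + s2) + Cr * l) + CR.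

Let p01 : 0 <= p <= 1. Proof. by rewrite (ltW p0). Qed.
Let s20 : 0 <= s2. Proof. exact: sqrtr_ge0. Qed.
Let M0 := tame_M0 tame.
Let L0 := tame_L0 tame.
Let W0 := tame_W0 tame.

Let sqrt_delta : Num.sqrt (2 * delta) = s2 * p.
Proof.
by rewrite /delta mulrA sqrtrM ?mulr_ge0 ?(ltW l0)// sqrtr_sqr gtr0_norm.
Qed.

Let delta0 : 0 <= delta.
Proof. by rewrite /delta mulr_ge0 ?(ltW l0)// sqr_ge0. Qed.

Lemma remainder_const_ge0 : 0 <= CR.
Proof.
by rewrite /CR /remainder_const; nonneg.
Qed.

Lemma step_const_ge0 : 0 <= step_const.
Proof.
have CR0 := remainder_const_ge0; have l0' := ltW l0.
have CQ0 : 0 <= CQ by rewrite /CQ; nonneg.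
have Cr0 : 0 <= Cr by rewrite /Cr; nonneg.
by rewrite /step_const; nonneg.
Qed.

Section estimates.
Variables (z xi : 'I_N -> R).
Hypothesis zb : p ^+ 4 * dot z z <= b ^+ 2.

Let z' := wproposal g delta z xi.
(* t is of order 1, and r, the length of the jump in H^s, of order p. *)
Let t := 1 + p ^+ 2 * `|dot xi xi - N%:R| + p ^+ 2 * `|dot z xi|.
Let r := wnrm sw (fun i => z' i - z i).
Let rem := 2 * delta * (dot xi xi - N%:R)
   + 2 * Num.sqrt (2 * delta) * dot z xi
   - 2 * delta * dot z (g z)
   + delta ^+ 2 * dot (fun i => z i + g z i) (fun i => z i + g z i)
   - 2 * delta * Num.sqrt (2 * delta) * (dot z xi + dot (g z) xi).

Let t1 : 1 <= t.
Proof. by rewrite /t -addrA lerDl addr_ge0// mulr_ge0// sqr_ge0. Qed.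

Let nz : p ^+ 2 * nrm z <= b.
Proof.
have h : 0 <= p ^+ 2 * nrm z by nonneg.
rewrite -(@ler_pXn2r _ 2)// ?nnegrE//.
by rewrite exprMn -exprM sqr_nrm; exact: zb.
Qed.

(* |xi|^2 = N + (|xi|^2 - N), and p^4 N = 1. *)
Let nxi : p ^+ 2 * nrm xi <= t.
Proof.
have t0 : 0 <= t := le_trans ler01 t1.
have h : 0 <= p ^+ 2 * nrm xi by nonneg.
rewrite -(@ler_pXn2r _ 2)// ?nnegrE//.
rewrite exprMn -exprM sqr_nrm /=.
set a := p ^+ 2 * `|dot xi xi - N%:R|.
have a0 : 0 <= a by rewrite mulr_ge0 ?sqr_ge0.
have ta : 1 + a <= t by rewrite /t lerDl mulr_ge0 ?sqr_ge0.
apply: (@le_trans _ _ (1 + a)).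
  have -> : p ^+ (2 * 2) * dot xi xi = N%:R * p ^+ 4
     + p ^+ 2 * (p ^+ 2 * (dot xi xi - N%:R)) by ring.
  rewrite Np lerD2l; apply: le_trans (ler_norm _) _.
  have p201 : 0 <= p ^+ 2 <= 1 by rewrite sqr_ge0 exprn_ile1// ltW.
  apply: ler_norm_shrink => //.
  by rewrite /a normrM (ger0_norm (sqr_ge0 p)).
by rewrite (le_trans ta)// expr2 ler_peMr.
Qed.

Lemma remainder_le : p * `|rem| <= CR * t.
Proof.
rewrite -[X in X * _ <= _](gtr0_norm p0) -normrM.
have -> : p * rem = 2 * l * (p * (p ^+ 2 * (dot xi xi - N%:R)))
  + 2 * s2 * (p ^+ 2 * dot z xi)
  - 2 * l * (p * (p ^+ 2 * dot z (g z)))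
  + l ^+ 2 * (p * (p ^+ 4 * dot (fun i => z i + g z i) (fun i => z i + g z i)))
  - 2 * l * s2 * (p * (p * (p ^+ 2 * dot z xi + p ^+ 2 * dot (g z) xi))).
  by rewrite /rem sqrt_delta /delta; ring.
have p20 := sqr_ge0 p.
apply: remainder_bound => //; first exact: ltW.
- have hn (x : R) : `|p ^+ 2 * x| = p ^+ 2 * `|x|.
    by rewrite normrM (ger0_norm p20).
  by rewrite !hn /t -(addrA 1) [leRHS]addrAC subrr add0r.
- rewrite normrM (ger0_norm p20).
  apply: (le_trans (ler_wpM2l p20 (cauchy_schwarz _ _))).
  rewrite mulrA; apply: ler_pM => //; first by rewrite mulr_ge0// nrm_ge0.
  - exact: nrm_ge0.
  - exact: (tame_grad tame).
- rewrite ger0_norm; last by rewrite mulr_ge0 ?dot_ge0// exprn_ge0// ltW.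
  have h : p ^+ 2 * nrm (fun i => z i + g z i) <= b + M.
    apply: (le_trans (ler_wpM2l p20 (nrmD _ _))).
    rewrite mulrDr; apply: lerD => //.
    rewrite -[leRHS]mul1r; apply: ler_pM => //; first exact: nrm_ge0.
      by rewrite exprn_ile1// ltW.
    exact: (tame_grad tame).
  have : (p ^+ 2 * nrm (fun i => z i + g z i)) ^+ 2 <= (b + M) ^+ 2.
    by rewrite lerXn2r ?nnegrE//; nonneg.
  rewrite exprMn -exprM sqr_nrm => /le_trans; apply.
  have := sqr_ge0 (b - M); rewrite !expr2; lra.
- rewrite normrM (ger0_norm p20).
  apply: (le_trans (ler_wpM2l p20 (cauchy_schwarz _ _))).
  rewrite mulrCA; apply: ler_pM => //; first exact: nrm_ge0.
  - by rewrite mulr_ge0// nrm_ge0.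
  - exact: (tame_grad tame).
Qed.

Lemma proposal_move_nrm :
  p * nrm (fun i => z' i - z i) <= (l * (b + M) + s2) * t.
Proof.
have l0' := ltW l0; have p0' := ltW p0; have p20 := sqr_ge0 p.
have -> : (fun i => z' i - z i) =
  (fun i => - delta * (z i + g z i) + Num.sqrt (2 * delta) * xi i).
  by apply/funext => i; rewrite /z' /wproposal; ring.
apply: (le_trans (ler_wpM2l p0' (nrmD _ _))).
rewrite !nrmZ normrN (ger0_norm delta0) sqrt_delta (ger0_norm (mulr_ge0 _ _))//.
have h : p ^+ 2 * nrm (fun i => z i + g z i) <= b + M.
  apply: (le_trans (ler_wpM2l p20 (nrmD _ _))).
  rewrite mulrDr; apply: lerD => //.
  rewrite -[leRHS]mul1r; apply: ler_pM => //; first exact: nrm_ge0.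
    by rewrite exprn_ile1.
  exact: (tame_grad tame).
rewrite mulrDr mulrDl; apply: lerD.
  rewrite [leLHS](_ : _ = l * (p * (p ^+ 2 * nrm (fun i => z i + g z i)))); last first.
    by rewrite /delta; ring.
  rewrite -mulrA; apply: ler_wpM2l => //.
  apply: (@le_trans _ _ (b + M)); last by rewrite ler_peMr// addr_ge0.
  by apply: le_trans h; rewrite ler_piMl//; nonneg.
rewrite [leLHS](_ : _ = s2 * (p ^+ 2 * nrm xi)); last by ring.
exact: ler_wpM2l.
Qed.

Lemma proposal_move_wnrm :
  r <= l * p ^+ 2 * wnrm sw z + p * (l * (W * M) + s2 * wnrm sw xi).
Proof.
have l0' := ltW l0; have p0' := ltW p0; have p20 := sqr_ge0 p.
rewrite /r; have -> : (fun i => z' i - z i) =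
  (fun i => - delta * (z i + g z i) + Num.sqrt (2 * delta) * xi i).
  by apply/funext => i; rewrite /z' /wproposal; ring.
apply: (le_trans (wnrmD _ _ _)).
rewrite !wnrmZ normrN (ger0_norm delta0) sqrt_delta (ger0_norm (mulr_ge0 _ _))//.
have h : wnrm sw (fun i => z i + g z i) <= wnrm sw z + W * M.
  apply: (le_trans (wnrmD _ _ _)); rewrite lerD2l.
  apply: (le_trans (wnrm_le_nrm _ W0 (tame_weights tame))).
  by apply: ler_wpM2l => //; exact: (tame_grad tame).
apply: (@le_trans _ _ (delta * (wnrm sw z + W * M) + s2 * p * wnrm sw xi)).
  by rewrite lerD2r; apply: ler_wpM2l.
rewrite /delta -subr_ge0 (_ : _ - _ = l * (W * M) * (p * (1 - p))); last by ring.
by rewrite !mulr_ge0// subr_ge0.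
Qed.

(** The term - delta / 4 * 2 delta (N - |z|^2) of log_ratioE equals
    l^2 (S - 1) / 2 for S = p^4 |z|^2; the others carry a factor p or r. *)
Lemma log_ratio_le :
  `|log_ratio V g delta z z' - l ^+ 2 * (p ^+ 4 * dot z z - 1) / 2|
    <= CQ * (p * t) + Cr * r.
Proof.
have l0' := ltW l0; have p0' := ltW p0; have p20 := sqr_ge0 p.
have r0 : 0 <= r by exact: wnrm_ge0.
rewrite log_ratioE wproposal_sqnorm// -/rem.
set D1 := dot (fun i => z' i - z i) (fun i => g z i + g z' i).
set D2 := dot (fun i => z' i - z i) (g z').
set D3 := dot z (fun i => g z' i - g z i).
have -> : V z - V z' + 2^-1 * D1
   - delta / 4 * (2 * delta * (N%:R - dot z z) + rem + 2 * (D2 + D3)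
                  + dot (g z') (g z') - dot (g z) (g z))
   - l ^+ 2 * (p ^+ 4 * dot z z - 1) / 2 =
  V z - V z' + 2^-1 * D1 - l / 4 * (p * (p * rem)) - l / 2 * (p * (p * D2))
  - l / 2 * (p ^+ 2 * D3)
  - l / 4 * (p ^+ 2 * (dot (g z') (g z') - dot (g z) (g z)))
  - l ^+ 2 / 2 * (N%:R * p ^+ 4 - 1).
  by rewrite /delta; field.
rewrite Np subrr mulr0 subr0.
have hM y : 0 <= dot (g y) (g y) <= M ^+ 2.
  rewrite dot_ge0 -sqr_nrm lerXn2r ?nnegrE ?nrm_ge0//.
  exact: (tame_grad tame).
have -> : CQ * (p * t) + Cr * r =
  L * r + 2^-1 * (2 * L * r) + l / 4 * (p * (CR * t))
  + l / 2 * (p * (M * (l * (b + M) + s2) * t)) + l / 2 * (b * L * r)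
  + l / 4 * (p * t * (2 * M ^+ 2)) by rewrite /CQ /Cr; field.
have n2 : p * nrm (fun i => z' i - z i) <= (l * (b + M) + s2) * t.
  exact: proposal_move_nrm.
have d3 : p ^+ 2 * `|D3| <= b * L * r.
  apply: (le_trans (ler_wpM2l p20 (cauchy_schwarz _ _))).
  rewrite mulrA -[leRHS]mulrA; apply: ler_pM => //; [nonneg|nonneg|].
  exact: (tame_grad_lip tame).
apply: ler_norm_sub; first apply: ler_norm_sub; first apply: ler_norm_sub;
  first apply: ler_norm_sub; first apply: ler_norm_add.
- exact: (tame_lip tame).
- by apply: ler_normZ; [nonneg|exact: (tame_pairing tame)].
- apply: ler_normZ; first nonneg.
  by apply: ler_normZ => //; rewrite normrM (gtr0_norm p0) remainder_le.
- apply: ler_normZ; first nonneg.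
  apply: ler_normZ => //; rewrite normrM (gtr0_norm p0).
  apply: (le_trans (ler_wpM2l p0' (cauchy_schwarz _ _))).
  rewrite mulrA -(mulrA M) [leRHS]mulrC; apply: ler_pM => //; [nonneg|nonneg|].
  exact: (tame_grad tame).
- apply: ler_normZ; first nonneg.
  by rewrite normrM (ger0_norm p20).
- apply: ler_normZ; first nonneg.
  rewrite normrM (ger0_norm p20); apply: ler_pM => //.
    by rewrite expr2 ler_wpM2l// (le_trans p1).
  have /andP[h1 h2] := hM z; have /andP[h3 h4] := hM z'.
  by rewrite ler_norml; apply/andP; split; lra.
Qed.

(** With gamma the acceptance indicator and alpha its probability, S changes by
    gamma (2 delta (1 - S) + remainder).  Splitting gamma into
    (gamma - alpha) + alpha isolates the centred part, and replacing alpha by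
    1 /\ exp (l^2 (S - 1) / 2), by log_ratio_le, produces the drift. *)
Lemma one_step_error (u : R) :
  `|p ^+ 4 * dot (wstep V g delta z xi u) (wstep V g delta z xi u)
     - p ^+ 4 * dot z z
     - 2 * delta * (1 - p ^+ 4 * dot z z)
         * ((u <= waccept V g delta z z')%R%:R - waccept V g delta z z')
     - p ^+ 2 * drift l (p ^+ 4 * dot z z)|
  <= step_const * (p ^+ 3 * (t + wnrm sw xi) + p ^+ 4 * wnrm sw z).
Proof.
have l0' := ltW l0; have p0' := ltW p0; have p20 := sqr_ge0 p.
set z1 := wstep V g delta z xi u; set S := p ^+ 4 * dot z z.
set a := waccept V g delta z z'; set gam : R := (u <= a)%R%:R.
have p40 : 0 <= p ^+ 4 by exact: exprn_ge0.
have S0 : 0 <= S by rewrite mulr_ge0// dot_ge0.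
have gam01 : 0 <= gam <= 1 by rewrite /gam; case: (u <= a); rewrite /= lexx ler01.
have e1 : p ^+ 4 * dot z1 z1 - S = gam * (2 * delta * (1 - S) + p ^+ 4 * rem).
  rewrite /z1 /wstep -/z' -/a /gam /S; case: ifP => _; last first.
    by rewrite mul0r subrr.
  rewrite mul1r -mulrBr wproposal_sqnorm// -/rem mulrDr; congr (_ + _).
  rewrite mulrCA; congr (_ * _); rewrite mulrBr mulrC Np//.
have e2 : p ^+ 2 * drift l S =
    2 * delta * (1 - S) * Num.min 1 (expR (l ^+ 2 * (S - 1) / 2)).
  by rewrite /drift /delta; ring.
rewrite e1 e2; set h := Num.min 1 _.
have -> : gam * (2 * delta * (1 - S) + p ^+ 4 * rem)
    - 2 * delta * (1 - S) * (gam - a) - 2 * delta * (1 - S) * h =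
  2 * l * ((1 - S) * (p ^+ 2 * (a - h))) + p ^+ 3 * (gam * (p * rem)).
  by rewrite /delta; ring.
have ah : `|a - h| <= CQ * (p * t) + Cr * r.
  by apply: (le_trans (min1_expR_lip _ _)); exact: log_ratio_le.
have rb := proposal_move_wnrm.
have CR0 := remainder_const_ge0.
have CQ0 : 0 <= CQ by rewrite /CQ; nonneg.
have Cr0 : 0 <= Cr by rewrite /Cr; nonneg.
have b20 : 0 <= 1 + b ^+ 2 by nonneg.
have t0 : 0 <= t := le_trans ler01 t1.
have tm : 0 <= t - 1 by rewrite subr_ge0.
have wz := wnrm_ge0 sw z; have wx := wnrm_ge0 sw xi.
have r0 : 0 <= r by exact: wnrm_ge0.
set T := p ^+ 3 * (t + wnrm sw xi) + p ^+ 4 * wnrm sw z.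
have pah : p ^+ 2 * `|a - h| <= (CQ + Cr * (l * (W * M) + s2) + Cr * l) * T.
  apply: (le_trans (ler_wpM2l p20 ah)).
  have := ler_wpM2l (mulr_ge0 Cr0 p20) rb.
  have h1 : 0 <= CQ * (p ^+ 3 * wnrm sw xi) by nonneg.
  have h2 : 0 <= CQ * (p ^+ 4 * wnrm sw z) by nonneg.
  have h3 : 0 <= Cr * (l * (W * M) + s2) * (p ^+ 4 * wnrm sw z) by nonneg.
  have h4 : 0 <= Cr * l * (p ^+ 3 * (t + wnrm sw xi)) by nonneg.
  have h5 : 0 <= Cr * (l * (W * M)) * (p ^+ 3 * (t - 1 + wnrm sw xi)).
    by nonneg.
  have h6 : 0 <= Cr * s2 * (p ^+ 3 * t) by nonneg.
  rewrite /T; move: h1 h2 h3 h4 h5 h6; move: (wnrm sw z) (wnrm sw xi) => y x.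
  move=> h1 h2 h3 h4 h5 h6 h7.
  rewrite -subr_ge0.
  move: h7; rewrite -subr_ge0 => h7.
  apply: le_trans (addr_ge0 (addr_ge0 (addr_ge0 h1 h2) (addr_ge0 h3 h4))
    (addr_ge0 (addr_ge0 h5 h6) h7)) _.
  by rewrite le_eqVlt; apply/orP; left; apply/eqP; ring.
have c0 : 0 <= CQ + Cr * (l * (W * M) + s2) + Cr * l by nonneg.
have T0 : 0 <= T by rewrite /T; nonneg.
rewrite /step_const [leRHS]mulrDl; apply: ler_norm_add.
  rewrite -2![leRHS]mulrA; apply: ler_normZ; first nonneg.
  rewrite normrM; apply: ler_pM => //.
    have Sb : S <= b ^+ 2 by exact: zb.
    by rewrite ler_norml; apply/andP; split; lra.
  by rewrite normrM (ger0_norm p20).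
apply: (@le_trans _ _ (p ^+ 3 * (CR * t))).
  apply: ler_normZ; first exact: exprn_ge0.
  by apply: ler_norm_shrink => //; rewrite normrM (gtr0_norm p0) remainder_le.
rewrite mulrCA; apply: ler_wpM2l => //; rewrite /T.
rewrite -subr_ge0 (_ : _ - _ = p ^+ 3 * wnrm sw xi + p ^+ 4 * wnrm sw z).
  by nonneg.
by ring.
Qed.

End estimates.
End one_step_error.

(** * The limiting differential equation *)

Section drift_ode.
Context {R : realType}.
Variable l : R.
Hypothesis l0 : 0 < l.

Let f (u : R) := u * Num.min 1 (expR (- (l ^+ 2 / 2 * u))).

Lemma mul_expRN_le1 (x : R) : x * expR (- x) <= 1.
Proof.
rewrite expRN ler_pdivrMr ?expR_gt0// mul1r.
by apply: le_trans (expR_ge1Dx x); rewrite lerDr.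
Qed.

Let f_neg u : u <= 0 -> f u = u.
Proof.
move=> u0; rewrite /f min_l ?mulr1// -[leLHS]expR0 ler_expR oppr_ge0.
by rewrite mulr_ge0_le0// divr_ge0// sqr_ge0.
Qed.

Let f_pos u : 0 <= u -> f u = u * expR (- (l ^+ 2 / 2 * u)).
Proof.
move=> u0; rewrite /f min_r// -[leRHS]expR0 ler_expR oppr_le0.
by rewrite mulr_ge0// divr_ge0// sqr_ge0.
Qed.

Let f_lip u v : v <= u -> `|f u - f v| <= u - v.
Proof.
move=> vu.
have c0 : 0 <= l ^+ 2 / 2 by rewrite divr_ge0// sqr_ge0.
have [u0|u0] := leP u 0.
  by rewrite !f_neg// ?(le_trans vu)// ger0_norm// subr_ge0.
have e1 : expR (- (l ^+ 2 / 2 * u)) <= 1.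
  by rewrite -[leRHS]expR0 ler_expR oppr_le0 mulr_ge0// ltW.
have [v0|v0] := leP v 0.
  rewrite (f_neg v0) (f_pos (ltW u0)) ger0_norm.
    by rewrite lerD2r ler_piMr// ltW.
  by rewrite subr_ge0 (le_trans v0)// mulr_ge0 ?expR_ge0// ltW.
rewrite (f_pos (ltW u0)) (f_pos (ltW v0)).
set eu := expR (- (l ^+ 2 / 2 * u)); set ev := expR (- (l ^+ 2 / 2 * v)).
have euv : eu <= ev by rewrite ler_expR lerN2 ler_wpM2l.
have eu0 : 0 <= eu by exact: expR_ge0.
have h : v * (ev - eu) <= u - v.
  have -> : ev - eu = ev * (1 - expR (- (l ^+ 2 / 2 * (u - v)))).
    by rewrite mulrBr mulr1 -expRD; congr (_ - expR _); ring.
  have := expR_ge1Dx (- (l ^+ 2 / 2 * (u - v))) => h1.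
  have h2 : 1 - expR (- (l ^+ 2 / 2 * (u - v))) <= l ^+ 2 / 2 * (u - v) by lra.
  rewrite mulrA.
  apply: (@le_trans _ _ (v * ev * (l ^+ 2 / 2 * (u - v)))).
    by apply: ler_wpM2l => //; rewrite mulr_ge0 ?expR_ge0// ltW.
  have := mul_expRN_le1 (l ^+ 2 / 2 * v); rewrite -/ev => h3.
  have := ler_wpM2r (_ : 0 <= u - v) h3; rewrite subr_ge0 => /(_ vu).
  by rewrite mul1r; apply: le_trans; rewrite le_eqVlt; apply/orP; left; apply/eqP; ring.
have h' : (u - v) * eu <= u - v by rewrite ler_piMr// subr_ge0.
have h'' : 0 <= (u - v) * eu by rewrite mulr_ge0// subr_ge0.
have h3 : 0 <= v * (ev - eu) by rewrite mulr_ge0 ?(ltW v0)// subr_ge0.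
by rewrite ler_norml; apply/andP; split; lra.
Qed.

(** For u = 1 - x the drift is 2 l u (1 /\ exp (- c u)) with c = l^2 / 2.  The
    second factor is 1 for u <= 0; for u >= 0 the product u exp (- c u) is
    1-Lipschitz because c u exp (- c u) <= 1. *)
Lemma drift_lip x y : `|drift l x - drift l y| <= 2 * l * `|x - y|.
Proof.
have E z : drift l z = 2 * l * f (1 - z).
  rewrite /drift /f -mulrA; congr (_ * (_ * Num.min _ (expR _))).
  by rewrite mulrAC -mulrN opprB.
rewrite !E -mulrBr normrM gtr0_norm ?mulr_gt0//.
rewrite ler_pM2l ?mulr_gt0//.
wlog xy : x y / x <= y.
  move=> H; have [|/ltW] := leP x y; first exact: H.
  by move=> /H; rewrite distrC [leRHS]distrC.
apply: (le_trans (f_lip _)); first by rewrite lerD2l lerN2.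
by rewrite distrC ger0_norm ?subr_ge0//; lra.
Qed.

(** Gronwall: (S1 - S2)^2 exp (- 4 l t) does not increase, since the drift is
    2 l-Lipschitz. *)
Lemma ode_unique T S0 S1 S2 : 0 < T ->
  ode_solution (drift l) T S0 S1 -> ode_solution (drift l) T S0 S2 ->
  {in `[0, T], S1 =1 S2}.
Proof.
move=> T0 [S10 cS1 dS1] [S20 cS2 dS2] t tT.
pose E (s : R) := expR (- (4 * l * s)).
pose D (s : R) := (S1 s - S2 s) ^+ 2 * E s.
have dE (s : R) : is_derive s 1 E (- (4 * l) * E s).
  rewrite (_ : E = expR \o (cst (- (4 * l)) * id)); last first.
    by apply/funext => r; rewrite /E /= mulNr.
  apply: is_derive_eq; rewrite /GRing.scale/=.
  by rewrite mulr0 addr0 mulr1 /E mulrC mulNr.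
have dD (s : R) : s \in `]0, T[ -> is_derive s (1:R) D
    (2 * (S1 s - S2 s) * (drift l (S1 s) - drift l (S2 s)) * E s
      - 4 * l * (S1 s - S2 s) ^+ 2 * E s).
  rewrite in_itv/= => /[dup] s01 /dS1 d1; have d2 := dS2 _ s01.
  change (is_derive s (1:R) ((S1 - S2) ^+ 2 * E)
    (2 * (S1 s - S2 s) * (drift l (S1 s) - drift l (S2 s)) * E s
      - 4 * l * (S1 s - S2 s) ^+ 2 * E s)).
  apply: (is_derive_eq (is_deriveM (is_deriveX 2 (is_deriveB d1 d2)) (dE s))).
  by rewrite /GRing.scale/= !fctE /=; ring.
have cE : continuous E.
  by move=> x; apply: differentiable_continuous; apply/derivable1_diffP;
    have [] := dE x.
have cD : {within `[0, T], continuous D}.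
  move/subspace_continuousP : cS1 => cS1; move/subspace_continuousP : cS2 => cS2.
  apply/subspace_continuousP => x xT.
  have cB : (fun s => S1 s - S2 s) @ within `[0, T] (nbhs x) --> S1 x - S2 x.
    by apply: cvgB; [exact: cS1|exact: cS2].
  apply: cvgM; first exact: (cvgM cB cB).
  by apply: cvg_within_filter; exact: cE.
have D0 : D t <= D 0.
  have T0' : 0 \in `[0, T] by rewrite in_itv/= lexx ltW.
  apply: (ler0_derive1_le_cc (a := 0) (b := T)) => //.
  - by move=> x /dD [].
  - move=> x xT; rewrite derive1E; have [_ ->] := dD x xT.
    rewrite -mulrBl mulr_le0_ge0 ?expR_ge0// subr_le0.
    have := drift_lip (S1 x) (S2 x).
    move: (drift l (S1 x) - drift l (S2 x)) (S1 x - S2 x) => p q pq.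
    apply: (le_trans (ler_norm _)); rewrite normrM normrM ger0_norm//.
    rewrite -(real_normK (num_real q)) expr2.
    have := ler_wpM2l (normr_ge0 q) pq; lra.
  - by move: tT; rewrite in_itv/= => /andP[].
have : D t <= 0.
  by apply: (le_trans D0); rewrite /D S10 S20 subrr expr0n/= mul0r.
rewrite /D pmulr_lle0 ?expR_gt0// => h.
have /eqP : (S1 t - S2 t) ^+ 2 = 0 by apply/le_anti; rewrite h sqr_ge0.
by rewrite sqrf_eq0 subr_eq0 => /eqP.
Qed.

End drift_ode.

Section ode_existence.
Context {R : realType}.
Variable l : R.
Hypothesis l0 : 0 < l.

Lemma is_derive_continuous_at (f : R -> R) (x d : R) :
  is_derive x (1 : R) f d -> {for x, continuous f}.
Proof.
by move=> [df _]; apply: differentiable_continuous; apply/derivable1_diffP.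
Qed.

(* For S < 1 and v = ln (1 - S) the equation becomes v' = - 1 / h v. *)
Let h (v : R) := expR (l ^+ 2 / 2 * expR v) / (2 * l).

Let h_cont : continuous h.
Proof.
move=> x; apply: cvgM; last exact: cvg_cst.
apply: (@cvg_comp _ _ _ (fun v => l ^+ 2 / 2 * expR v) expR).
  by apply: cvgM; [exact: cvg_cst|exact: continuous_expR].
exact: continuous_expR.
Qed.

Let h_ge v : (2 * l)^-1 <= h v.
Proof.
rewrite /h ler_peMl ?invr_ge0 ?mulr_ge0 ?(ltW l0)//.
by rewrite -[leLHS]expR0 ler_expR mulr_ge0 ?expR_ge0// divr_ge0// sqr_ge0.
Qed.

Let h_gt0 v : 0 < h v.
Proof. by apply: lt_le_trans (h_ge v); rewrite invr_gt0 mulr_gt0. Qed.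

(** Separation of variables: for a primitive F of h, the quantity F (v (t))
    decreases at unit speed, so v is the inverse of F at F v0 - t.  As h is at
    least (2 l)^-1, during the time T the value of v decreases by at most
    2 l T, so that F need be inverted only on ]a, e[. *)
Lemma ode_exists_lt1 (T S0 : R) : 0 < T -> S0 < 1 ->
  exists S : R -> R, [/\ S 0 = S0 &
    forall t : R, 0 <= t <= T -> is_derive t (1 : R) S (drift l (S t))].
Proof.
move=> T0 S01.
pose v0 := ln (1 - S0); pose a := v0 - 2 * l * T - 1; pose e := v0 + 1.
have lT : 0 < 2 * l * T by rewrite !mulr_gt0.
have av0 : a < v0 by rewrite /a; lra.
have v0e : v0 < e by rewrite /e; lra.
have ae := lt_trans av0 v0e.
pose mu := @lebesgue_measure R.
pose F (v : R) := \int[mu]_(s in `[a, v]) h s.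
have ih : mu.-integrable `[a, e] (EFin \o h).
  by apply: continuous_compact_integrable;
    [exact: segment_compact|exact: continuous_subspaceT].
have dF v : a < v < e -> is_derive v (1 : R) F (h v).
  move=> /andP[av ve]; have [d1 d2] := continuous_FTC1_closed ve ih av (@h_cont v).
  apply: (DeriveDef d1).
  by rewrite -derive1E; exact: d2.
have cF : {within `[a, e], continuous F}.
  exact: (parameterized_integral_continuous (ltW ae) ih).
have Fmvt x y : a <= x -> x < y -> y <= e -> (2 * l)^-1 * (y - x) <= F y - F x.
  move=> ax xy ye.
  have [| |c _ ->] := @MVT _ F h x y xy.
  - move=> z; rewrite in_itv/= => /andP[xz zy]; apply: dF.
    by rewrite (le_lt_trans ax)//= (lt_le_trans zy).
  - apply: continuous_subspaceW cF => z /=; rewrite !in_itv/= => /andP[xz zy].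
    by rewrite (le_trans ax)//= (le_trans zy).
  - by rewrite ler_pM2r ?subr_gt0.
have Finj x y : a <= x -> x < y -> y <= e -> F x < F y.
  move=> ax xy ye; have := Fmvt x y ax xy ye.
  have : 0 < (2 * l)^-1 * (y - x) by rewrite mulr_gt0 ?invr_gt0 ?mulr_gt0 ?subr_gt0.
  lra.
pose g (y : R) := xget v0 [set v | a < v < e /\ F v = y].
have gF v : a < v < e -> g (F v) = v.
  move=> ave; rewrite /g; case: xgetP => [w _ [/andP[aw we] Fwv]|/(_ v)]; last first.
    by move=> H; exfalso; apply: H.
  case: (ltgtP w v) => // wv; move/andP : ave => [av ve].
    have := Finj _ _ (ltW aw) wv (ltW ve); rewrite Fwv ltxx//.
  have := Finj _ _ (ltW av) wv (ltW we); rewrite Fwv ltxx//.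
exists (fun t => 1 - expR (g (F v0 - t))); split.
  rewrite subr0 gF ?av0// lnK ?posrE ?subr_gt0//; lra.
move=> t /andP[t0 tT].
have [v ave Fv] : exists2 v, a < v < e & F v = F v0 - t.
  have Fa : F v0 - t > F a.
    have := Fmvt a v0 (lexx _) av0 (ltW v0e).
    have -> : (2 * l)^-1 * (v0 - a) = T + (2 * l)^-1.
      by rewrite /a; field; rewrite gt_eqF.
    have : 0 < (2 * l)^-1 by rewrite invr_gt0 mulr_gt0.
    lra.
  have Fe : F v0 - t < F e.
    by have := Finj v0 e (ltW av0) v0e (lexx _); lra.
  have [] := @IVT _ F a e (F v0 - t) (ltW ae) cF.
    by rewrite minEle maxEle (ltW (Finj a e _ ae _))// !ltW.
  move=> v; rewrite in_itv/= => /andP[av ve] Fv; exists v => //.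
  rewrite !lt_neqAle av ve !andbT; apply/andP; split; apply/eqP => E.
    by move: Fa; rewrite -Fv -E ltxx.
  by move: Fe; rewrite -Fv E ltxx.
have nearv : \forall w \near v, a < w < e.
  have /(_ v) := @near_in_itvoo R a e; rewrite in_itv/= => /(_ ave).
  by apply: filterS => w; rewrite in_itv.
have dg : is_derive (F v) (1 : R) g (h v)^-1.
  apply: is_derive_inverse; last by rewrite gt_eqF.
  - by apply: filterS nearv => w; exact: gF.
  - by apply: filterS nearv => w aw; apply: is_derive_continuous_at (dF w aw).
  - exact: dF.
rewrite Fv in dg.
have gv : g (F v0 - t) = v by rewrite -Fv gF.
have dS : is_derive t (1:R) (cst 1 - (expR \o (g \o (cst (F v0) - id)))) 
   (0 - (expR v * ((h v)^-1 * (0 - 1)))).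
  apply: is_deriveB.
  apply: is_derive1_comp.
    by rewrite /= !fctE /= gv; exact: is_derive_expR.
apply: (is_derive_eq dS); rewrite gv /drift.
have -> : l ^+ 2 * (1 - expR v - 1) / 2 = - (l ^+ 2 / 2 * expR v) by field.
rewrite min_r; last first.
  by rewrite -[leRHS]expR0 ler_expR oppr_le0 mulr_ge0 ?expR_ge0// divr_ge0// sqr_ge0.
rewrite expRN /h; field.
by rewrite !gt_eqF ?expR_gt0.
Qed.

(** Above 1 the acceptance probability is 1 and the equation is linear. *)
Lemma ode_exists_ge1 (S0 : R) : 1 <= S0 ->
  exists S : R -> R, [/\ S 0 = S0 &
    forall t : R, 0 <= t -> is_derive t (1 : R) S (drift l (S t))].
Proof.
move=> S01; exists (fun t => 1 + (S0 - 1) * expR (- (2 * l * t))); split.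
  by rewrite mulr0 oppr0 expR0 mulr1 addrC subrK.
move=> t t0.
have dexp : is_derive t (1:R) (expR \o (cst (- (2 * l)) * id))
    (expR (- (2 * l) * t) * (- (2 * l) * 1 + t * 0)).
  exact: (is_derive1_comp (is_derive_expR _)
    (is_deriveM (is_derive_cst _ _ _) (is_derive_id _ _))).
have dS := is_deriveD (is_derive_cst (1 : R) t (1:R))
  (is_deriveM (is_derive_cst (S0 - 1 : R) t (1:R)) dexp).
rewrite (_ : (fun _ => _) =
    cst 1 + cst (S0 - 1) * (expR \o (cst (- (2 * l)) * id))); last first.
  by apply/funext => s /=; rewrite !fctE /= mulNr.
apply: (is_derive_eq dS); rewrite /drift /GRing.scale/= !fctE /= mulNr.
set E := expR (- _); have E0 : 0 <= E by exact: expR_ge0.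
rewrite min_l.
  by ring.
rewrite -[leLHS]expR0 ler_expR addrAC subrr add0r divr_ge0// mulr_ge0 ?sqr_ge0// mulr_ge0//.
by rewrite subr_ge0.
Qed.

Lemma ode_exists (T S0 : R) : 0 < T ->
  exists S : R -> R, [/\ S 0 = S0 &
    forall t : R, 0 <= t <= T -> is_derive t (1 : R) S (drift l (S t))].
Proof.
move=> T0; have [S01|S01] := ltP S0 1; first exact: ode_exists_lt1.
have [S [S00 dS]] := ode_exists_ge1 S01.
by exists S; split => // t /andP[t0 _]; exact: dS.
Qed.

End ode_existence.

(** * Comparison of a perturbed Euler scheme with the equation *)

Section euler.
Context {R : realType}.
Variables (b S : R -> R) (L T : R).
Hypotheses (L0 : 0 <= L) (T0 : 0 <= T)
  (b_lip : forall x y, `|b x - b y| <= L * `|x - y|)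
  (dS : forall t : R, 0 <= t <= T -> is_derive t (1 : R) S (b (S t))).

Lemma lipschitz_continuous (f : R -> R) (c : R) : 0 <= c ->
  (forall x y, `|f x - f y| <= c * `|x - y|) -> continuous f.
Proof.
move=> c0 fc x; apply/cvgrPdist_le => e e0; near=> y.
apply: (le_trans (fc _ _)).
apply: (@le_trans _ _ ((c + 1) * `|x - y|)).
  by apply: ler_wpM2r => //; lra.
rewrite mulrC -ler_pdivlMr; last by rewrite ltr_wpDl.
near: y; apply: cvgr_dist_le; first exact: cvg_id.
by rewrite divr_gt0// ltr_wpDl.
Unshelve. all: by end_near. Qed.

Let S_within : {within `[0, T], continuous S}.
Proof.
apply/subspace_continuousP => x; rewrite /= in_itv/= => xT.
by apply: cvg_within_filter; exact: (is_derive_continuous_at (dS xT)).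
Qed.

Lemma ode_lipschitz : exists2 M : R, 0 <= M &
  forall s t, 0 <= s <= T -> 0 <= t <= T -> `|S s - S t| <= M * `|s - t|.
Proof.
pose f x := `|b (S x)|.
have cf : {within `[0, T], continuous f}.
  apply/subspace_continuousP => x xT.
  apply: cvg_within_filter; apply: cvg_norm.
  apply: (cvg_comp S b).
    by apply: (is_derive_continuous_at (dS _)); move: xT; rewrite /= in_itv.
  exact: (lipschitz_continuous L0 b_lip).
have [c _ fmax] := EVT_max T0 cf.
exists (f c); first exact: normr_ge0.
move=> s t.
wlog st : s t / s <= t.
  move=> H sT tT; have [st|/ltW ts] := leP s t; first exact: H.
  by rewrite distrC (distrC s); exact: H.
move=> /andP[s0 sT] /andP[t0 tT].
rewrite distrC (distrC s).
have [| |x xst ->] := @MVT_segment _ S (b \o S) s t st.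
- move=> x; rewrite in_itv/= => /andP[sx xt]; apply: dS.
  by rewrite (le_trans s0 (ltW sx)) (le_trans (ltW xt) tT).
- apply: continuous_subspaceW S_within => x /=; rewrite !in_itv/= => /andP[sx xt].
  by rewrite (le_trans s0 sx) (le_trans xt tT).
rewrite normrM ler_wpM2r//; apply: fmax.
move: xst; rewrite !in_itv/= => /andP[sx xt].
by rewrite (le_trans s0 sx) (le_trans xt tT).
Qed.

Lemma euler_step (M : R) (t h : R) : 0 <= M ->
  (forall s t, 0 <= s <= T -> 0 <= t <= T -> `|S s - S t| <= M * `|s - t|) ->
  0 <= t -> 0 <= h -> t + h <= T ->
  `|S (t + h) - S t - h * b (S t)| <= L * M * h ^+ 2.
Proof.
move=> M0 SM t0 h0 thT.
have tth : t <= t + h by rewrite lerDl.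
have [| |x] := @MVT_segment _ S (b \o S) t (t + h) tth.
- move=> x; rewrite in_itv/= => /andP[sx xt]; apply: dS.
  by rewrite (le_trans t0 (ltW sx)) (le_trans (ltW xt) thT).
- apply: continuous_subspaceW S_within => x /=; rewrite !in_itv/= => /andP[sx xt].
  by rewrite (le_trans t0 sx) (le_trans xt thT).
rewrite in_itv/= => /andP[tx xth] ->.
rewrite addrAC subrr add0r mulrC -mulrBr normrM (ger0_norm h0) /=.
have xt : `|x - t| <= h by rewrite ger0_norm ?subr_ge0//; lra.
rewrite expr2 mulrA [leRHS]mulrC; apply: ler_wpM2l => //.
apply: (le_trans (b_lip _ _)); rewrite -mulrA; apply: ler_wpM2l => //.
apply: (@le_trans _ _ (M * `|x - t|)); last exact: ler_wpM2l.
by apply: SM; rewrite ?t0 ?(le_trans tth)// ?(le_trans t0 tx) ?(le_trans xth).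
Qed.

End euler.

Section pathwise.
Context {R : realType}.
Variables (b S : R -> R) (L T M : R).
Hypotheses (L0 : 0 <= L) (T0 : 0 <= T) (M0 : 0 <= M)
  (b_lip : forall x y, `|b x - b y| <= L * `|x - y|)
  (dS : forall t : R, 0 <= t <= T -> is_derive t (1 : R) S (b (S t)))
  (SM : forall s t, 0 <= s <= T -> 0 <= t <= T -> `|S s - S t| <= M * `|s - t|).

(** The sum of the increments mi, frozen once it reaches eta and skipping the
    times at which s is above B.  It equals the plain sum along the paths that
    stay below both levels, and on all paths only increments at times with
    s <= B contribute. *)
Fixpoint stopped (eta B : R) (s mi : nat -> R) (k : nat) : R :=
  if k is k'.+1 then
    let m := stopped eta B s mi k' in
    m + ((`|m| < eta) && (s k' <= B))%:R * mi k'
  else 0.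

Lemma stopped_ge eta B s mi k n : (k <= n)%N ->
  eta <= `|stopped eta B s mi k| ->
  stopped eta B s mi n = stopped eta B s mi k.
Proof.
move=> kn mk; rewrite -(subnK kn); elim: (n - k)%N => // j IH.
by rewrite addSn /= IH ltNge mk /= mul0r addr0.
Qed.

Definition path_const : R := expR (L * T) * (2 + L * T + L * M * T) + 1.

Lemma path_const_ge1 : 1 <= path_const.
Proof.
by rewrite /path_const lerDr mulr_ge0 ?expR_ge0// !addr_ge0// !mulr_ge0.
Qed.

(** Discrete Gronwall estimate for s - S - m, with m the stopped sum.  A path
    with |m| < eta at time n has |m| < eta at all earlier times, since m is
    frozen when it reaches eta.  The bound reached at time k gives
    s k <= S + 1 <= B, which makes the hypothesis on the errors available at
    that time and m an unstopped sum up to time k + 1. *)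
Lemma pathwise_compare (eta B h : R) (s mi err : nat -> R) (n : nat) :
  0 < eta -> 0 <= h -> h <= eta -> n%:R * h <= T ->
  path_const * eta <= 1 ->
  (forall t, 0 <= t <= T -> S t <= B - 1) ->
  `|s 0 - S 0| <= eta ->
  (forall k, 0 <= err k) ->
  (forall k, (k < n)%N -> s k <= B ->
    `|s k.+1 - s k - mi k - h * b (s k)| <= err k) ->
  \sum_(k < n) err k <= eta ->
  `|stopped eta B s mi n| < eta ->
  forall k, (k <= n)%N -> `|s k - S (k%:R * h)| <= path_const * eta.
Proof.
move=> eta0 h0 heta nhT C1 SB s0 err0 serr sumerr mn.
set m := stopped eta B s mi.
have mk k : (k <= n)%N -> `|m k| < eta.
  move=> kn; rewrite ltNge; apply/negP => mk.
  by move: mn; rewrite (stopped_ge kn mk) ltNge mk.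
pose a j := err j + h * L * eta + L * M * h ^+ 2.
have a0 j : 0 <= a j.
  by rewrite /a !addr_ge0 ?mulr_ge0 ?sqr_ge0// ltW.
have hL0 : 0 <= h * L by rewrite mulr_ge0.
pose E k := `|s k - S (k%:R * h) - m k|.
have kT k : (k <= n)%N -> 0 <= k%:R * h <= T.
  move=> kn; rewrite mulr_ge0//=; apply: le_trans nhT.
  by rewrite ler_wpM2r// ler_nat.
have Ebound k : (k <= n)%N ->
    E k <= (1 + h * L) ^+ k * (eta + \sum_(j < k) a j) ->
    `|s k - S (k%:R * h)| <= path_const * eta.
  move=> kn Ek.
  have suma : \sum_(j < k) a j <= eta + L * T * eta + L * M * T * eta.
    apply: (@le_trans _ _ (\sum_(j < n) a j)).
      rewrite -(big_mkord xpredT a) -(big_mkord xpredT a).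
      rewrite (@big_cat_nat _ _ _ k 0 n)//= lerDl.
      by rewrite big_nat_cond; apply: sumr_ge0 => j _.
    rewrite /a !big_split /= !sumr_const card_ord -!addrA.
    apply: lerD => //.
    have hn : h * n%:R <= T by rewrite mulrC.
    have h1 : h * L * eta *+ n <= L * T * eta.
      rewrite -mulr_natr (_ : _ * _ = L * (h * n%:R) * eta); last by ring.
      by apply: ler_wpM2r; [exact: ltW|exact: ler_wpM2l].
    have h2 : L * M * h ^+ 2 *+ n <= L * M * T * eta.
      rewrite -mulr_natr (_ : _ * _ = L * M * ((h * n%:R) * h)); last by ring.
      rewrite -[leRHS]mulrA; apply: ler_wpM2l; first by rewrite mulr_ge0.
      by apply: ler_pM => //; rewrite mulr_ge0.
    by apply: lerD.
  have pw : (1 + h * L) ^+ k <= expR (L * T).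
    apply: (@le_trans _ _ (expR (h * L) ^+ k)).
      by apply: lerXn2r; rewrite ?nnegrE ?addr_ge0 ?expR_ge0// expR_ge1Dx.
    rewrite -expRM_natl ler_expR mulrA (mulrC L); apply: ler_wpM2r => //.
    by have /andP[] := kT k kn.
  have Ek' : E k <= expR (L * T) * (2 + L * T + L * M * T) * eta.
    apply: (le_trans Ek); rewrite -mulrA; apply: ler_pM => //.
    - by rewrite exprn_ge0// addr_ge0.
    - by rewrite addr_ge0 ?(ltW eta0)// sumr_ge0.
    - have := suma; lra.
  rewrite /path_const mulrDl mul1r.
  have -> : s k - S (k%:R * h) = (s k - S (k%:R * h) - m k) + m k by ring.
  by apply: (le_trans (ler_normD _ _)); apply: lerD => //; exact: ltW (mk k kn).
have main k : (k <= n)%N -> E k <= (1 + h * L) ^+ k * (eta + \sum_(j < k) a j).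
  elim: k => [_|k IH kn].
    by rewrite big_ord0 addr0 expr0 mul1r /E mul0r /m /= subr0.
  have {}IH := IH (ltnW kn).
  have D := Ebound k (ltnW kn) IH.
  have /andP[t0 tT] := kT k (ltnW kn).
  have skB : s k <= B.
    have := SB (k%:R * h); rewrite t0 tT => /(_ isT).
    have := le_trans D C1; rewrite ler_norml => /andP[_]; lra.
  have mS : m k.+1 = m k + mi k.
    by rewrite /m /= -/(m k) (mk k (ltnW kn)) skB mul1r.
  have e1 := serr k kn skB.
  have tk : k.+1%:R * h = k%:R * h + h by rewrite -natr1 mulrDl mul1r.
  have e2 := @euler_step _ b S L T L0 b_lip dS M (k%:R * h) h M0 SM t0 h0.
  have {}e2 : `|S (k%:R * h + h) - S (k%:R * h) - h * b (S (k%:R * h))| <= L * M * h ^+ 2.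
    by apply: e2; rewrite -tk; have /andP[] := kT k.+1 kn.
  have e3 : `|h * (b (s k) - b (S (k%:R * h)))| <= h * L * (E k + eta).
    rewrite normrM (ger0_norm h0) -mulrA; apply: ler_wpM2l => //.
    apply: (le_trans (b_lip _ _)); apply: ler_wpM2l => //.
    have -> : s k - S (k%:R * h) = (s k - S (k%:R * h) - m k) + m k by ring.
    apply: (le_trans (ler_normD _ _)); apply: lerD => //; exact: ltW (mk k (ltnW kn)).
  have Ek1 : E k.+1 <= (1 + h * L) * E k + a k.
    rewrite /E tk mS.
    have -> : s k.+1 - S (k%:R * h + h) - (m k + mi k) =
      (s k - S (k%:R * h) - m k) + (h * (b (s k) - b (S (k%:R * h))))
      + (s k.+1 - s k - mi k - h * b (s k))
      - (S (k%:R * h + h) - S (k%:R * h) - h * b (S (k%:R * h))) by ring.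
    apply: (le_trans (ler_norm_sub (ler_norm_add (ler_norm_add (lexx _) e3) e1) e2)).
    by rewrite /a -/(E k); lra.
  apply: (le_trans Ek1).
  rewrite big_ord_recr /=; set A := \sum_(i < k) _.
  have q1 : 1 <= 1 + h * L by rewrite lerDl.
  have := ler_wpM2l (le_trans ler01 q1) IH; rewrite -/A.
  have : 1 * a k <= (1 + h * L) ^+ k.+1 * a k.
    by apply: ler_wpM2r => //; apply: exprn_ege1.
  rewrite exprS; move: (a k) (E k) => x y; lra.
by move=> k kn; apply: Ebound => //; exact: main.
Qed.

End pathwise.

(** * From the grid to continuous time *)

Section interpolation.
Context {R : realType}.

(** An interpolated value is a convex combination of two values on the grid, at
    times within h of t; the Lipschitz constant M of S accounts for the
    distance to t. *)
Lemma interpolant_close (N : nat) (s : nat -> R) (S : R -> R) (T T1 M c : R) :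
  (0 < N)%N -> 0 <= M -> 0 <= c ->
  let h := (Num.sqrt N%:R)^-1 in
  T + h <= T1 ->
  (forall s t, 0 <= s <= T1 -> 0 <= t <= T1 -> `|S s - S t| <= M * `|s - t|) ->
  (forall k, (k <= (Num.truncn (Num.sqrt N%:R * T)).+1)%N ->
    `|s k - S (k%:R * h)| <= c) ->
  forall t, 0 <= t <= T -> `|interpolant N s t - S t| <= c + M * h.
Proof.
move=> N0 M0 c0 h hT SM sS t /andP[t0 tT].
have r0 : 0 < Num.sqrt N%:R :> R by rewrite sqrtr_gt0 ltr0n.
have h0 : 0 < h by rewrite invr_gt0.
rewrite /interpolant; set u := _ * t; set k := Num.truncn u.
have u0 : 0 <= u by rewrite mulr_ge0// ltW.
have /andP[ku uk] := truncn_itv u0; rewrite -/k in ku uk.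
have kn : (k.+1 <= (Num.truncn (Num.sqrt N%:R * T)).+1)%N.
  by rewrite ltnS; apply: le_truncn; rewrite ler_wpM2l// ltW.
have uh : t = u * h by rewrite /u /h mulrAC mulfV ?mul1r// gt_eqF.
have kt : k%:R * h <= t by rewrite uh ler_wpM2r// ltW.
have tk : t <= k.+1%:R * h by rewrite uh ler_wpM2r// ltW.
have kh0 : 0 <= k%:R * h by rewrite mulr_ge0// ltW.
have kk : k.+1%:R * h = k%:R * h + h by rewrite -natr1 mulrDl mul1r.
have tT1 : 0 <= t <= T1 by rewrite t0 (le_trans tT)// (le_trans _ hT)// lerDl ltW.
have b1 : `|s k - S t| <= c + M * h.
  rewrite -(subrKA (S (k%:R * h))); apply: (le_trans (ler_normD _ _)).
  apply: lerD; first by apply: sS; exact: ltnW.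
  apply: (le_trans (SM _ _ _ tT1)).
    by rewrite kh0 (le_trans kt)//; case/andP: tT1.
  by apply: ler_wpM2l => //; rewrite distrC ger0_norm ?subr_ge0//; lra.
have b2 : `|s k.+1 - S t| <= c + M * h.
  rewrite -(subrKA (S (k.+1%:R * h))); apply: (le_trans (ler_normD _ _)).
  apply: lerD; first exact: sS.
  apply: (le_trans (SM _ _ _ tT1)).
    by rewrite kk addr_ge0 ?(ltW h0)//=; lra.
  by apply: ler_wpM2l => //; rewrite ger0_norm ?subr_ge0//; lra.
have -> : (u - k%:R) * s k.+1 + (k.+1%:R - u) * s k - S t =
   (u - k%:R) * (s k.+1 - S t) + (k.+1%:R - u) * (s k - S t).
  by rewrite -natr1; ring.
have w1 : 0 <= u - k%:R by rewrite subr_ge0.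
have w2 : 0 <= k.+1%:R - u by rewrite subr_ge0 ltW.
apply: (le_trans (ler_norm_add (ler_normZ w1 b2) (ler_normZ w2 b1))).
have w12 : (u - k%:R) + (k.+1%:R - u) = 1 by rewrite -natr1; ring.
by rewrite -mulrDl w12 mul1r.
Qed.

Lemma interpolant_right_continuous (N : nat) (s : nat -> R) (t : R) :
  (0 < N)%N -> 0 <= t ->
  interpolant N s x @[x --> t^'+] --> interpolant N s t.
Proof.
move=> N0 t0.
have r0 : 0 < Num.sqrt N%:R :> R by rewrite sqrtr_gt0 ltr0n.
set r := Num.sqrt N%:R in r0 *.
pose k := Num.truncn (r * t).
have /andP[ku uk] : k%:R <= r * t < k.+1%:R by apply: truncn_itv; rewrite mulr_ge0// ltW.
pose f x := (r * x - k%:R) * s k.+1 + (k.+1%:R - r * x) * s k.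
have cf : continuous f.
  move=> x; apply: cvgD; (apply: cvgM; last exact: cvg_cst); apply: cvgB;
    (try exact: cvg_cst); by apply: cvgM; [exact: cvg_cst|exact: cvg_id].
rewrite (_ : interpolant N s t = f t)//.
have : f x @[x --> t^'+] --> f t by apply: cvg_at_right_filter; exact: cf.
apply: cvg_trans; apply: near_eq_cvg; near=> x.
have tx : t < x by near: x; exact: nbhs_right_gt.
have xk : x < k.+1%:R / r.
  by near: x; apply: nbhs_right_lt; rewrite ltr_pdivlMr// mulrC.
rewrite /f /interpolant -/r (_ : Num.truncn (r * x) = k)//.
apply: truncn_def; rewrite (le_trans ku)/=; last by rewrite ler_pM2l// ltW.
by rewrite mulrC -ltr_pdivlMr.
Unshelve. all: by end_near. Qed.

(** By right-continuity of the interpolant the supremum exceeds e if and only if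
    the deviation exceeds e at T or at a rational time before T. *)
Lemma measurable_unif_dist d (Omega : measurableType d) (N : nat)
    (s : nat -> Omega -> R) (S : R -> R) (T e : R) : (0 < N)%N -> 0 < T ->
  (forall k, measurable_fun setT (s k)) ->
  (forall t, 0 <= t < T -> {for t, continuous S}) ->
  measurable [set w | (e%:E < unif_dist T (interpolant N (s^~ w)) S)%E].
Proof.
move=> N0 T0 ms cS.
pose A t := [set w | e < `|interpolant N (s^~ w) t - S t|].
have mA t : measurable (A t).
  have mf : measurable_fun setT (fun w => `|interpolant N (s^~ w) t - S t|).
    apply: measurableT_comp => //; apply: measurable_funB => //.
    by rewrite /interpolant; apply: measurable_funD; apply: measurable_funM.
  have := mf measurableT `]e, +oo[%classic (measurable_itv _).
  by rewrite setTI preimage_itvoy.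
suff -> : [set w | (e%:E < unif_dist T (interpolant N (s^~ w)) S)%E] =
    A T `|` \bigcup_(q in [set: rat])
      (if (0 : R) <= ratr q < T then A (ratr q) else set0).
  apply: measurableU => //; apply: bigcupT_measurable_rat => q.
  by case: ifP.
apply/seteqP; split => [w /ereal_sup_gt[_ [t + <-]]|w].
  rewrite /= in_itv/= lte_fin => /andP[t0 tT] et.
  have [->|tT'] := eqVneq T t; first by left.
  have {}tT : t < T by rewrite lt_neqAle eq_sym tT'.
  right.
  have cvgt : (`|interpolant N (s^~ w) x - S x|) @[x --> t^'+] -->
      `|interpolant N (s^~ w) t - S t|.
    apply: cvg_norm; apply: cvgB; first exact: interpolant_right_continuous.
    by apply: cvg_at_right_filter; apply: cS; rewrite t0.
  have ne : \forall x \near t^'+, e < `|interpolant N (s^~ w) x - S x|.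
    exact: (cvgr_gt _ cvgt).
  have [d0 /= d00 Hd] := ne.
  have [q] : exists q : rat, ratr q \in `]t, (Num.min T (t + d0))[.
    by apply: rat_in_itvoo; rewrite lt_min tT ltrDl.
  rewrite in_itv/= lt_min => /andP[tq /andP[qT qd]].
  exists q => //; rewrite (le_trans t0 (ltW tq)) qT/=; apply: Hd => //.
  by rewrite /ball/= distrC gtr0_norm ?subr_gt0//; lra.
move=> [Aw|[q _]]; last case: ifP => // /andP[q0 qT] Aw.
- apply: (@lt_le_trans _ _ (`|interpolant N (s^~ w) T - S T|)%:E); first by rewrite lte_fin.
  by apply: ereal_sup_ubound; exists T => //=; rewrite in_itv/= lexx ltW.
- apply: (@lt_le_trans _ _ (`|interpolant N (s^~ w) (ratr q) - S (ratr q)|)%:E).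
    by rewrite lte_fin.
  by apply: ereal_sup_ubound; exists (ratr q) => //=; rewrite in_itv/= q0 ltW.
Qed.

End interpolation.

(** * Measurability of the chain *)

Section chain_measurability.
Context {R : realType} {N : nat}.
Variables (sw : 'I_N -> R) (V : ('I_N -> R) -> R)
  (g : ('I_N -> R) -> 'I_N -> R) (M L W : R).
Hypothesis tame : tame_potential sw V g M L W.
Context d (T : measurableType d).
Implicit Types Z Xi : 'I_N -> T -> R.

Lemma cvg_nrm0 (u : nat -> 'I_N -> R) (a : 'I_N -> R) :
  (forall i, u n i @[n --> \oo] --> a i) ->
  nrm (fun i => u n i - a i) @[n --> \oo] --> 0.
Proof.
move=> ua.
have h i : u n i - a i @[n --> \oo] --> 0.
  by rewrite -(subrr (a i)); apply: cvgB => //; exact: cvg_cst.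
have hd : dot (fun i => u n i - a i) (fun i => u n i - a i) @[n --> \oo]
    --> (0 : R).
  rewrite -[X in _ --> X](@big1 R 0 +%R _ (index_enum 'I_N) xpredT (fun=> 0 * 0)).
    apply: cvg_big => [|i _]; last exact: (cvgM (h i) (h i)).
    exact: add_continuous.
  by move=> i _; rewrite mulr0.
rewrite -(sqrtr0 R).
by apply: (cvg_comp _ _ hd); exact: sqrt_continuous.
Qed.

(** The form of continuity asked for by measurable_seq_continuous. *)
Lemma lip_seq_continuous (f : ('I_N -> R) -> R) (c : R) :
  (forall z z', `|f z - f z'| <= c * nrm (fun i => z' i - z i)) ->
  forall (u : nat -> 'I_N -> R) (a : 'I_N -> R),
  (forall i, u n i @[n --> \oo] --> a i) -> f (u n) @[n --> \oo] --> f a.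
Proof.
move=> fc u a /cvg_nrm0 ua; apply/cvgrPdist_le => e e0.
have : c * nrm (fun i => u n i - a i) @[n --> \oo] --> 0.
  by rewrite -(mulr0 c); apply: cvgM => //; exact: cvg_cst.
move=> /cvgrPdist_le /(_ _ e0); apply: filterS => n.
rewrite sub0r normrN => h; apply: (le_trans (fc _ _)).
exact: le_trans (ler_norm _) h.
Qed.

Lemma measurable_potential Z : (forall i, measurable_fun setT (Z i)) ->
  measurable_fun setT (fun t => V (fun i => Z i t)).
Proof.
apply: measurable_seq_continuous; apply: (@lip_seq_continuous _ (L * W)).
move=> z z'; apply: (le_trans (tame_lip tame _ _)); rewrite -mulrA.
apply: ler_wpM2l; first exact: (tame_L0 tame).
exact: (wnrm_le_nrm _ (tame_W0 tame) (tame_weights tame)).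
Qed.

Lemma measurable_gradient Z j : (forall i, measurable_fun setT (Z i)) ->
  measurable_fun setT (fun t => g (fun i => Z i t) j).
Proof.
apply: (@measurable_seq_continuous _ _ _ _ (fun z => g z j)).
apply: (@lip_seq_continuous _ (L * W)) => z z'; rewrite distrC.
apply: (le_trans (ler_norm_nrm (fun i => g z' i - g z i) j)).
apply: (le_trans (tame_grad_lip tame _ _)); rewrite -mulrA.
apply: ler_wpM2l; first exact: (tame_L0 tame).
exact: (wnrm_le_nrm _ (tame_W0 tame) (tame_weights tame)).
Qed.

Lemma measurable_dot (Y Z : 'I_N -> T -> R) :
  (forall i, measurable_fun setT (Y i)) -> (forall i, measurable_fun setT (Z i)) ->
  measurable_fun setT (fun t => dot (fun i => Y i t) (fun i => Z i t)).
Proof.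
by move=> mY mZ; apply: measurable_sum => i; exact: measurable_funM.
Qed.

Lemma measurable_wproposal delta Z Xi j :
  (forall i, measurable_fun setT (Z i)) -> (forall i, measurable_fun setT (Xi i)) ->
  measurable_fun setT
    (fun t => wproposal g delta (fun i => Z i t) (fun i => Xi i t) j).
Proof.
move=> mZ mXi; rewrite /wproposal; apply: measurable_funD.
  apply: measurable_funB => //; apply: measurable_funM => //.
  by apply: measurable_funD => //; exact: measurable_gradient.
exact: measurable_funM.
Qed.

Lemma measurable_waccept delta (Y Z : 'I_N -> T -> R) :
  (forall i, measurable_fun setT (Y i)) -> (forall i, measurable_fun setT (Z i)) ->
  measurable_fun setT
    (fun t => waccept V g delta (fun i => Y i t) (fun i => Z i t)).
Proof.
move=> mY mZ.
have mS (A : 'I_N -> T -> R) : (forall i, measurable_fun setT (A i)) ->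
    measurable_fun setT (fun t =>
      dot (fun i => A i t + g (fun i => A i t) i)
          (fun i => A i t + g (fun i => A i t) i)).
  by move=> mA; apply: (@measurable_dot (fun i t => A i t + g (fun i => A i t) i)
    (fun i t => A i t + g (fun i => A i t) i)) => i;
    apply: measurable_funD => //; exact: measurable_gradient.
apply: measurable_minr => //; apply: measurableT_comp => //.
rewrite /log_ratio; apply: measurable_funB.
  apply: measurable_funD.
    by apply: measurable_funB; exact: measurable_potential.
  apply: measurable_funM => //.
  apply: (@measurable_dot (fun i t => Z i t - Y i t)
    (fun i t => g (fun i => Y i t) i + g (fun i => Z i t) i)) => i.
    exact: measurable_funB.
  by apply: measurable_funD; exact: measurable_gradient.
by apply: measurable_funM => //; apply: measurable_funB; exact: mS.
Qed.

Lemma measurable_wstep delta Z Xi (u : T -> R) j :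
  (forall i, measurable_fun setT (Z i)) -> (forall i, measurable_fun setT (Xi i)) ->
  measurable_fun setT u ->
  measurable_fun setT
    (fun t => wstep V g delta (fun i => Z i t) (fun i => Xi i t) (u t) j).
Proof.
move=> mZ mXi mu; rewrite /wstep.
rewrite (_ : (fun _ => _) = fun t =>
  if u t <= waccept V g delta (fun i => Z i t)
       (wproposal g delta (fun i => Z i t) (fun i => Xi i t))
  then wproposal g delta (fun i => Z i t) (fun i => Xi i t) j else Z j t); last first.
  by apply/funext => t; case: ifP.
apply: measurable_fun_ifT => //; last exact: measurable_wproposal.
apply: measurable_fun_ler => //.
apply: (@measurable_waccept delta Z
  (fun i t => wproposal g delta (fun i => Z i t) (fun i => Xi i t) i)) => // i.
exact: measurable_wproposal.
Qed.

End chain_measurability.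

(** * Second moments along the chain *)

Section chain_moments.
Context {R : realType} {N : nat}.
Variables (sw : 'I_N -> R) (V : ('I_N -> R) -> R)
  (g : ('I_N -> R) -> 'I_N -> R) (M L W : R).
Hypothesis tame : tame_potential sw V g M L W.
Context d (Omega : measurableType d) (P : probability Omega R).
Variables (xi : nat -> 'I_N -> {RV P >-> R}) (U : nat -> {RV P >-> R}).
Hypothesis noise : mala_noise xi U.
Variables (delta : R) (z0 : 'I_N -> R).

Local Notation X := (noise_family xi U).
Local Notation index := (nat * 'I_N + nat)%type.

Definition chain_at (w : Omega) (k : nat) : 'I_N -> R :=
  wchain V g delta z0 (fun k j => xi k j w) (fun k => U k w) k.

Definition noise_at (w : Omega) (k : nat) : 'I_N -> R := fun j => xi k j w.

Definition accept_at (w : Omega) (k : nat) : R :=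
  waccept V g delta (chain_at w k)
    (wproposal g delta (chain_at w k) (noise_at w k)).

(** The noise that determines the chain at time k. *)
Definition past (k : nat) : pred index :=
  fun i => match i with inl kj => (kj.1 < k)%N | inr k' => (k' < k)%N end.

(** The noise that determines the proposal made at time k and its acceptance
    probability: U k is independent of both. *)
Definition past_proposal (k : nat) : pred index :=
  fun i => match i with inl kj => (kj.1 <= k)%N | inr k' => (k' < k)%N end.

Lemma past_past_proposal k : {subset past k <= past_proposal k}.
Proof. by case=> [[k' j]|k'] //; exact: ltnW. Qed.

Lemma past_proposal_pastS k : {subset past_proposal k <= past k.+1}.
Proof. by case=> [[k' j]|k'] //; exact: ltnW. Qed.

Lemma indep_noise : mutually_independent X.
Proof. by case: noise. Qed.

Lemma law_xi k j (B : set R) : measurable B ->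
  P (X (inl (k, j)) @^-1` B) = normal_prob 0 1 B.
Proof. by case: noise => h _ _; exact: h. Qed.

Lemma law_U k (B : set R) : measurable B ->
  P (X (inr k) @^-1` B) = uniform_prob (@ltr01 R) B.
Proof. by case: noise => _ h _; exact: h. Qed.

Lemma measurable_chain k i :
  measurable_fun setT ((fun w => chain_at w k i) : noise_algebra X (past k) -> R).
Proof.
elim: k i => [|k IH] i; first exact: measurable_cst.
apply: (@measurable_wstep _ _ _ _ _ _ _ _ tame _ (noise_algebra X (past k.+1))
  delta (fun i w => chain_at w k i) (fun i w => xi k i w) (fun w => U k w)).
- move=> j; apply: (noise_algebra_measurable_funS _ (IH j)).
  by move=> a /past_past_proposal /past_proposal_pastS.
- by move=> j; apply: (@measurable_noise _ _ _ _ _ X _ (inl (k, j))); exact: ltnSn.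
- by apply: (@measurable_noise _ _ _ _ _ X _ (inr k)); exact: ltnSn.
Qed.

Lemma measurable_accept k :
  measurable_fun setT
    ((fun w => accept_at w k) : noise_algebra X (past_proposal k) -> R).
Proof.
have mz i : measurable_fun setT
    ((fun w => chain_at w k i) : noise_algebra X (past_proposal k) -> R).
  apply: (noise_algebra_measurable_funS _ (@measurable_chain k i)).
  exact: past_past_proposal.
have mx i : measurable_fun setT
    ((fun w => noise_at w k i) : noise_algebra X (past_proposal k) -> R).
  by apply: (@measurable_noise _ _ _ _ _ X _ (inl (k, i))); exact: leqnn.
apply: (@measurable_waccept _ _ _ _ _ _ _ _ tame _
  (noise_algebra X (past_proposal k)) delta
  (fun i w => chain_at w k i)
  (fun i w => wproposal g delta (chain_at w k) (noise_at w k) i)) => // i.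
exact: (@measurable_wproposal _ _ _ _ _ _ _ _ tame _
  (noise_algebra X (past_proposal k)) delta
  (fun i w => chain_at w k i) (fun i w => noise_at w k i)).
Qed.

Lemma measurable_sqnorm k : measurable_fun setT
  ((fun w => dot (chain_at w k) (chain_at w k)) : noise_algebra X (past k) -> R).
Proof.
apply: (@measurable_dot _ _ _ (noise_algebra X (past k)) (fun i w => chain_at w k i)
  (fun i w => chain_at w k i)); exact: measurable_chain.
Qed.

Let row k : seq index := [seq inl (k, i) | i <- index_enum 'I_N].

Let row_uniq k : uniq (row k).
Proof. by rewrite map_inj_uniq ?index_enum_uniq// => i j []. Qed.

Let row_law k i : i \in row k -> forall B : set R, measurable B ->
  P (X i @^-1` B) = normal_prob 0 1 B.
Proof. by move=> /mapP[j _ ->] B mB; exact: law_xi. Qed.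

Lemma integral_noise_sqnorm k :
  (\int[P]_w ((dot (noise_at w k) (noise_at w k) - N%:R) ^+ 2)%:E
   <= (2 * N%:R)%:E)%E.
Proof.
have := @noise_sum_sqr _ _ _ P _ X indep_noise pred0 (row k) (normal_prob 0 1)
  (fun x => x ^+ 2 - 1) 2 (fun _ _ => 1) (@row_law k) _
  (fun a c => gauss_square_sqr a c) _ (row_uniq k) _ _.
move=> H; apply: le_trans; last first.
  apply: le_trans (H _ _ _ _) _ => //.
  - apply: measurable_funB => //; exact: exprn_measurable.
  - rewrite big_map.
    have e : (\int[P]_w ((1 : R) ^+ 2)%:E = 1%:E)%E.
      by rewrite expr1n integral_cst//= probability_setT mule1.
    under eq_bigr do rewrite e.
    rewrite sumEFin -EFinM lee_fin sumr_const.
    by rewrite card_ord.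
rewrite le_eqVlt; apply/orP; left; apply/eqP.
apply: eq_integral => w _; congr (_ ^+ 2)%:E.
rewrite big_map /dot -[X in _ - X%:R](card_ord N) -sum1_card natr_sum -sumrB.
by apply: eq_bigr => i _ /=; rewrite mul1r expr2.
Qed.

(** Dimension-free because the weights are square summable: the noise
    C^(1/2) xi has a bounded second moment in H^s. *)
Lemma integral_noise_wnrm k :
  (\int[P]_w (wnrm sw (noise_at w k) ^+ 2)%:E <= (W ^+ 2)%:E)%E.
Proof.
apply: (@le_trans _ _ (\sum_(i < N) \int[P]_w ((sw i * xi k i w) ^+ 2)%:E)%E).
  rewrite -ge0_integral_sum//; last 2 first.
  - move=> i; apply/measurable_EFinP; apply: measurable_funX.
    by apply: measurable_funM => //.
  - by move=> i w _; rewrite lee_fin sqr_ge0.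
  rewrite le_eqVlt; apply/orP; left; apply/eqP.
  apply: eq_integral => w _; rewrite sqr_nrm /dot -sumEFin.
  by apply: eq_bigr => i _; rewrite expr2.
apply: (@le_trans _ _ (\sum_(i < N) (sw i ^+ 2)%:E)%E).
  apply: lee_sum => i _.
  have := @noise_sum_sqr _ _ _ P _ X indep_noise pred0 [:: inl (k, i)]
    (normal_prob 0 1) id 1 (fun _ _ => sw i) _ _ _ _ _ _ _.
  rewrite !big_seq1 mul1e integral_cst//= probability_setT mule1 => H.
  apply: le_trans (H _ _ _ _ _ _ _) => //.
  - by under [leRHS]eq_integral do rewrite big_seq1.
  - by move=> j; rewrite inE => /eqP -> B; exact: law_xi.
  - by move=> a c; rewrite mul1r; exact: gauss_affine_sqr.
rewrite sumEFin lee_fin; apply: le_trans (tame_weights tame).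
by rewrite /dot; apply: ler_sum => i _; rewrite expr2.
Qed.

Variables (p b eta : R).
Hypotheses (delta0 : 0 <= delta) (p0 : 0 <= p) (Np : N%:R * p ^+ 4 = 1).

(** With p = N^(-1/4), the rescaled norm |z|^2 / N. *)
Definition level (w : Omega) (k : nat) : R :=
  p ^+ 4 * dot (chain_at w k) (chain_at w k).

Lemma measurable_level k : measurable_fun setT
  ((fun w => level w k) : noise_algebra X (past k) -> R).
Proof. by apply: measurable_funM => //; exact: measurable_sqnorm. Qed.

(** Given the past, p^2 z.xi is centred with variance p^4 |z|^2, which is the
    level; the indicator caps it at b^2. *)
Lemma integral_cross k :
  (\int[P]_w ((level w k <= b ^+ 2)%R%:R
      * (p ^+ 2 * dot (chain_at w k) (noise_at w k)) ^+ 2)%:E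
   <= (b ^+ 2)%:E)%E.
Proof.
pose ind w : R := (level w k <= b ^+ 2)%R%:R.
have ind2 w : ind w ^+ 2 = ind w.
  by rewrite /ind; case: (level w k <= _); rewrite ?expr1n ?expr0n.
have mind : measurable_fun setT (ind : noise_algebra X (past k) -> R).
  rewrite (_ : ind = fun w => if level w k <= b ^+ 2 then 1 else 0); last first.
    by apply/funext => w; rewrite /ind; case: ifP.
  apply: measurable_fun_ifT => //.
  by apply: measurable_fun_ler => //; exact: measurable_level.
pose c (i : index) w : R :=
  if i is inl kj then ind w * p ^+ 2 * chain_at w k kj.2 else 0.
have mc i : measurable_fun setT (c i : noise_algebra X (past k) -> R).
  case: i => [[k' j]|k'] /=; last exact: measurable_cst.
  by apply: measurable_funM; [exact: measurable_funM|exact: measurable_chain].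
have H := @noise_sum_sqr _ _ _ P _ X indep_noise (past k) (row k)
  (normal_prob 0 1) id 1 c (@row_law k) _ _ _ (row_uniq k) _ _.
apply: le_trans; last first.
  apply: le_trans (H _ _ _ _ _) _ => //.
  - by move=> x y; rewrite mul1r; exact: gauss_affine_sqr.
  - by move=> i /mapP[j _ ->]; rewrite -topredE /= ltnn.
  rewrite mul1e big_map -ge0_integral_sum//; last 2 first.
  - move=> i; apply/measurable_EFinP; apply: measurable_funX.
    exact: (noise_algebra_measurable_fun (mc (inl (k, i)))).
  - by move=> i w _; rewrite lee_fin sqr_ge0.
  have <- : (\int[P]_w (b ^+ 2)%:E = (b ^+ 2)%:E)%E.
    by rewrite integral_cst//= probability_setT mule1.
  apply: ge0_le_integral => //.
  - by move=> w _; apply: sume_ge0 => i _; rewrite lee_fin sqr_ge0.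
  - apply: emeasurable_sum => i; apply/measurable_EFinP; apply: measurable_funX.
    exact: (noise_algebra_measurable_fun (mc (inl (k, i)))).
  - move=> w _; rewrite sumEFin lee_fin.
    rewrite (_ : \sum_i _ = ind w * level w k); last first.
      rewrite /level /dot !mulr_sumr; apply: eq_bigr => i _ /=.
      by rewrite !exprMn ind2; ring.
    rewrite /ind; case: (boolP (level w k <= _)) => [|_]; first by rewrite mul1r.
    by rewrite mul0r sqr_ge0.
rewrite le_eqVlt; apply/orP; left; apply/eqP.
apply: eq_integral => w _; congr EFin.
rewrite big_map /= -/(ind w) -[X in X * _ = _]ind2 -exprMn; congr (_ ^+ 2).
by rewrite /dot !mulr_sumr; apply: eq_bigr => i _; rewrite /noise_at; ring.
Qed.

(** Dominates the random factor of one_step_error while the level is at most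
    b^2; squares replace absolute values so that the expectations come from
    orthogonality. *)
Definition step_cost (w : Omega) (k : nat) : R :=
  1 + (p ^+ 2 * (dot (noise_at w k) (noise_at w k) - N%:R)) ^+ 2
  + (level w k <= b ^+ 2)%R%:R
      * (p ^+ 2 * dot (chain_at w k) (noise_at w k)) ^+ 2
  + wnrm sw (noise_at w k) ^+ 2.

Lemma step_cost_ge1 w k : 1 <= step_cost w k.
Proof. by rewrite /step_cost -!addrA lerDl; nonneg. Qed.

Lemma measurable_noise_at k i : measurable_fun setT (fun w => noise_at w k i).
Proof. exact: measurable_funP. Qed.

Lemma measurable_chain_at k i : measurable_fun setT (fun w => chain_at w k i).
Proof. exact: noise_algebra_measurable_fun (@measurable_chain k i). Qed.

Lemma measurable_level_at k : measurable_fun setT (fun w => level w k).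
Proof. exact: noise_algebra_measurable_fun (@measurable_level k). Qed.

Let m_sphere k : measurable_fun setT
  (fun w => (p ^+ 2 * (dot (noise_at w k) (noise_at w k) - N%:R)) ^+ 2).
Proof.
apply: measurable_funX; apply: measurable_funM => //.
apply: measurable_funB => //.
by apply: (@measurable_dot _ _ _ _ (fun i w => noise_at w k i)
  (fun i w => noise_at w k i)) => i; exact: measurable_noise_at.
Qed.

Let m_cross k : measurable_fun setT
  (fun w => (level w k <= b ^+ 2)%R%:R
      * (p ^+ 2 * dot (chain_at w k) (noise_at w k)) ^+ 2).
Proof.
apply: measurable_funM.
  rewrite (_ : (fun _ => _) =
    fun w => if level w k <= b ^+ 2 then (1 : R) else 0); last first.
    by apply/funext => w; case: ifP.
  apply: measurable_fun_ifT => //.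
  by apply: measurable_fun_ler => //; exact: measurable_level_at.
apply: measurable_funX; apply: measurable_funM => //.
apply: (@measurable_dot _ _ _ _ (fun i w => chain_at w k i)
  (fun i w => noise_at w k i)) => i; [exact: measurable_chain_at|
  exact: measurable_noise_at].
Qed.

Let m_wnrm k : measurable_fun setT (fun w => wnrm sw (noise_at w k) ^+ 2).
Proof.
under eq_fun do rewrite sqr_nrm.
by apply: (@measurable_dot _ _ _ _ (fun i w => sw i * noise_at w k i)
  (fun i w => sw i * noise_at w k i)) => i; apply: measurable_funM => //;
  exact: measurable_noise_at.
Qed.

Lemma measurable_step_cost k : measurable_fun setT (fun w => step_cost w k).
Proof.
apply: measurable_funD => //; apply: measurable_funD => //.
exact: measurable_funD.
Qed.

(** The sphere term is p^4 Var (|xi|^2) = 2 N p^4 = 2. *)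
Lemma integral_step_cost k :
  (\int[P]_w (step_cost w k)%:E <= (3 + b ^+ 2 + W ^+ 2)%:E)%E.
Proof.
under eq_integral do rewrite /step_cost !EFinD.
rewrite ge0_integralD//; last 4 first.
- by move=> w _; rewrite -!EFinD lee_fin; nonneg.
- apply/measurable_EFinP; apply: measurable_funD => //.
  exact: measurable_funD.
- by move=> w _; rewrite lee_fin sqr_ge0.
- exact/measurable_EFinP.
rewrite ge0_integralD//; last 4 first.
- by move=> w _; rewrite -!EFinD lee_fin; nonneg.
- by apply/measurable_EFinP; apply: measurable_funD.
- by move=> w _; rewrite lee_fin; nonneg.
- exact/measurable_EFinP.
rewrite ge0_integralD//; last 2 first.
- by move=> w _; rewrite lee_fin sqr_ge0.
- exact/measurable_EFinP.
rewrite EFinD; apply: leeD; last exact: integral_noise_wnrm.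
rewrite EFinD; apply: leeD; last exact: integral_cross.
rewrite (_ : 3 = 1 + 2); last by ring.
rewrite EFinD; apply: leeD.
  by rewrite integral_cst//= probability_setT mule1.
under eq_integral do rewrite exprMn EFinM.
rewrite ge0_integralZl//; last 3 first.
- apply/measurable_EFinP; apply: measurable_funX; apply: measurable_funB => //.
  by apply: (@measurable_dot _ _ _ _ (fun i w => noise_at w k i)
    (fun i w => noise_at w k i)) => i; exact: measurable_noise_at.
- by move=> w _; rewrite lee_fin sqr_ge0.
- by rewrite lee_fin sqr_ge0.
apply: le_trans (lee_wpmul2l _ (integral_noise_sqnorm k)) _.
  by rewrite lee_fin sqr_ge0.
by rewrite -EFinM lee_fin -exprM mulrCA (mulrC _ N%:R) Np mulr1.
Qed.

(** The centred part of the change of the level: given the past and the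
    proposal, only the coin toss is random. *)
Definition mart_incr (w : Omega) (k : nat) : R :=
  2 * delta * (1 - level w k) * ((U k w <= accept_at w k)%R%:R - accept_at w k).

Definition stopped_mart (k : nat) (w : Omega) : R :=
  stopped eta (b ^+ 2) (level w) (mart_incr w) k.

Let mart_coef (k : nat) (w : Omega) : R :=
  ((`|stopped_mart k w| < eta) && (level w k <= b ^+ 2))%:R
  * (2 * delta * (1 - level w k)).

Let stopped_martS k w : stopped_mart k.+1 w = stopped_mart k w
  + mart_coef k w * ((U k w <= accept_at w k)%R%:R - accept_at w k).
Proof. by rewrite /stopped_mart /= /mart_incr /mart_coef /stopped_mart !mulrA. Qed.

Lemma measurable_stopped k : measurable_fun setT
  (stopped_mart k : noise_algebra X (past k) -> R).
Proof.
elim: k => [|k IH]; first exact: measurable_cst.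
have pS : {subset past k <= past k.+1}.
  by move=> a /past_past_proposal /past_proposal_pastS.
have IH' := noise_algebra_measurable_funS pS IH.
have ml := noise_algebra_measurable_funS pS (@measurable_level k).
have ma := noise_algebra_measurable_funS (@past_proposal_pastS k)
  (@measurable_accept k).
rewrite (_ : stopped_mart k.+1 = fun w => stopped_mart k w
  + mart_coef k w * ((U k w <= accept_at w k)%R%:R - accept_at w k)); last first.
  by apply/funext => w; exact: stopped_martS.
apply: measurable_funD => //; apply: measurable_funM.
  apply: measurable_funM.
    rewrite (_ : (fun _ => _) = fun w =>
      if `|stopped_mart k w| < eta then
        if level w k <= b ^+ 2 then (1 : R) else 0 else 0); last first.
      by apply/funext => w; case: (_ < _); case: (_ <= _).
    apply: measurable_fun_ifT => //.
      by apply: measurable_fun_ltr => //; exact: measurableT_comp.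
    by apply: measurable_fun_ifT => //; exact: measurable_fun_ler.
  by apply: measurable_funM => //; apply: measurable_funB.
apply: measurable_funB => //.
rewrite (_ : (fun _ => _) =
    fun w => if U k w <= accept_at w k then (1 : R) else 0); last first.
  by apply/funext => w; case: (_ <= _).
apply: measurable_fun_ifT => //; apply: measurable_fun_ler => //.
by apply: (@measurable_noise _ _ _ _ _ X _ (inr k)); exact: ltnSn.
Qed.

End chain_moments.

(** * Bounds on the coin tosses and on the total error *)

Section chain_bounds.
Context {R : realType} {N : nat}.
Variables (sw : 'I_N -> R) (V : ('I_N -> R) -> R)
  (g : ('I_N -> R) -> 'I_N -> R) (M L W : R).
Hypothesis tame : tame_potential sw V g M L W.
Context d (Omega : measurableType d) (P : probability Omega R).
Variables (xi : nat -> 'I_N -> {RV P >-> R}) (U : nat -> {RV P >-> R}).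
Hypothesis noise : mala_noise xi U.
Variables (p b l eta : R) (z0 : 'I_N -> R).
Hypotheses (p0 : 0 < p) (p1 : p <= 1) (Np : N%:R * p ^+ 4 = 1)
  (l0 : 0 < l) (b0 : 0 <= b).

Local Notation X := (noise_family xi U).
Let delta := l * p ^+ 2.
Let s2 := Num.sqrt (2 * l).

Local Notation chain := (chain_at V g xi U delta z0).
Local Notation xit := (noise_at xi).
Local Notation acc := (accept_at V g xi U delta z0).
Local Notation lev := (level V g xi U delta z0 p).
Local Notation cost := (step_cost sw V g xi U delta z0 p b).
Local Notation incr := (mart_incr V g xi U delta z0 p).
Local Notation mart := (stopped_mart V g xi U delta z0 p b eta).

Let delta0 : 0 <= delta. Proof. by rewrite /delta; nonneg. Qed.

Let lev_ge0 w k : 0 <= lev w k.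
Proof. by rewrite /level; nonneg. Qed.

(** Orthogonality of the increments: each one adds at most the square of its
    largest size, attained below the level b^2. *)
Lemma integral_stopped_sqr n :
  (\int[P]_w (mart n w ^+ 2)%:E
    <= (n%:R * (2 * delta * (1 + b ^+ 2)) ^+ 2)%:E)%E.
Proof.
set K := 2 * delta * (1 + b ^+ 2).
have K0 : 0 <= K by rewrite /K; nonneg.
elim: n => [|k IH].
  rewrite mul0r integral0_eq// => w _.
  by rewrite /stopped_mart /= expr0n.
pose coef w : R := ((`|mart k w| < eta) && (lev w k <= b ^+ 2))%:R
  * (2 * delta * (1 - lev w k)).
have coefK w : coef w ^+ 2 <= K ^+ 2.
  rewrite -real_normK ?num_real//; apply: lerXn2r; rewrite ?nnegrE//.
  rewrite /coef; case: (boolP (_ && _)) => [/andP[_ h]|_]; last by rewrite mul0r normr0.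
  rewrite mul1r normrM ger0_norm; last nonneg.
  apply: ler_wpM2l; first nonneg.
  have := lev_ge0 w k => h0.
  by rewrite ler_norml; apply/andP; split; lra.
have sub := @past_past_proposal N k.
have mm := noise_algebra_measurable_funS sub
  (@measurable_stopped _ _ _ _ _ _ _ _ tame _ _ P xi U delta z0 p b eta k).
have ml := noise_algebra_measurable_funS sub
  (@measurable_level _ _ _ _ _ _ _ _ tame _ _ P xi U delta z0 p k).
have ma := @measurable_accept _ _ _ _ _ _ _ _ tame _ _ P xi U delta z0 k.
have mcoef : measurable_fun setT (coef : noise_algebra X (past_proposal k) -> R).
  apply: measurable_funM.
    rewrite (_ : (fun _ => _) = fun w =>
      if `|mart k w| < eta then
        if lev w k <= b ^+ 2 then (1 : R) else 0 else 0); last first.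
      by apply/funext => w; case: (_ < _); case: (_ <= _).
    apply: measurable_fun_ifT => //.
      by apply: measurable_fun_ltr => //; exact: measurableT_comp.
    by apply: measurable_fun_ifT => //; exact: measurable_fun_ler.
  by apply: measurable_funM => //; apply: measurable_funB.
have iD : inr k \notin (past_proposal k : pred (nat * 'I_N + nat)%type).
  by rewrite -topredE /= ltnn.
have step := @noise_integral_le _ _ _ P _ X (indep_noise noise)
  (past_proposal k) (inr k) (uniform_prob (@ltr01 R))
  (fun wy => (mart k wy.1 + coef wy.1 * ((wy.2 <= acc wy.1 k)%R%:R - acc wy.1 k)) ^+ 2)
  (fun w => mart k w ^+ 2 + K ^+ 2) iD (law_U noise k).
rewrite [leLHS](_ : _ = \int[P]_w
  ((mart k w + coef w * ((U k w <= acc w k)%R%:R - acc w k)) ^+ 2)%:E)%E; last first.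
  apply: eq_integral => w _; congr (_ ^+ 2)%:E.
  by rewrite /stopped_mart /= /mart_incr /coef /stopped_mart !mulrA.
apply: le_trans (step _ _ _ _) _.
- apply: measurable_funX; apply: measurable_funD; first exact: measurableT_comp.
  apply: measurable_funM; first exact: measurableT_comp.
  have ma1 : measurable_fun setT (fun wy : noise_algebra X (past_proposal k)
      * measurableTypeR R => acc wy.1 k).
    exact: (measurableT_comp ma measurable_fst).
  apply: measurable_funB => //.
  rewrite (_ : (fun _ => _) = fun wy : noise_algebra X (past_proposal k)
      * measurableTypeR R => if wy.2 <= acc wy.1 k then (1 : R) else 0); last first.
    by apply/funext => w; case: (_ <= _).
  apply: measurable_fun_ifT => //; apply: measurable_fun_ler => //.
- by move=> x; exact: sqr_ge0.
- by apply: measurable_funD => //; exact: measurable_funX.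
- move=> w /=; apply: le_trans (uniform_centered_sqr _ _ (waccept01 _ _ _ _ _)) _.
  by rewrite lee_fin lerD2l.
under eq_integral do rewrite EFinD.
rewrite ge0_integralD//; last 3 first.
- by move=> w _; rewrite lee_fin sqr_ge0.
- apply/measurable_EFinP; apply: measurable_funX.
  exact: noise_algebra_measurable_fun mm.
- by move=> w _; rewrite lee_fin sqr_ge0.
rewrite integral_cst//= probability_setT mule1 -natr1 mulrDl mul1r EFinD.
by rewrite leeD2r.
Qed.

(** The triangle inequality, step by step.  The bound may grow like N^(1/4), but
    in one_step_error this norm carries the factor p^4, one more than the
    noise. *)
Lemma chain_wnrm_le w k : delta <= 1 ->
  wnrm sw (chain w k) <= wnrm sw z0
    + \sum_(j < k) (delta * (W * M) + s2 * p * wnrm sw (xit w j)).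
Proof.
move=> d1; elim: k => [|k IH]; first by rewrite big_ord0 addr0.
rewrite big_ord_recr /= addrA.
have W0 := tame_W0 tame; have M0 := tame_M0 tame.
have inc0 : 0 <= delta * (W * M) + s2 * p * wnrm sw (xit w k).
  by have := wnrm_ge0 sw (xit w k); have := sqrtr_ge0 (2 * l); rewrite -/s2 => *; nonneg.
rewrite /chain_at /= -/(chain w k) -/(xit w k) /wstep; case: ifP => _; last first.
  by apply: (le_trans IH); rewrite lerDl.
apply: (@le_trans _ _ (wnrm sw (chain w k)
    + (delta * (W * M) + s2 * p * wnrm sw (xit w k)))); last by rewrite lerD2r.
have -> : wproposal g delta (chain w k) (xit w k) = (fun i =>
    ((1 - delta) * chain w k i + - delta * g (chain w k) i)
    + Num.sqrt (2 * delta) * xit w k i).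
  by apply/funext => i; rewrite /wproposal; ring.
apply: (le_trans (wnrmD _ _ _)); rewrite addrA; apply: lerD.
  apply: (le_trans (wnrmD _ _ _)); rewrite !wnrmZ normrN (ger0_norm delta0).
  rewrite ger0_norm ?subr_ge0//; apply: lerD.
    by rewrite ler_piMl ?wnrm_ge0// gerBl.
  apply: ler_wpM2l => //.
  apply: (le_trans (wnrm_le_nrm _ W0 (tame_weights tame))).
  by apply: ler_wpM2l => //; exact: (tame_grad tame).
rewrite wnrmZ ger0_norm ?sqrtr_ge0// /delta mulrA sqrtrM; last nonneg.
by rewrite sqrtr_sqr gtr0_norm.
Qed.

Variables (n : nat) (T1 w0 : R).
Hypotheses (nT : n%:R * p ^+ 2 <= T1) (d1 : delta <= 1)
  (zw : wnrm sw z0 <= w0).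

Let C := step_const M L W l b.
Let A := w0 + l * (W * M) * T1.

(** The bound of one_step_error in terms of step_cost, after the norm of the
    chain has been bounded by chain_wnrm_le. *)
Definition step_err (w : Omega) (k : nat) : R :=
  C * (4 * p ^+ 3 * cost w k + p ^+ 4 * A
       + s2 * p ^+ 5 * \sum_(j < n) cost w j).

Let C0 : 0 <= C. Proof. exact: (step_const_ge0 tame l0 b0). Qed.
Let s20 : 0 <= s2. Proof. exact: sqrtr_ge0. Qed.
Let T10 : 0 <= T1. Proof. by apply: le_trans nT; nonneg. Qed.
Let w00 : 0 <= w0. Proof. exact: le_trans (wnrm_ge0 _ _) zw. Qed.
Let A0 : 0 <= A.
Proof.
by have W0 := tame_W0 tame; have M0 := tame_M0 tame; rewrite /A; nonneg.
Qed.

Let cost0 w k : 0 <= cost w k.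
Proof. exact: le_trans ler01 (step_cost_ge1 _ _ _ _ _ _ _ _ _ _ _). Qed.

Lemma step_err_ge0 w k : 0 <= step_err w k.
Proof.
have h : 0 <= \sum_(j < n) cost w j by apply: sumr_ge0.
by rewrite /step_err; nonneg.
Qed.

Lemma step_err_bound w k : (k < n)%N -> lev w k <= b ^+ 2 ->
  `|lev w k.+1 - lev w k - incr w k - p ^+ 2 * drift l (lev w k)|
    <= step_err w k.
Proof.
move=> kn lb.
have p0' := ltW p0.
have := one_step_error tame p0 p1 Np l0 b0 (xit w k) lb (U k w).
rewrite -/delta -/(acc w k) -/(lev w k) -/C.
rewrite -[dot (wstep _ _ _ _ _ _) _]/(dot (chain w k.+1) (chain w k.+1)).
rewrite -/(lev w k.+1) -/(incr w k) => /le_trans; apply.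
rewrite /step_err; apply: ler_wpM2l => //.
have x1 (x : R) : x <= 1 + x ^+ 2.
  by have := sqr_ge0 (x - 1); have := sqr_ge0 x; rewrite !expr2; lra.
have c1 : 1 + p ^+ 2 * `|dot (xit w k) (xit w k) - N%:R|
    + p ^+ 2 * `|dot (chain w k) (xit w k)| + wnrm sw (xit w k) <= 4 * cost w k.
  have a1 := x1 (p ^+ 2 * `|dot (xit w k) (xit w k) - N%:R|).
  have a2 := x1 (p ^+ 2 * `|dot (chain w k) (xit w k)|).
  have a3 := x1 (wnrm sw (xit w k)).
  rewrite exprMn real_normK ?num_real// -exprMn in a1.
  rewrite exprMn real_normK ?num_real// -exprMn in a2.
  rewrite /step_cost lb mul1r.
  have := sqr_ge0 (p ^+ 2 * (dot (xit w k) (xit w k) - N%:R)).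
  have := sqr_ge0 (p ^+ 2 * dot (chain w k) (xit w k)).
  have := sqr_ge0 (wnrm sw (xit w k)).
  lra.
have c2 : wnrm sw (chain w k) <= A + s2 * p * \sum_(j < n) cost w j.
  apply: (le_trans (chain_wnrm_le w k d1)); rewrite big_split /= /A -addrA.
  apply: lerD => //; apply: lerD.
    rewrite sumr_const card_ord -mulr_natr /delta.
    rewrite (_ : _ * _ = l * (W * M) * (k%:R * p ^+ 2)); last by ring.
    apply: ler_wpM2l.
      by have W0 := tame_W0 tame; have M0 := tame_M0 tame; nonneg.
    by apply: le_trans nT; rewrite ler_wpM2r ?sqr_ge0// ler_nat ltnW.
  rewrite -mulr_sumr; apply: ler_wpM2l; first nonneg.
  apply: (@le_trans _ _ (\sum_(j < k) cost w j)).
    apply: ler_sum => j _; have := x1 (wnrm sw (xit w j)).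
    rewrite /step_cost.
    have := sqr_ge0 (p ^+ 2 * (dot (xit w j) (xit w j) - N%:R)).
    have : 0 <= (lev w j <= b ^+ 2)%R%:R * (p ^+ 2 * dot (chain w j) (xit w j)) ^+ 2.
      by nonneg.
    lra.
  rewrite -(big_mkord xpredT (cost w)) -(big_mkord xpredT (cost w)).
  rewrite (@big_cat_nat _ _ _ k 0 n)//=; last exact: ltnW.
  by rewrite lerDl big_nat_cond; apply: sumr_ge0.
have p3 : 0 <= p ^+ 3 by nonneg.
have p4 : 0 <= p ^+ 4 by nonneg.
have := lerD (ler_wpM2l p3 c1) (ler_wpM2l p4 c2).
move: (wnrm sw (chain w k)) (wnrm sw (xit w k)) (\sum_(j < n) cost w j) (cost w k)
  => x y S c h.
apply: (le_trans h); rewrite le_eqVlt; apply/orP; left; apply/eqP; ring.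
Qed.

Lemma step_err_sum w : \sum_(k < n) step_err w k <=
  C * ((4 + s2 * T1) * p ^+ 3 * \sum_(k < n) cost w k + p ^+ 2 * (T1 * A)).
Proof.
have p0' := ltW p0.
rewrite -mulr_sumr; apply: ler_wpM2l => //.
set S := \sum_(k < n) cost w k.
rewrite (_ : \sum_(k < n) _ = 4 * p ^+ 3 * S + p ^+ 4 * A *+ n
  + s2 * p ^+ 5 * S *+ n); last first.
  by rewrite 2!big_split /= -mulr_sumr !sumr_const card_ord.
have S0 : 0 <= S by apply: sumr_ge0.
have h1 : p ^+ 4 * A *+ n <= p ^+ 2 * (T1 * A).
  rewrite -mulr_natr (_ : _ * _ = p ^+ 2 * (n%:R * p ^+ 2 * A)); last by ring.
  by apply: ler_wpM2l; [exact: sqr_ge0|exact: ler_wpM2r].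
have h2 : s2 * p ^+ 5 * S *+ n <= s2 * T1 * p ^+ 3 * S.
  rewrite -mulr_natr (_ : _ * _ = s2 * (n%:R * p ^+ 2) * p ^+ 3 * S); last by ring.
  apply: ler_wpM2r => //; apply: ler_wpM2r; first nonneg.
  exact: ler_wpM2l.
move: h1 h2; move: (p ^+ 4 * A *+ n) (s2 * p ^+ 5 * S *+ n) => x y h1 h2; lra.
Qed.

End chain_bounds.

(** * Probability of a deviation for fixed N *)

Lemma markov_le d (Omega : measurableType d) (R : realType)
    (P : probability Omega R) (f : Omega -> R) (a c : R) :
  measurable_fun setT f -> (forall w, 0 <= f w) -> 0 < a ->
  (\int[P]_w (f w)%:E <= c%:E)%E -> (P [set w | (a <= f w)%R] <= (c / a)%:E)%E.
Proof.
move=> mf f0 a0 fc.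
have mf' : measurable_fun setT (EFin \o f) by exact/measurable_EFinP.
have := le_integral_abse P measurableT mf' a0.
rewrite setTI => h.
have e1 : [set x | (a%:E <= `|(EFin \o f) x|)%E] = [set w | (a <= f w)%R].
  by apply/seteqP; split => w /=; rewrite ger0_norm// lee_fin.
rewrite e1 in h.
have e2 : (\int[P]_x `|(EFin \o f) x| = \int[P]_w (f w)%:E)%E.
  by apply: eq_integral => w _; rewrite /= ger0_norm.
rewrite e2 in h.
have {}h := le_trans h fc.
by rewrite EFinM lee_pdivlMr // muleC.
Qed.

Section limit_theorem.
Context {R : realType} {N : nat}.
Variables (sw : 'I_N -> R) (V : ('I_N -> R) -> R)
  (g : ('I_N -> R) -> 'I_N -> R) (M L W : R).
Hypothesis tame : tame_potential sw V g M L W.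
Context d (Omega : measurableType d) (P : probability Omega R).
Variables (xi : nat -> 'I_N -> {RV P >-> R}) (U : nat -> {RV P >-> R}).
Hypothesis noise : mala_noise xi U.
Variables (p b l eta T M' w0 e : R) (z0 : 'I_N -> R) (S : R -> R).
Let T1 := T + 1.
Let C := step_const M L W l b.
Let A := w0 + l * (W * M) * T1.
Let K := path_const (2 * l) T1 M'.

(** The two terms are the Markov bounds for the total error and for the stopped
    sum of coin tosses; both vanish with p. *)
Definition failure_bound : R :=
  C * (4 + Num.sqrt (2 * l) * T1) * T1 * (3 + b ^+ 2 + W ^+ 2) / (eta / 2) * p
  + T1 * (2 * l * (1 + b ^+ 2)) ^+ 2 / eta ^+ 2 * p ^+ 2.

Hypotheses (N0 : (0 < N)%N) (pE : p = (Num.sqrt (Num.sqrt N%:R))^-1)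
  (l0 : 0 < l) (b0 : 0 <= b) (T0 : 0 < T) (eta0 : 0 < eta) (M'0 : 0 <= M').
Hypotheses (p1 : p <= 1) (peta : p ^+ 2 <= eta) (lp : l * p ^+ 2 <= 1)
  (zw : wnrm sw z0 <= w0)
  (S0 : `|p ^+ 4 * dot z0 z0 - S 0| <= eta)
  (dS : forall t : R, 0 <= t <= T1 -> is_derive t (1 : R) S (drift l (S t)))
  (SM : forall s t : R, 0 <= s <= T1 -> 0 <= t <= T1 ->
     `|S s - S t| <= M' * `|s - t|)
  (Sb : forall t : R, 0 <= t <= T1 -> S t <= b ^+ 2 - 1)
  (Keta : K * eta <= 1) (Ke : K * eta + M' * p ^+ 2 <= e)
  (CpA : C * (p ^+ 2 * (T1 * A)) <= eta / 2).

Local Notation lev := (level V g xi U (l * p ^+ 2) z0 p).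
Local Notation cost := (step_cost sw V g xi U (l * p ^+ 2) z0 p b).
Local Notation mart := (stopped_mart V g xi U (l * p ^+ 2) z0 p b eta).
Let n := (Num.truncn (Num.sqrt N%:R * T)).+1.

Let r0 : 0 < Num.sqrt N%:R :> R. Proof. by rewrite sqrtr_gt0 ltr0n. Qed.
Let p0 : 0 < p. Proof. by rewrite pE invr_gt0 sqrtr_gt0. Qed.
Let p2 : p ^+ 2 = (Num.sqrt N%:R)^-1.
Proof. by rewrite pE exprVn sqr_sqrtr// ltW. Qed.
Let Np : N%:R * p ^+ 4 = 1.
Proof.
rewrite -[4%N]/(2 * 2)%N exprM p2 exprVn sqr_sqrtr ?ler0n// mulfV//.
by rewrite pnatr_eq0 -lt0n.
Qed.
Let T10 : 0 <= T1. Proof. by rewrite addr_ge0// ltW. Qed.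
(* The grid must extend one step beyond T, whence the horizon T1 = T + 1. *)
Let nT : n%:R * p ^+ 2 <= T1.
Proof.
have /andP[h _] : (Num.truncn (Num.sqrt N%:R * T))%:R <= Num.sqrt N%:R * T
    < (Num.truncn (Num.sqrt N%:R * T)).+1%:R.
  by apply: truncn_itv; rewrite mulr_ge0 ?(ltW r0)// ltW.
rewrite /n -natr1 mulrDl mul1r /T1; apply: lerD.
  by rewrite p2 ler_pdivrMr// [leRHS]mulrC.
by apply: exprn_ile1 => //; exact: ltW.
Qed.
Let C0 : 0 <= C. Proof. exact: (step_const_ge0 tame l0 b0). Qed.

Let Y w := C * (4 + Num.sqrt (2 * l) * T1) * p ^+ 3 * \sum_(k < n) cost w k.

Let c0 : 0 <= C * (4 + Num.sqrt (2 * l) * T1) * p ^+ 3.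
Proof. by have := sqrtr_ge0 (2 * l); have := ltW p0 => *; nonneg. Qed.

Let cost0 w k : 0 <= cost w k.
Proof. exact: le_trans ler01 (step_cost_ge1 _ _ _ _ _ _ _ _ _ _ _). Qed.

Let mcost k : measurable_fun setT (fun w => cost w k).
Proof. exact: (measurable_step_cost tame). Qed.

Let mY : measurable_fun setT Y.
Proof.
by apply: measurable_funM => //; apply: measurable_sum => k; exact: mcost.
Qed.

Let Y0 w : 0 <= Y w.
Proof. by rewrite /Y mulr_ge0// sumr_ge0. Qed.

Lemma integral_total_cost : (\int[P]_w (Y w)%:E <=
  (C * (4 + Num.sqrt (2 * l) * T1) * T1 * (3 + b ^+ 2 + W ^+ 2) * p)%:E)%E.
Proof.
under eq_integral do rewrite EFinM -sumEFin.
rewrite ge0_integralZl//; last 2 first.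
- by apply: emeasurable_sum => k; apply/measurable_EFinP; exact: mcost.
- by move=> w _; apply: sume_ge0 => k _; rewrite lee_fin.
rewrite ge0_integral_sum//; last 2 first.
- by move=> k; apply/measurable_EFinP; exact: mcost.
- by move=> k w _; rewrite lee_fin.
apply: (@le_trans _ _ ((C * (4 + Num.sqrt (2 * l) * T1) * p ^+ 3)%:E *
    \sum_(k < n) (3 + b ^+ 2 + W ^+ 2)%:E)%E).
  apply: lee_wpmul2l; first by rewrite lee_fin.
  by apply: lee_sum => k _; exact: (integral_step_cost tame noise).
rewrite sumEFin -EFinM lee_fin sumr_const card_ord -mulr_natr.
set x := 3 + b ^+ 2 + W ^+ 2; set c := C * _.
have x0 : 0 <= x by rewrite /x; nonneg.
have cc0 : 0 <= c by rewrite /c; have := sqrtr_ge0 (2 * l) => *; nonneg.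
rewrite [leLHS](_ : _ = c * (n%:R * p ^+ 2) * x * p); last by ring.
by rewrite !ler_wpM2r ?(ltW p0)//; apply: ler_wpM2l.
Qed.

(** The two conditions on w are those of pathwise_compare for this path. *)
Lemma good_path w : Y w < eta / 2 -> `|mart n w| < eta ->
  forall t, 0 <= t <= T ->
  `|interpolant N (lev w) t - S t| <= K * eta + M' * p ^+ 2.
Proof.
move=> Yw mw t tT.
have Keta0 : 0 <= K * eta.
  apply: mulr_ge0; last exact: ltW.
  apply: le_trans ler01 (path_const_ge1 _ _ _) => //; nonneg.
rewrite p2; apply: (interpolant_close (T := T) (T1 := T1)) => //.
  by rewrite -p2 /T1 lerD2l; apply: exprn_ile1 => //; exact: ltW.
move=> k kn; rewrite -p2.
have l20 : 0 <= 2 * l by nonneg.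
apply: (@pathwise_compare _ (drift l) S (2 * l) T1 M' l20 M'0 (drift_lip l0)
  dS SM eta (b ^+ 2) (p ^+ 2) (lev w)
  (mart_incr V g xi U (l * p ^+ 2) z0 p w)
  (step_err sw V g M L W xi U p b l z0 n T1 w0 w) n) => //.
- exact: sqr_ge0.
- exact: (step_err_ge0 tame).
- by move=> j jn jb; exact: (step_err_bound tame).
- apply: (le_trans (step_err_sum tame xi U p0 l0 b0 nT zw w)).
  rewrite mulrDr -/C -/A; rewrite [leRHS](splitr eta); apply: lerD => //.
  by apply: le_trans (ltW Yw); rewrite /Y !mulrA.
Qed.

Lemma failure_probability :
  (P [set w | (e%:E < unif_dist T (interpolant N (lev w)) S)%E]
    <= failure_bound%:E)%E.
Proof.
have mm : measurable_fun setT (mart n).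
  exact: (noise_algebra_measurable_fun (@measurable_stopped _ _ _ _ _ _ _ _
    tame _ _ P xi U (l * p ^+ 2) z0 p b eta n)).
have m1 : measurable [set w | eta / 2 <= Y w].
  rewrite -[X in measurable X]setTI.
  by have := mY measurableT (measurable_itv `[eta / 2, +oo[); rewrite preimage_itvcy.
have m2 : measurable [set w | eta ^+ 2 <= mart n w ^+ 2].
  rewrite -[X in measurable X]setTI.
  have mm2 : measurable_fun setT (fun w => mart n w ^+ 2) by exact: measurable_funX.
  by have := mm2 measurableT _ (measurable_itv `[eta ^+ 2, +oo[); rewrite preimage_itvcy.
apply: (@le_trans _ _ (P ([set w | eta / 2 <= Y w]
    `|` [set w | eta ^+ 2 <= mart n w ^+ 2]))).
  apply: le_measure; rewrite ?inE.
  - apply: (@measurable_unif_dist _ _ _ _ (fun k w => lev w k)) => //.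
      by move=> k; exact: (measurable_level_at tame).
    move=> t /andP[t0 tT]; apply: is_derive_continuous_at (dS _).
    by rewrite t0 /T1; lra.
  - exact: measurableU.
  move=> w /= ew; apply/orP; move: ew; apply: contraTT.
  rewrite negb_or -!ltNge => /andP[Yw mw].
  have {}mw : `|mart n w| < eta.
    by rewrite -(@ltr_pXn2r _ 2)// ?nnegrE ?(ltW eta0)// real_normK ?num_real.
  rewrite -leNgt; apply: ge_ereal_sup => _ [t /= + <-].
  rewrite in_itv/= => tT; rewrite lee_fin.
  exact: le_trans (good_path Yw mw tT) Ke.
apply: (le_trans (measureU2 _ m1 m2)).
rewrite /failure_bound EFinD; apply: leeD.
  apply: le_trans (markov_le mY Y0 _ integral_total_cost) _.
    by rewrite divr_gt0.
  by rewrite lee_fin [leRHS]mulrAC.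
apply: le_trans (markov_le _ _ _ (integral_stopped_sqr tame noise b eta z0 p0 l0 n)) _.
- exact: measurable_funX.
- by move=> w; exact: sqr_ge0.
- by rewrite exprn_gt0.
rewrite lee_fin [leRHS]mulrAC; apply: ler_wpM2r; first by rewrite invr_ge0 sqr_ge0.
rewrite [leLHS](_ : _ =
    (n%:R * p ^+ 2) * ((2 * l * (1 + b ^+ 2)) ^+ 2 * p ^+ 2)); last by ring.
rewrite -[leRHS]mulrA; apply: ler_wpM2r => //.
by apply: mulr_ge0; exact: sqr_ge0.
Qed.

End limit_theorem.

(** * The limit theorem in whitened coordinates *)

Section white_limit.
Context {R : realType}.

Definition quartic_root (N : nat) : R := (Num.sqrt (Num.sqrt N%:R))^-1.

Lemma quartic_root_cvg : quartic_root N @[N --> \oo] --> 0.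
Proof.
apply/cvgrPdist_le => e e0; near=> N.
rewrite sub0r normrN /quartic_root ger0_norm ?invr_ge0 ?sqrtr_ge0//.
have N1 : e ^- 4 <= N%:R by near: N; exact: nbhs_infty_ger.
have e40 : 0 < e ^- 4 by rewrite invr_gt0 exprn_gt0.
have s0 : 0 < Num.sqrt (Num.sqrt N%:R) :> R.
  by rewrite !sqrtr_gt0; exact: lt_le_trans N1.
rewrite -[leRHS]invrK lef_pV2 ?posrE ?invr_gt0//.
rewrite -(@ler_pXn2r _ 4)// ?nnegrE ?invr_ge0 ?(ltW e0) ?(ltW s0)//.
rewrite exprVn (_ : Num.sqrt (Num.sqrt N%:R) ^+ 4 = N%:R)//.
by rewrite -[4%N]/(2 * 2)%N exprM !sqr_sqrtr ?sqrtr_ge0.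
Unshelve. all: by end_near. Qed.

Lemma quartic_rootE N : (0 < N)%N -> quartic_root N ^+ 4 = N%:R^-1.
Proof.
move=> N0; rewrite /quartic_root exprVn; congr (_^-1).
by rewrite -[4%N]/(2 * 2)%N exprM !sqr_sqrtr ?sqrtr_ge0.
Qed.

Lemma quartic_root_sqr N : quartic_root N ^+ 2 = (Num.sqrt N%:R)^-1.
Proof. by rewrite /quartic_root exprVn sqr_sqrtr ?sqrtr_ge0. Qed.

Context d (Omega : measurableType d) (P : probability Omega R).
Variables (sw : forall N, 'I_N -> R) (V : forall N, ('I_N -> R) -> R)
  (g : forall N, ('I_N -> R) -> 'I_N -> R) (z0 : forall N, 'I_N -> R)
  (M L W l T w0 S0 : R)
  (xi : forall N : nat, nat -> 'I_N -> {RV P >-> R})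
  (U : nat -> nat -> {RV P >-> R}) (S : R -> R).

(** The level b^2 comes from a bound on the solution S, the tolerance eta from
    e and from the constant of pathwise_compare; none depends on N, so that
    failure_probability applies for all large N with a bound that tends
    to 0. *)
Lemma white_limit :
  (forall N, tame_potential (@sw N) (@V N) (@g N) M L W) ->
  (forall N, mala_noise (@xi N) (U N)) ->
  0 < l -> 0 < T ->
  (forall N, wnrm (@sw N) (@z0 N) <= w0) ->
  N%:R^-1 * dot (@z0 N) (@z0 N) @[N --> \oo] --> S0 ->
  S 0 = S0 ->
  (forall t : R, 0 <= t <= T + 1 -> is_derive t (1 : R) S (drift l (S t))) ->
  cvg_in_probability_unif P T
    (fun N w => interpolant N (fun k =>
       let z := chain_at (@V N) (@g N) (@xi N) (U N) (l / Num.sqrt N%:R) (@z0 N) w k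
       in N%:R^-1 * dot z z)) S.
Proof.
move=> tame noise l0 T0 zw zS0 SS0 dS e e0.
have T10 : 0 <= T + 1 by rewrite addr_ge0// ltW.
have l20 : 0 <= 2 * l by rewrite mulr_ge0// ltW.
have [M' M'0 SM] := ode_lipschitz l20 T10 (drift_lip l0) dS.
pose b : R := Num.sqrt (`|S 0| + M' * (T + 1) + 1).
have bb0 : 0 <= `|S 0| + M' * (T + 1) + 1 by rewrite !addr_ge0// mulr_ge0.
have Sb (t : R) : 0 <= t <= T + 1 -> S t <= b ^+ 2 - 1.
  move=> tT; rewrite sqr_sqrtr// addrK.
  have h : `|S t - S 0| <= M' * (T + 1).
    apply: (le_trans (SM _ _ tT _)); first by rewrite lexx.
    case/andP: tT => t0 tT.
    by apply: ler_wpM2l => //; rewrite subr0 ger0_norm.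
  have := ler_norm (S 0); move: h; rewrite ler_norml => /andP[_]; lra.
set K := path_const (2 * l) (T + 1) M'.
have K1 : 1 <= K by apply: path_const_ge1.
have K0 : 0 < K := lt_le_trans ltr01 K1.
pose eta := Num.min K^-1 (e / 2 / K).
have eta0 : 0 < eta by rewrite lt_min invr_gt0 K0 !divr_gt0.
have Keta : K * eta <= 1.
  by rewrite mulrC -ler_pdivlMr// div1r ge_min lexx.
have Ke : K * eta <= e / 2.
  by rewrite mulrC -ler_pdivlMr// ge_min lexx orbT.
pose bound N := failure_bound M L W (quartic_root N) b l eta T.
have cvgp2 : quartic_root N ^+ 2 @[N --> \oo] --> 0.
  rewrite -(mulr0 (0 : R)); exact: (cvgM quartic_root_cvg quartic_root_cvg).
have small (c r : R) : 0 < r ->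
    \forall N \near \oo, c * quartic_root N ^+ 2 <= r.
  move=> r0.
  have : c * quartic_root N ^+ 2 @[N --> \oo] --> 0.
    by rewrite -(mulr0 c); apply: cvgM => //; exact: cvg_cst.
  move=> /cvgrPdist_le /(_ _ r0); apply: filterS => N.
  by rewrite sub0r normrN; apply: le_trans; exact: ler_norm.
apply: (@squeeze_cvge _ _ _ _ (cst 0%E) _ (fun N => (bound N)%:E)).
- near=> N.
  have N0 : (0 < N)%N by near: N; exists 1%N.
  rewrite measure_ge0 /=.
  have pE := quartic_rootE N0; have p2E := quartic_root_sqr N.
  rewrite [X in (P X <= _)%E](_ : _ = [set w | (e%:E < unif_dist T (interpolant N
      (level (@V N) (@g N) (@xi N) (U N) (l * quartic_root N ^+ 2) (@z0 N)
        (quartic_root N) w)) S)%E]); last by rewrite /level pE p2E.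
  apply: (failure_probability (M' := M') (w0 := w0) (tame N) (noise N)) => //.
  + exact: sqrtr_ge0.
  + near: N.
    have := quartic_root_cvg => /cvgrPdist_le /(_ _ ltr01); apply: filterS => N.
    by rewrite sub0r normrN; apply: le_trans; exact: ler_norm.
  + by rewrite -[leLHS]mul1r; near: N; exact: small.
  + by near: N; exact: small.
  + rewrite pE SS0 distrC; near: N.
    by move: zS0 => /cvgrPdist_le /(_ _ eta0).
  + rewrite [leRHS](splitr e); apply: lerD => //; near: N; apply: small.
    by rewrite divr_gt0.
  + set c := (T + 1) * _; rewrite (mulrC (quartic_root N ^+ 2)) mulrA.
    by near: N; apply: small; rewrite divr_gt0.
- exact: cvg_cst.
- apply/fine_cvgP; split; first by near=> N.
  rewrite (_ : fine \o _ = bound)// /bound /failure_bound.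
  have lin (c : R) (f : nat -> R) : f N @[N --> \oo] --> 0 ->
      c * f N @[N --> \oo] --> 0.
    by move=> f0; rewrite -(mulr0 c); apply: cvgM => //; exact: cvg_cst.
  rewrite -[X in _ --> X](addr0 (0 : R)); apply: cvgD.
    by apply: lin; exact: quartic_root_cvg.
  exact: (lin _ (fun N => quartic_root N ^+ 2)).
Unshelve. all: by end_near. Qed.

End white_limit.

(** * Weighted sequence spaces *)

Section weighted_sequences.
Context {R : realType}.
Implicit Types (a g h : nat -> R) (r s : R).

Lemma powR_sqr (x r : R) : (x `^ r) ^+ 2 = x `^ (2 * r).
Proof. by rewrite mulrC powRrM powR_mulrn ?powR_ge0. Qed.

(** The discrete form of b x^(-1-b) = - (x^-b)', from which the series
    telescopes. *)
Lemma zeta_term_le (b : R) (j : nat) : 0 < b ->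
  b * (j.+2%:R : R) `^ (- (1 + b)) <= (j.+1%:R) `^ (- b) - (j.+2%:R) `^ (- b).
Proof.
move=> b0.
have j1 : 0 < j.+1%:R :> R by [].
have j2 : 0 < j.+2%:R :> R by [].
pose u : R := j.+2%:R / j.+1%:R.
have u0 : 0 < u by rewrite divr_gt0.
have e1 : (j.+1%:R : R) `^ (- b) = j.+2%:R `^ (- b) * u `^ b.
  rewrite !powRN (_ : j.+2%:R = j.+1%:R * u); last by rewrite mulrC divfK ?gt_eqF.
  by rewrite powRM ?(ltW u0)// invfM divfK// gt_eqF// powR_gt0.
have e2 : (j.+2%:R : R) `^ (- (1 + b)) = j.+2%:R `^ (- b) / j.+2%:R.
  rewrite (_ : - (1 + b) = - b + - 1); last by ring.
  by rewrite powRD ?powR_inv1 ?(ltW j2)// (gt_eqF j2) implybT.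
rewrite e1 e2 [leRHS](_ : _ = j.+2%:R `^ (- b) * (u `^ b - 1)); last by ring.
rewrite mulrCA.
apply: ler_wpM2l; first exact: powR_ge0.
have ub : 1 + b * ln u <= u `^ b by rewrite /powR gt_eqF// expR_ge1Dx.
have lnu : j.+2%:R^-1 <= ln u.
  have -> : ln u = - ln (u^-1) by rewrite lnV ?opprK.
  have uv : u^-1 = 1 + - j.+2%:R^-1.
    rewrite /u invf_div -[in LHS](_ : (j.+2%:R - 1 : R) = j.+1%:R); last first.
      by rewrite -natr1 addrK.
    by rewrite mulrBl mulfV ?gt_eqF// div1r.
  rewrite lerNr -ler_expR lnK ?posrE ?invr_gt0//.
  by rewrite uv; exact: expR_ge1Dx.
by rewrite lerBrDl (le_trans _ ub)// lerD2l ler_wpM2l// ltW.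
Qed.

Lemma zeta_bounded (c : R) : 1 < c ->
  exists2 Z : R, 0 <= Z & forall N, \sum_(j < N) (j.+1%:R : R) `^ (- c) <= Z.
Proof.
move=> c1; pose b := c - 1; have b0 : 0 < b by rewrite subr_gt0.
have cb : c = 1 + b by rewrite /b; ring.
exists (1 + b^-1); first by rewrite addr_ge0// invr_ge0 ltW.
case=> [|N]; first by rewrite big_ord0 addr_ge0// invr_ge0 ltW.
rewrite big_ord_recl /= powR1; apply: lerD => //.
rewrite -[leRHS]mulr1 -ler_pdivrMl ?invr_gt0// invrK mulr_sumr.
apply: (@le_trans _ _ (1 - (N.+1%:R : R) `^ (- b))); last first.
  by rewrite gerBl powR_ge0.
elim: N => [|N IH]; first by rewrite big_ord0 powR1 subrr.
rewrite big_ord_recr /=.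
have := zeta_term_le N b0; rewrite -cb; move: IH.
by rewrite /bump /= add1n; lra.
Qed.

Lemma Hr_term_ge0 r a j : 0 <= (j.+1%:R : R) `^ (2 * r) * a j ^+ 2.
Proof. by rewrite mulr_ge0 ?powR_ge0 ?sqr_ge0. Qed.

Lemma Hr_sqnorm_ge0 r a : (0 <= Hr_sqnorm r a)%E.
Proof. by apply: nneseries_ge0 => j _ _; rewrite lee_fin Hr_term_ge0. Qed.

Lemma Hr_normE r a : in_Hr r a -> (Hr_norm r a ^+ 2)%:E = Hr_sqnorm r a.
Proof.
move=> ra; have h := Hr_sqnorm_ge0 r a.
by rewrite sqr_sqrtr ?fine_ge0// fineK// ge0_fin_numE.
Qed.

Lemma Hr_norm_partial r a N : in_Hr r a ->
  \sum_(j < N) (j.+1%:R : R) `^ (2 * r) * a j ^+ 2 <= Hr_norm r a ^+ 2.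
Proof.
move=> ra; rewrite -lee_fin Hr_normE// -sumEFin.
rewrite -(big_mkord xpredT (fun j => (j.+1%:R `^ (2 * r) * a j ^+ 2)%:E)).
by apply: nneseries_lim_ge => j _; rewrite lee_fin Hr_term_ge0.
Qed.

Lemma Hr_sqnorm_finite r a N : (forall j, (N <= j)%N -> a j = 0) ->
  Hr_sqnorm r a = (\sum_(j < N) (j.+1%:R : R) `^ (2 * r) * a j ^+ 2)%:E.
Proof.
move=> aN; rewrite /Hr_sqnorm (nneseries_split _ N); last first.
  by move=> j _; rewrite lee_fin Hr_term_ge0.
rewrite add0n big_mkord -sumEFin [X in (_ + X)%E]eseries0 ?adde0//.
by move=> j Nj _; rewrite aN// expr0n mulr0.
Qed.

Lemma in_HrB r a h : in_Hr r a -> in_Hr r h -> in_Hr r (fun j => a j - h j).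
Proof.
rewrite /in_Hr => ra rh.
have le : (Hr_sqnorm r (fun j => (a j - h j)%R) <=
    2%:E * Hr_sqnorm r a + 2%:E * Hr_sqnorm r h)%E.
  rewrite /Hr_sqnorm -!nneseriesZl; last 2 first.
  - by move=> j _; rewrite lee_fin Hr_term_ge0.
  - by move=> j _; rewrite lee_fin Hr_term_ge0.
  rewrite -nneseriesD; last 2 first.
  - by move=> j _ _; rewrite -EFinM lee_fin mulr_ge0// Hr_term_ge0.
  - by move=> j _ _; rewrite -EFinM lee_fin mulr_ge0// Hr_term_ge0.
  apply: lee_nneseries => j _.
    by move=> _; rewrite lee_fin (Hr_term_ge0 r (fun j => a j - h j)).
  rewrite -!EFinM -EFinD lee_fin.
  rewrite [leRHS](_ : _ = j.+1%:R `^ (2 * r) * (2 * a j ^+ 2 + 2 * h j ^+ 2)).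
    2: by ring.
  apply: ler_wpM2l; first exact: powR_ge0.
  by have := sqr_ge0 (a j + h j); rewrite !expr2; lra.
apply: (le_lt_trans le).
by apply: lte_add_pinfty; apply: lte_mul_pinfty.
Qed.

Lemma dual_pairing_finite g h N : (forall j, (N <= j)%N -> h j = 0) ->
  dual_pairing g h = \sum_(j < N) g j * h j.
Proof.
move=> hN; apply: cvg_lim => //.
apply: cvg_near_cst; near=> m.
have Nm : (N <= m)%N by near: m; exists N.
rewrite /series /= (@big_cat_nat _ _ _ N)//= big_mkord.
rewrite [X in _ + X]big_nat_cond [X in _ + X]big1 ?addr0//.
by move=> j /andP[/andP[Nj _] _]; rewrite hN// mulr0.
Unshelve. all: by end_near. Qed.

End weighted_sequences.

(** * From the Hilbert space to whitened coordinates *)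

Section whitening.
Context {R : realType} {H : completeNormedModType R}.
Variables (ip : {dot H for @idfun R}) (phi : nat -> H) (lambda : nat -> R).
Variables (C : {linear H -> H}) (Psi : H -> R) (gradPsi : H -> nat -> R).
Hypothesis ortho : forall i j, ip (phi i) (phi j) = (i == j)%:R.
Hypothesis lambda_gt0 : forall j, 0 < lambda j.
Hypothesis eigen : forall j, C (phi j) = lambda j ^+ 2 *: phi j.

(** The map C_N^(1/2), from R^N onto X^N. *)
Definition unwhiten {N} (z : 'I_N -> R) : H :=
  \sum_(j < N) (lambda j * z j) *: phi j.

Definition wpotential {N} (z : 'I_N -> R) : R := Psi (unwhiten z).

(** The function C_N^(1/2) grad Psi. *)
Definition wgrad {N} (z : 'I_N -> R) (i : 'I_N) : R :=
  lambda i * gradPsi (unwhiten z) i.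

Definition whiten N (x : H) (i : 'I_N) : R := (lambda i)^-1 * hcoord ip phi x i.

Let lambda_neq0 j : lambda j != 0. Proof. by rewrite gt_eqF. Qed.

Lemma hcoord_sum N (a : 'I_N -> R) j :
  hcoord ip phi (\sum_(i < N) a i *: phi i) j = \sum_(i < N | i == j :> nat) a i.
Proof.
rewrite /hcoord linear_sumlz [RHS]big_mkcond/=; apply: eq_bigr => i _.
rewrite linearZl_LR/= ortho; by case: eqP => _; rewrite ?mulr1 ?mulr0.
Qed.

Lemma hcoord_ord N (a : 'I_N -> R) (j : 'I_N) :
  hcoord ip phi (\sum_(i < N) a i *: phi i) j = a j.
Proof. by rewrite hcoord_sum (big_pred1 j). Qed.

Lemma hcoord_beyond N (a : 'I_N -> R) j : (N <= j)%N ->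
  hcoord ip phi (\sum_(i < N) a i *: phi i) j = 0.
Proof.
move=> Nj; rewrite hcoord_sum big_pred0// => i.
by rewrite ltn_eqF// (leq_trans (ltn_ord i)).
Qed.

Lemma unwhitenD N (z z' : 'I_N -> R) :
  unwhiten z + unwhiten z' = unwhiten (fun i => z i + z' i).
Proof.
by rewrite -big_split; apply: eq_bigr => i _ /=; rewrite -scalerDl -mulrDr.
Qed.

Lemma unwhitenZ N a (z : 'I_N -> R) :
  a *: unwhiten z = unwhiten (fun i => a * z i).
Proof.
by rewrite scaler_sumr; apply: eq_bigr => i _; rewrite scalerA mulrCA.
Qed.

Lemma unwhitenB N (z z' : 'I_N -> R) :
  unwhiten z - unwhiten z' = unwhiten (fun i => z i - z' i).
Proof.
rewrite -scaleN1r unwhitenZ unwhitenD; congr unwhiten.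
by apply/funext => i; rewrite mulN1r.
Qed.

Lemma projXN_unwhiten N (z : 'I_N -> R) :
  projXN ip phi N (unwhiten z) = unwhiten z.
Proof.
by rewrite /projXN /synthXN; apply: eq_bigr => i _; rewrite hcoord_ord.
Qed.

Lemma projXN_whiten N x : projXN ip phi N x = unwhiten (@whiten N x).
Proof.
by rewrite /projXN /synthXN; apply: eq_bigr => i _; rewrite mulVKf.
Qed.

Lemma drift_unwhiten N (z : 'I_N -> R) :
  CN ip phi C N (gradPsiN ip phi gradPsi N (unwhiten z)) = unwhiten (wgrad z).
Proof.
rewrite /CN /gradPsiN projXN_unwhiten.
have -> : projXN ip phi N (synthXN phi N (gradPsi (unwhiten z))) =
          synthXN phi N (gradPsi (unwhiten z)).
  by rewrite /projXN /synthXN; apply: eq_bigr => i _; rewrite hcoord_ord.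
have -> : C (synthXN phi N (gradPsi (unwhiten z))) = unwhiten (wgrad z).
  rewrite /synthXN linear_sum; apply: eq_bigr => i _.
  by rewrite linearZ/= eigen scalerA mulrC expr2 -mulrA.
exact: projXN_unwhiten.
Qed.

Lemma proposal_unwhiten N delta (z xi : 'I_N -> R) :
  proposal ip phi lambda C gradPsi delta (unwhiten z) xi =
  unwhiten (wproposal wgrad delta z xi).
Proof.
rewrite /proposal drift_unwhiten.
have -> : sqrtCN ip phi lambda N (\sum_(j < N) xi j *: phi j) = unwhiten xi.
  by rewrite /sqrtCN; apply: eq_bigr => i _; rewrite hcoord_ord.
by rewrite unwhitenD !unwhitenZ unwhitenB unwhitenD.
Qed.

Lemma sqnormCN_unwhiten N (z : 'I_N -> R) :
  sqnormCN ip phi lambda N (unwhiten z) = dot z z.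
Proof.
apply: eq_bigr => i _; rewrite hcoord_ord exprMn mulrAC divff ?mul1r//.
by rewrite expf_neq0.
Qed.

Lemma rescaled_norm_unwhiten N (z : 'I_N -> R) :
  rescaled_norm ip phi lambda N (unwhiten z) = N%:R^-1 * dot z z.
Proof.
congr (_ * _); rewrite -sqnormCN_unwhiten; apply: eq_bigr => i _.
by rewrite real_normK ?num_real.
Qed.

Lemma rescaled_norm_whiten N x :
  rescaled_norm ip phi lambda N x = N%:R^-1 * dot (@whiten N x) (@whiten N x).
Proof.
congr (_ * _); apply: eq_bigr => i _; rewrite real_normK ?num_real//.
by rewrite /whiten mulrACA -expr2 -expr2 exprVn mulrC.
Qed.

(** The cross terms in the exponents of the proposal densities give
    (z' - z).(z + g z + z' + g z') / 2, whose part (|z'|^2 - |z|^2) / 2 cancels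
    the quadratic part of the target density. *)
Lemma acceptance_unwhiten N (delta : R) (z z' : 'I_N -> R) : delta != 0 ->
  acceptance ip phi lambda C Psi gradPsi N delta (unwhiten z) (unwhiten z') =
  waccept wpotential wgrad delta z z'.
Proof.
move=> delta0; congr (Num.min 1 _).
rewrite /target_density /proposal_density /PsiN !projXN_unwhiten.
rewrite !drift_unwhiten !unwhitenD !unwhitenZ !unwhitenB !unwhitenD.
rewrite !sqnormCN_unwhiten -!expRD -expRN -expRD; congr expR.
rewrite /log_ratio /wpotential.
move: (wgrad z) (wgrad z') => a b; rewrite !dotE.
rewrite (dotC z' z) (dotC a z) (dotC b z) (dotC a z') (dotC b z').
by field.
Qed.

Lemma mala_step_unwhiten N (delta : R) (z xi : 'I_N -> R) u : delta != 0 ->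
  mala_step ip phi lambda C Psi gradPsi delta (unwhiten z) xi u =
  unwhiten (wstep wpotential wgrad delta z xi u).
Proof.
move=> delta0; rewrite /mala_step proposal_unwhiten acceptance_unwhiten//.
rewrite /wstep; case: ifP => _; first by rewrite scale1r subrr scale0r addr0.
by rewrite scale0r add0r subr0 scale1r.
Qed.

Lemma mala_chain_unwhiten N (delta : R) x0 (xi : nat -> 'I_N -> R) u k : delta != 0 ->
  mala_chain ip phi lambda C Psi gradPsi delta x0 xi u k =
  unwhiten (wchain wpotential wgrad delta (@whiten N x0) xi u k).
Proof.
move=> delta0; elim: k => [|k IH]; first exact: projXN_whiten.
by rewrite /= IH mala_step_unwhiten.
Qed.

End whitening.

(** * The potential in whitened coordinates *)

Section whitened_potential.
Context {R : realType} {H : completeNormedModType R}.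
Variables (ip : {dot H for @idfun R}) (phi : nat -> H) (lambda : nat -> R).
Variables (Psi : H -> R) (gradPsi : H -> nat -> R) (kappa s K c : R).
Hypothesis ortho : forall i j, ip (phi i) (phi j) = (i == j)%:R.
Hypothesis lambda_gt0 : forall j, 0 < lambda j.
Hypothesis c_ge0 : 0 <= c.
Hypothesis lambda_le : forall j, lambda j <= c * j.+1%:R `^ (- kappa).
Hypothesis s_lt : s < kappa - 2^-1.
Hypothesis K_ge0 : 0 <= K.
Hypothesis potential : potential_assumption ip phi s K Psi gradPsi.

Local Notation unwhiten := (unwhiten phi lambda).
Local Notation wpotential := (wpotential phi lambda Psi).
Local Notation wgrad := (wgrad phi lambda gradPsi).

Definition sobolev_weight {N} (i : 'I_N) : R := i.+1%:R `^ s * lambda i.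

Local Notation sw := (@sobolev_weight _).

Lemma sobolev_normE N (z : 'I_N -> R) :
  Hr_sqnorm s (hcoord ip phi (unwhiten z)) = (wnrm sw z ^+ 2)%:E.
Proof.
rewrite (@Hr_sqnorm_finite _ _ _ N) => [|j Nj]; last exact: hcoord_beyond.
congr EFin; rewrite sqr_nrm; apply: eq_bigr => i _.
by rewrite hcoord_ord// /sobolev_weight -powR_sqr; ring.
Qed.

Lemma in_Hs_unwhiten N (z : 'I_N -> R) : in_Hs ip phi s (unwhiten z).
Proof. by rewrite /in_Hs /in_Hr sobolev_normE ltry. Qed.

Lemma Hs_norm_unwhiten N (z : 'I_N -> R) :
  Hs_norm ip phi s (unwhiten z) = wnrm sw z.
Proof.
by rewrite /Hs_norm /Hr_norm sobolev_normE/= sqrtr_sqr ger0_norm ?wnrm_ge0.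
Qed.

Lemma whiten_norm_le N x : in_Hs ip phi s x ->
  wnrm sw (@whiten _ _ ip phi lambda N x) <= Hs_norm ip phi s x.
Proof.
move=> xs; apply: nrm_le; first exact: sqrtr_ge0.
apply: le_trans (Hr_norm_partial N xs); rewrite le_eqVlt; apply/orP; left.
apply/eqP; apply: eq_bigr => i _; rewrite /sobolev_weight /whiten -powR_sqr.
by rewrite -(mulrA (_ `^ s)) mulVKf ?gt_eqF// -expr2 exprMn.
Qed.

(** The squared weights are O(j^(2 s - 2 kappa)) and 2 kappa - 2 s > 1. *)
Lemma sobolev_weight_bound : exists2 W : R, 0 <= W &
  forall N, dot (@sobolev_weight N) sw <= W ^+ 2.
Proof.
have [|Z Z0 hZ] := @zeta_bounded R (2 * kappa - 2 * s).
  by have := s_lt; lra.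
exists (c * Num.sqrt Z) => [|N]; first by rewrite mulr_ge0 ?sqrtr_ge0.
rewrite exprMn sqr_sqrtr//; apply: le_trans (ler_wpM2l (sqr_ge0 c) (hZ N)).
rewrite /dot mulr_sumr; apply: ler_sum => i _; rewrite -expr2 exprMn powR_sqr.
apply: (@le_trans _ _
    (i.+1%:R `^ (2 * s) * (c * i.+1%:R `^ (- kappa)) ^+ 2)).
  rewrite ler_wpM2l ?powR_ge0// ler_sqr ?nnegrE ?mulr_ge0 ?powR_ge0//.
  exact: ltW.
rewrite exprMn powR_sqr mulrCA ler_wpM2l ?sqr_ge0// -powRD ?pnatr_eq0/= ?implybT//.
by rewrite (_ : 2 * s + 2 * - kappa = - (2 * kappa - 2 * s)) //; ring.
Qed.

(** Since s < kappa, the operator C^(1/2) maps H^-s boundedly into H. *)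
Lemma wgrad_norm_le N (a : nat -> R) : in_Hr (- s) a ->
  nrm (fun i : 'I_N => lambda i * a i) <= c * Hr_norm (- s) a.
Proof.
move=> as_; apply: nrm_le; first by rewrite mulr_ge0 ?sqrtr_ge0.
rewrite exprMn; apply: le_trans (ler_wpM2l (sqr_ge0 c) (Hr_norm_partial N as_)).
rewrite /dot mulr_sumr; apply: ler_sum => i _.
rewrite -expr2 exprMn [leRHS]mulrA ler_wpM2r ?sqr_ge0// -powR_sqr -exprMn.
rewrite ler_sqr ?nnegrE ?mulr_ge0 ?powR_ge0// ?(ltW (lambda_gt0 _))//.
apply: le_trans (lambda_le i) _; rewrite ler_wpM2l//.
by rewrite ler_powR ?ler1n// lerN2; have := s_lt; lra.
Qed.

(** Cauchy-Schwarz with the weights j^s and j^-s: the duality between H^s and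
    H^-s. *)
Lemma weighted_pairing_le N (u : 'I_N -> R) (a : nat -> R) : in_Hr (- s) a ->
  `|dot u (fun i => lambda i * a i)| <= Hr_norm (- s) a * wnrm sw u.
Proof.
move=> as_; pose v (i : 'I_N) : R := i.+1%:R `^ (- s) * a i.
have -> : dot u (fun i => lambda i * a i) = dot v (fun i => sw i * u i).
  apply: eq_bigr => i _; rewrite /v /sobolev_weight powRN.
  by rewrite [RHS](_ : _ = (i.+1%:R `^ s)^-1 * i.+1%:R `^ s * (u i * (lambda i * a i)));
    [rewrite mulVf ?mul1r// gt_eqF// powR_gt0|ring].
apply: le_trans (cauchy_schwarz _ _) _; rewrite ler_wpM2r ?wnrm_ge0//.
apply: nrm_le; first exact: sqrtr_ge0.
apply: le_trans (Hr_norm_partial N as_); rewrite le_eqVlt; apply/orP; left.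
by apply/eqP; apply: eq_bigr => i _; rewrite -expr2 exprMn powR_sqr.
Qed.

Let gradPsi_in N (z : 'I_N -> R) : in_Hr (- s) (gradPsi (unwhiten z)).
Proof. by case: potential => + _ _ _; apply; exact: in_Hs_unwhiten. Qed.

Let gradPsi_le N (z : 'I_N -> R) : Hr_norm (- s) (gradPsi (unwhiten z)) <= K.
Proof. by case: potential => _ _ + _; apply; exact: in_Hs_unwhiten. Qed.

Lemma wgrad_pairing_le N (z u : 'I_N -> R) :
  `|dot u (wgrad z)| <= K * wnrm sw u.
Proof.
apply: le_trans (weighted_pairing_le u (gradPsi_in z)) _.
by rewrite ler_wpM2r ?wnrm_ge0.
Qed.

(** The directions are in X^N, where the duality pairing is a finite sum. *)
Lemma wpotential_derive N (z u : 'I_N -> R) (t : R) :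
  is_derive t (1 : R) (fun t => wpotential (fun i => z i + t * u i))
    (dot u (wgrad (fun i => z i + t * u i))).
Proof.
set zt := fun i => z i + t * u i; set d := dot u _.
have dPsi : Hs_derivative_at ip phi s Psi (unwhiten zt) (gradPsi (unwhiten zt)).
  by case: potential => _ + _ _; apply; exact: in_Hs_unwhiten.
have cv : h^-1 *: (wpotential (fun i => z i + (h + t) * u i) - wpotential zt)
    @[h --> (0 : R)^'] --> d.
  apply/cvgrPdist_le => e e0.
  pose e' := e / (wnrm sw u + 1).
  have w1 : 0 < wnrm sw u + 1 by rewrite ltr_pwDr ?wnrm_ge0.
  have [r r0 hr] := dPsi e' (divr_gt0 e0 w1).
  near=> h.
  have h0 : h != 0 by near: h; exact: nbhs_dnbhs_neq.
  have hr' : `|h| < r / (wnrm sw u + 1).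
    near: h; apply: dnbhs0_lt; exact: divr_gt0.
  have nh : Hs_norm ip phi s (unwhiten (fun i => h * u i)) = `|h| * wnrm sw u.
    by rewrite Hs_norm_unwhiten wnrmZ.
  have := hr _ (in_Hs_unwhiten (fun i => h * u i)).
  rewrite nh unwhitenD.
  have -> : dual_pairing (gradPsi (unwhiten zt))
      (hcoord ip phi (unwhiten (fun i => h * u i))) = h * d.
    rewrite (@dual_pairing_finite _ _ _ N) => [|j Nj]; last exact: hcoord_beyond.
    rewrite /d /dot mulr_sumr; apply: eq_bigr => i _.
    by rewrite hcoord_ord// /wgrad; ring.
  have -> : (fun i => zt i + h * u i) = (fun i => z i + (h + t) * u i).
    by apply/funext => i; rewrite /zt; ring.
  rewrite -/(wpotential _) -/(wpotential zt) => hh.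
  have {hh} : `|wpotential (fun i => z i + (h + t) * u i) - wpotential zt - h * d|
      <= e' * (`|h| * wnrm sw u).
    apply: hh; apply: (@le_lt_trans _ _ (`|h| * (wnrm sw u + 1))).
      by rewrite ler_wpM2l// lerDl.
    by rewrite -ltr_pdivlMr.
  set D := wpotential _ - _ => hD.
  rewrite -[d](mulKf h0) -scalerBr normrZ normfV ler_pdivrMl ?normr_gt0//.
  rewrite distrC; apply: le_trans hD _.
  rewrite /e' mulrCA ler_wpM2l// mulrAC ler_pdivrMr// ler_wpM2l ?(ltW e0)//.
  by rewrite lerDl.
have cv' : h^-1 *: (((fun t => wpotential (fun i => z i + t * u i)) \o shift t)
    (h *: (1 : R)) - wpotential zt) @[h --> (0 : R)^'] --> d.
  by under eq_fun do rewrite /= [_ *: 1]mulr1; exact: cv.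
apply: DeriveDef; first by apply/cvg_ex; exists d.
exact: cvg_lim.
Unshelve. all: by end_near. Qed.

(** Mean value theorem along the segment from z to z'. *)
Lemma wpotential_lip N (z z' : 'I_N -> R) :
  `|wpotential z - wpotential z'| <= K * wnrm sw (fun i => z' i - z i).
Proof.
pose u i := z' i - z i.
pose f (t : R) := wpotential (fun i => z i + t * u i).
have df (t : R) : is_derive t (1 : R) f (dot u (wgrad (fun i => z i + t * u i))).
  exact: wpotential_derive.
have [|t _] := @MVT_segment R f _ 0 1 ler01 (fun t _ => df t).
  apply: continuous_subspaceT => t.
  exact: (is_derive_continuous_at (df t)).
have -> : f 0 = wpotential z.
  by congr wpotential; apply/funext => i; rewrite mul0r addr0.
have -> : f 1 = wpotential z'.
  by congr wpotential; apply/funext => i; rewrite mul1r /u addrC subrK.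
rewrite subr0 mulr1 distrC => ->; exact: wgrad_pairing_le.
Qed.

Lemma wpotential_tame : exists W : R, forall N,
  tame_potential (@sobolev_weight N) wpotential wgrad
    (c * K) ((1 + c) * K) W.
Proof.
have [W W0 hW] := sobolev_weight_bound.
have KL : K <= (1 + c) * K by rewrite ler_peMl// lerDl.
have cKL : c * K <= (1 + c) * K by rewrite ler_wpM2r// lerDr.
exists W => N; split => //.
- by rewrite mulr_ge0.
- by rewrite mulr_ge0// addr_ge0.
- move=> z; apply: le_trans (wgrad_norm_le N (gradPsi_in z)) _.
  by rewrite ler_wpM2l.
- move=> z z'; apply: le_trans (wpotential_lip z z') _.
  by rewrite ler_wpM2r ?wnrm_ge0.
- move=> z z'.
  have -> : (fun i => wgrad z' i - wgrad z i) = (fun i : 'I_N => lambda i *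
      (gradPsi (unwhiten z') i - gradPsi (unwhiten z) i)).
    by apply/funext => i; rewrite mulrBr.
  apply: le_trans (wgrad_norm_le N (in_HrB (gradPsi_in z') (gradPsi_in z))) _.
  apply: le_trans (ler_wpM2r (wnrm_ge0 _ _) cKL); rewrite -mulrA ler_wpM2l//.
  rewrite -Hs_norm_unwhiten -unwhitenB.
  by case: potential => _ _ _; apply; exact: in_Hs_unwhiten.
- move=> z z'; set u := fun i => z' i - z i.
  rewrite dotDr; apply: le_trans (ler_normD _ _) _.
  rewrite -mulrA mulr2n mulrDl mul1r; apply: lerD;
    apply: le_trans (wgrad_pairing_le _ _) _;
    by rewrite ler_wpM2r ?wnrm_ge0.
Qed.

End whitened_potential.

Theorem theorem4p1 (R : realType) (H : completeNormedModType R)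
  (ip : {dot H for @idfun R}) (phi : nat -> H) (lambda : nat -> R)
  (C : {linear H -> H}) (Psi : H -> R) (gradPsi : H -> nat -> R)
  (kappa s K ell T : R) (x0 : H)
  (d : measure_display) (Omega : measurableType d) (P : probability Omega R)
  (xi : forall N : nat, nat -> 'I_N -> {RV P >-> R})
  (U : nat -> nat -> {RV P >-> R}) :
  norm_of_dot ip ->
  orthonormal_basis ip phi ->
  positive_trace_class ip phi C ->
  (forall j, 0 < lambda j) ->
  (forall j, C (phi j) = lambda j ^+ 2 *: phi j) ->
  2^-1 < kappa ->
  asymp_power lambda kappa ->
  0 <= s ->
  s < kappa - 2^-1 ->
  potential_assumption ip phi s K Psi gradPsi ->
  0 < ell ->
  0 < T ->
  Hs_cap ip phi lambda s x0 ->
  (forall N, mala_noise (xi N) (U N)) ->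
  let x (N : nat) (w : Omega) (k : nat) : H :=
    mala_chain ip phi lambda C Psi gradPsi (ell / Num.sqrt N%:R) x0
      (fun k j => xi N k j w) (fun k => U N k w) k in
  let SN (N : nat) (w : Omega) : R -> R :=
    interpolant N (fun k => rescaled_norm ip phi lambda N (x N w k)) in
  let S0 : R := limn (fun N => rescaled_norm ip phi lambda N x0) in
  exists S : R -> R,
    [/\ ode_solution (drift ell) T S0 S,
        forall S' : R -> R, ode_solution (drift ell) T S0 S' ->
          {in `[0, T], S' =1 S} &
        cvg_in_probability_unif P T SN S].

Proof.
move=> _ [ortho _] _ lambda_gt0 eigen _ [c1 [c [_ c0 lam]]] _ s_lt pot ell0 T0
  [x0s x0cvg] noise x SN S0.
have c_ge0 := ltW c0.
have lambda_le j := proj2 (lam j).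
have K_ge0 : 0 <= K.
  by case: pot => _ _ + _ => /(_ _ x0s); apply: le_trans; exact: sqrtr_ge0.
have [W tame] := wpotential_tame ortho lambda_gt0 c_ge0 lambda_le s_lt K_ge0 pot.
(* One more unit of time than T, for the last grid point beyond T. *)
have T10 : 0 < T + 1 by rewrite addr_gt0.
have [S [SS0 dS]] := ode_exists ell0 S0 T10.
have dS' (t : R) : 0 <= t <= T -> is_derive t (1 : R) S (drift ell (S t)).
  by move=> /andP[t0 tT]; apply: dS; rewrite t0/= (le_trans tT)// lerDl.
have solS : ode_solution (drift ell) T S0 S.
  split=> //.
    apply: continuous_in_subspaceT => t; rewrite inE/= in_itv/= => tT.
    exact: (is_derive_continuous_at (dS' t tT)).
  by move=> t /andP[t0 tT]; apply: dS'; rewrite !ltW.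
exists S; split => //.
  by move=> S' solS'; exact: ode_unique T0 solS' solS.
pose z0 N := whiten ip phi lambda x0 : 'I_N -> R.
have SNE : SN = fun N w => interpolant N (fun k =>
    let z := chain_at (wpotential phi lambda Psi) (wgrad phi lambda gradPsi)
      (@xi N) (U N) (ell / Num.sqrt N%:R) (z0 N) w k in N%:R^-1 * dot z z).
  apply/funext => N; apply/funext => w; rewrite /SN; congr (interpolant N _).
  (* For N = 0 the step size is degenerate, but both sides vanish. *)
  apply/funext => k; case: N => [|N].
    by rewrite /rescaled_norm invr0 !mul0r.
  rewrite /x mala_chain_unwhiten// ?rescaled_norm_unwhiten//.
  by rewrite mulf_neq0 ?gt_eqF// invr_gt0 sqrtr_gt0.
rewrite SNE; apply: (white_limit tame noise ell0 T0 _ _ SS0 dS).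
  by move=> N; exact: whiten_norm_le.
rewrite (_ : (fun N => _) = fun N => rescaled_norm ip phi lambda N x0) //.
by apply/funext => N; rewrite rescaled_norm_whiten.
Qed.
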